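(* For a real number $\varepsilon>0$, set $$\theta_{\varepsilon}(S)=\left(y,-x\right),\qquad \theta_{\varepsilon}(R)=\left(\frac{x+\varepsilon y}{\varepsilon+xy},\ \varepsilon y\right).$$ Then: (1) For every real $\varepsilon>0$, $\theta_\varepsilon$ is an embedding (injective group homomorphism) of $\mathrm{SL}(2,\mathbb{Z})$ into the Cremona group $\mathrm{Bir}(\mathbb{P}^2)$ that preserves the type. (2) If $\varepsilon$ and $\varepsilon'$ are two distinct positive real numbers such that $\varepsilon\varepsilon'\neq 1$, then the subgroups $\theta_\varepsilon(\mathrm{SL}(2,\mathbb{Z}))$ and $\theta_{\varepsilon'}(\mathrm{SL}(2,\mathbb{Z}))$ are not conjugate in $\mathrm{Bir}(\mathbb{P}^2)$. (3) The standard embedding $\theta_s$ is conjugate to $\theta_1$ (by an element of $\mathrm{Bir}(\mathbb{P}^2)$).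
   Context: $\mathrm{Bir}(\mathbb{P}^2)$ is the group of birational self-maps of the complex projective plane. The notation $(p(x,y),q(x,y))$ denotes the birational map $(x,y)\dashrightarrow(p(x,y),q(x,y))$ of $\mathbb{C}^2$, viewed in $\mathrm{Bir}(\mathbb{C}^2)=\mathrm{Bir}(\mathbb{P}^2)$. $\mathrm{SL}(2,\mathbb{Z})$ is generated by $R=\begin{bmatrix}1&1\\0&1\end{bmatrix}$ and $S=\begin{bmatrix}0&1\\-1&0\end{bmatrix}$, with presentation $\langle R,S\mid S^4=(RS)^3=1,\ S^2(RS)=(RS)S^2\rangle$; saying that $\theta_\varepsilon$ is a homomorphism means that the given images of $R,S$ extend to a homomorphism on $\mathrm{SL}(2,\mathbb{Z})$. An element $M\in\mathrm{SL}(2,\mathbb{Z})$ is elliptic if it has finite order, parabolic if it has infinite order and trace $\pm2$, hyperbolic if it has infinite order and trace $\neq\pm2$. The degree of $f\in\mathrm{Bir}(\mathbb{P}^2)$ is the common degree of the homogeneous polynomials without common factor defining it, and $\lambda(f)=\lim_n(\deg f^n)^{1/n}$ is its first dynamical degree. $f$ is elliptic if $(\deg f^n)_n$ is bounded, parabolic if $(\deg f^n)_n$ grows linearly or quadratically, hyperbolic if $\lambda(f)>1$. An embedding $\theta\colon\mathrm{SL}(2,\mathbb{Z})\to\mathrm{Bir}(\mathbb{P}^2)$ preserves the type if it sends elliptic (resp. parabolic, resp. hyperbolic) elements to elliptic (resp. parabolic, resp. hyperbolic) maps. The standard embedding $\theta_s$ is $\begin{bmatrix}a&b\\c&d\end{bmatrix}\mapsto(x^ay^b,x^cy^d)$.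 *)

(* Defs.v *)
From HB Require Import structures.
From mathcomp Require Import all_boot all_order all_algebra fraction.
From mathcomp Require Import generic_quotient.
From mathcomp Require Import boolp classical_sets reals topology sequences exp.
From mathcomp Require Import complex mpoly.

Set Implicit Arguments.
Unset Strict Implicit.
Unset Printing Implicit Defensive.

Import Order.TTheory GRing.Theory Num.Theory.
Import numFieldTopology.Exports.

Local Open Scope classical_set_scope.
Local Open Scope quotient_scope.
Local Open Scope ring_scope.

Record SL2Z := MkSL2Z {
  SL2Z_mx :> 'M[int]_2;
  SL2Z_det : \det SL2Z_mx == 1 }.

HB.instance Definition _ := [isSub for SL2Z_mx].
HB.instance Definition _ := [Choice of SL2Z by <:].

Section SL2ZGroup.
Implicit Types M N : SL2Z.

Let one_subproof : \det (1%:M : 'M[int]_2) == 1.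
Proof. by rewrite det1. Qed.

Let mul_subproof M N : \det (M *m N) == 1.
Proof. by rewrite det_mulmx (eqP (SL2Z_det M)) (eqP (SL2Z_det N)) mulr1. Qed.

Let inv_subproof M : \det (\adj M) == 1.
Proof.
have /(congr1 determinant) := mul_mx_adj M.
by rewrite det_mulmx (eqP (SL2Z_det M)) mul1r det_scalar expr1n => ->.
Qed.

Definition SL2Z_one := MkSL2Z one_subproof.
Definition SL2Z_mul M N := MkSL2Z (mul_subproof M N).
Definition SL2Z_inv M := MkSL2Z (inv_subproof M).

Let mulA : associative SL2Z_mul.
Proof. by move=> M N P; apply/val_inj; rewrite /= mulmxA. Qed.
Let mul1 : left_id SL2Z_one SL2Z_mul.
Proof. by move=> M; apply/val_inj; rewrite /= mul1mx. Qed.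
Let mulr1 : right_id SL2Z_one SL2Z_mul.
Proof. by move=> M; apply/val_inj; rewrite /= mulmx1. Qed.
Let mulV : left_inverse SL2Z_one SL2Z_inv SL2Z_mul.
Proof. by move=> M; apply/val_inj; rewrite /= mul_adj_mx (eqP (SL2Z_det M)). Qed.
Let mulrV : right_inverse SL2Z_one SL2Z_inv SL2Z_mul.
Proof. by move=> M; apply/val_inj; rewrite /= mul_mx_adj (eqP (SL2Z_det M)). Qed.

HB.instance Definition _ := isGroup.Build SL2Z mulA mul1 mulr1 mulV mulrV.
End SL2ZGroup.

Definition mx2 (a b c d : int) : 'M[int]_2 :=
  \matrix_(i, j) nth 0 (nth [::] [:: [:: a; b]; [:: c; d]] i) j.

Lemma det_mx2 a b c d : \det (mx2 a b c d) = a * d - b * c.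
Proof.
by rewrite (expand_det_row _ ord0) !big_ord_recl big_ord0 /cofactor !det_mx11
  !mxE /= expr0 mul1r addr0 expr1 mulN1r mulrN.
Qed.

Fact SL2Z_R_subproof : \det (mx2 1 1 0 1) == 1.
Proof. by rewrite det_mx2. Qed.
Fact SL2Z_S_subproof : \det (mx2 0 1 (- 1) 0) == 1.
Proof. by rewrite det_mx2. Qed.

Definition SL2Z_R : SL2Z := MkSL2Z SL2Z_R_subproof.
Definition SL2Z_S : SL2Z := MkSL2Z SL2Z_S_subproof.

Definition finite_order (G : groupType) (x : G) : Prop :=
  exists n : nat, (0 < n)%N /\ (x ^+ n = 1)%g.

Definition elliptic_mx (M : SL2Z) : Prop := finite_order M.
Definition parabolic_mx (M : SL2Z) : Prop :=
  ~ finite_order M /\ (\tr M = 2 \/ \tr M = - 2).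
Definition hyperbolic_mx (M : SL2Z) : Prop :=
  ~ finite_order M /\ (\tr M <> 2 /\ \tr M <> - 2).

Section Cremona.
Variable K : fieldType.

(* A triple F stands for the rational map [x : y : z] |-> [F0 : F1 : F2]. *)
Local Notation triple := (3.-tuple {mpoly K[3]}).
Implicit Types (F G H : triple) (p : {mpoly K[3]}).

Definition rational_map F : Prop :=
  (exists d, forall i, tnth F i \is d.-homog) /\ (exists i, tnth F i != 0).

(* Proportionality: on nonzero triples, equality of the rational maps. *)
Definition same_map F G : bool :=
  [forall i, forall j, tnth F i * tnth G j == tnth F j * tnth G i].

Definition comp_triple F G : triple := [tuple tnth F i \mPo G | i < 3].

Definition id_triple : triple := [tuple 'X_i | i < 3].

(* The composite is undefined when comp_triple is zero, hence the requirement
   that it be a rational map. *)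
Definition right_inverse_map F G : Prop :=
  rational_map (comp_triple F G) /\ same_map (comp_triple F G) id_triple.

Definition birational F : Prop :=
  rational_map F /\
  exists G, [/\ rational_map G, right_inverse_map F G & right_inverse_map G F].

Lemma same_mapP F G :
  reflect (forall i j, tnth F i * tnth G j = tnth F j * tnth G i)
          (same_map F G).
Proof.
apply: (iffP forallP) => [h i j|h i]; first exact/eqP/(forallP (h i)).
by apply/forallP => j; apply/eqP.
Qed.

Lemma same_map_refl : reflexive same_map.
Proof. by move=> F; apply/same_mapP => i j; rewrite mulrC. Qed.

Lemma same_map_sym : ssrbool.symmetric same_map.
Proof.
move=> F G; apply/same_mapP/same_mapP => h i j;
  by rewrite mulrC -h mulrC.
Qed.

Lemma same_map_trans F G H : rational_map G ->
  same_map F G -> same_map G H -> same_map F H.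
Proof.
move=> [_ [k nzk]] /same_mapP FG /same_mapP GH; apply/same_mapP => i j.
apply: (mulfI nzk).
rewrite mulrA [tnth G k * _]mulrC FG -mulrA GH mulrA.
by rewrite -FG -mulrA mulrCA.
Qed.

Lemma same_map_neq0 F G k : rational_map G -> same_map F G ->
  tnth F k != 0 -> tnth G k != 0.
Proof.
move=> [_ [i nzi]] /same_mapP FG nzF; apply/negP => /eqP G0.
by move: (FG k i) => /eqP; rewrite G0 mulr0 mulf_eq0 (negbTE nzF) (negbTE nzi).
Qed.

Lemma tnth_comp F G i : tnth (comp_triple F G) i = tnth F i \mPo G.
Proof. by rewrite tnth_mktuple. Qed.

Lemma comp_mpolyA p F G : (p \mPo F) \mPo G = p \mPo comp_triple F G.
Proof.
rewrite (comp_mpolyE p F) (comp_mpolyE p) rmorph_sum /=; apply: eq_bigr => m _.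
rewrite linearZ rmorph_prod /=; congr (_ *: _); apply: eq_bigr => i _.
by rewrite rmorphXn /= tnth_comp.
Qed.

Lemma comp_tripleA F G H :
  comp_triple F (comp_triple G H) = comp_triple (comp_triple F G) H.
Proof. by apply: eq_from_tnth => i; rewrite !tnth_comp comp_mpolyA. Qed.

Lemma comp_triple_id F : comp_triple F id_triple = F.
Proof. by apply: eq_from_tnth => i; rewrite tnth_comp comp_mpoly_id. Qed.

Lemma comp_id_triple F : comp_triple id_triple F = F.
Proof.
apply: eq_from_tnth => i.
by rewrite tnth_comp tnth_mktuple comp_mpolyXU -tnth_nth.
Qed.

Lemma prod_homog F e (m : 'X_{1..3}) : (forall i, tnth F i \is e.-homog) ->
  \prod_(i < 3) tnth F i ^+ m i \is (e * mdeg m).-homog.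
Proof.
move=> hF; rewrite mdegE big_distrr /=.
apply: (big_ind2 (fun p d => p \is d.-homog)) => [|????|i _].
- exact: dhomog1.
- exact: dhomogM.
- exact: dhomogMn.
Qed.

Lemma comp_homog p F d e : p \is d.-homog -> (forall i, tnth F i \is e.-homog) ->
  p \mPo F \is (e * d).-homog.
Proof.
move=> /dhomogP hp hF; rewrite comp_mpolyE big_seq; apply: rpred_sum => m mp.
by apply: rpredZ; rewrite -(hp m mp); exact: prod_homog.
Qed.

Lemma comp_same_homog p F G d k : p \is d.-homog -> same_map F G ->
  tnth G k ^+ d * (p \mPo F) = tnth F k ^+ d * (p \mPo G).
Proof.
move=> /dhomogP hp /same_mapP FG; rewrite !comp_mpolyE !mulr_sumr.
rewrite big_seq [RHS]big_seq; apply: eq_bigr => m mp.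
rewrite -!scalerAr; congr (_ *: _); rewrite -(hp m mp) /= mdegE -!prodrXr -!big_split /=.
apply: eq_bigr => i _; rewrite -!exprMn mulrC; congr (_ ^+ _).
exact: FG.
Qed.

Lemma comp_same_neq0 p F G d : rational_map F -> rational_map G ->
  p \is d.-homog -> same_map F G -> p \mPo F != 0 -> p \mPo G != 0.
Proof.
move=> ratF ratG hp FG; have [_ [k nzF]] := ratF.
have nzG := same_map_neq0 ratG FG nzF.
apply: contra_neq => G0; move: (comp_same_homog k hp FG).
by rewrite G0 mulr0 => /eqP; rewrite mulf_eq0 expf_eq0 (negbTE nzG) andbF => /eqP.
Qed.

Lemma same_comp F F' G G' : rational_map F -> rational_map F' ->
  rational_map G -> rational_map G' -> same_map F F' -> same_map G G' ->
  same_map (comp_triple F G) (comp_triple F' G').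
Proof.
move=> [[d hF] _] _ [_ [k nzG]] ratG' /same_mapP FF' GG'.
have nzG' := same_map_neq0 ratG' GG' nzG.
apply/same_mapP => i j; rewrite !tnth_comp.
apply: (mulfI (expf_neq0 d nzG')).
rewrite !mulrA (comp_same_homog k (hF i) GG') (comp_same_homog k (hF j) GG').
by rewrite -!mulrA -!rmorphM FF'.
Qed.

Lemma rational_id : rational_map id_triple.
Proof.
split; first by exists 1 => i; rewrite tnth_mktuple dhomogX /= mdeg1.
by exists ord0; rewrite tnth_mktuple -msupp_eq0 msuppX.
Qed.

Lemma rational_comp F G : rational_map F -> birational G ->
  rational_map (comp_triple F G).
Proof.
move=> [[d hF] [i nzF]] [[[e hG] nzG] [H [ratH [ratGH GHid] _]]]; split.
  by exists (e * d)%N => j; rewrite tnth_comp; exact: comp_homog.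
exists i; rewrite tnth_comp; apply/negP => /eqP FG0.
have := comp_same_neq0 rational_id ratGH (hF i).
rewrite same_map_sym comp_mpoly_id => /(_ GHid nzF).
by rewrite -comp_mpolyA FG0 comp_mpoly0 eqxx.
Qed.

Lemma right_inverse_comp F F' G G' : birational F -> birational F' ->
  birational G -> birational G' ->
  right_inverse_map F G -> right_inverse_map F' G' ->
  right_inverse_map (comp_triple F F') (comp_triple G' G).
Proof.
move=> bF bF' bG bG' [ratFG FGid] [ratFG' FGid'].
have rc X Y := @rational_comp X Y.
have ratFFG : rational_map (comp_triple (comp_triple F F') G').
  rewrite -comp_tripleA; split.
    have [[[d hF] _] _] := bF; have [[e hG] _] := ratFG'.
    by exists (e * d)%N => i; rewrite tnth_comp; exact: comp_homog.
  have [[[d hF] [i nzF]] _] := bF; exists i; rewrite tnth_comp.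
  apply: (comp_same_neq0 rational_id ratFG' (hF i)).
    by rewrite same_map_sym.
  by rewrite comp_mpoly_id.
rewrite /right_inverse_map comp_tripleA; split; first exact: rc.
have [ratF _] := bF; have [ratG _] := bG.
have FF'G' : same_map (comp_triple (comp_triple F F') G') F.
  have := same_comp ratF ratF ratFG' rational_id (same_map_refl F) FGid'.
  by rewrite comp_triple_id comp_tripleA.
have FF'G'G := same_comp ratFFG ratF ratG ratG FF'G' (same_map_refl G).
exact: (same_map_trans ratFG FF'G'G FGid).
Qed.

Lemma birational_comp F G :
  birational F -> birational G -> birational (comp_triple F G).
Proof.
move=> bF bG; have [ratF [F' [ratF' FF' F'F]]] := bF.
have [ratG [G' [ratG' GG' G'G]]] := bG.
have bF' : birational F' by split=> //; exists F.
have bG' : birational G' by split=> //; exists G.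
split; first exact: rational_comp.
exists (comp_triple G' F'); split; first exact: rational_comp.
- exact: right_inverse_comp.
- exact: right_inverse_comp.
Qed.

Lemma birational_id : birational id_triple.
Proof.
have h : right_inverse_map id_triple id_triple.
  by split; rewrite comp_triple_id ?same_map_refl//; exact: rational_id.
by split; [exact: rational_id|exists id_triple; split=> //; exact: rational_id].
Qed.

Record birational_triple := BirationalTriple {
  birational_val :> 3.-tuple {mpoly K[3]};
  birational_valP : `[< birational birational_val >] }.

HB.instance Definition _ := [isSub for birational_val].
HB.instance Definition _ := [Choice of birational_triple by <:].
Implicit Types f g h : birational_triple.

Lemma birationalP f : birational f.
Proof. exact/asboolP/birational_valP. Qed.

Definition same_birational f g : bool := same_map f g.

Fact same_birational_refl : reflexive same_birational.
Proof. by move=> f; exact: same_map_refl. Qed.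
Fact same_birational_sym : ssrbool.symmetric same_birational.
Proof. by move=> f g; exact: same_map_sym. Qed.
Fact same_birational_trans : transitive same_birational.
Proof. by move=> g f h; exact/same_map_trans/(fst (birationalP g)). Qed.

Canonical same_birational_equiv := EquivRel same_birational
  same_birational_refl same_birational_sym same_birational_trans.

(* Bir(P^2) over K; the group law below is composition, (u * v)(p) = u (v p). *)
Definition Cremona := {eq_quot same_birational}.
HB.instance Definition _ := Choice.on Cremona.
HB.instance Definition _ := EqQuotient.on Cremona.

Definition birational_one := BirationalTriple (asboolT birational_id).
Definition birational_mul f g :=
  BirationalTriple (asboolT (birational_comp (birationalP f) (birationalP g))).

Lemma birational_invP f : exists g, right_inverse_map f g /\ right_inverse_map g f.
Proof.
have [ratf [G [ratG fG Gf]]] := birationalP f.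
have bG : birational G by split=> //; exists f.
exact: (ex_intro _ (BirationalTriple (asboolT bG)) (conj fG Gf)).
Qed.
Definition birational_inv f := sval (cid (birational_invP f)).

Implicit Types u v w : Cremona.
Definition Cremona_one : Cremona := \pi_Cremona birational_one.
Definition Cremona_mul u v : Cremona := \pi_Cremona (birational_mul (repr u) (repr v)).
Definition Cremona_inv u : Cremona := \pi_Cremona (birational_inv (repr u)).

Lemma Cremona_eqP f g : (\pi_Cremona f = \pi_Cremona g) <-> same_map f g.
Proof. by split=> [/eqquotP|?]; last exact/eqquotP. Qed.

Lemma Cremona_eq f g :
  birational_val f = birational_val g -> \pi_Cremona f = \pi_Cremona g.
Proof. by move=> /val_inj ->. Qed.

Lemma Cremona_piM f g :
  Cremona_mul (\pi_Cremona f) (\pi_Cremona g) = \pi_Cremona (birational_mul f g).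
Proof.
have rat h := fst (birationalP h).
by apply/Cremona_eqP/same_comp; try exact: rat; apply/Cremona_eqP; rewrite reprK.
Qed.

Opaque Cremona_mul.
Fact Cremona_mulA : associative Cremona_mul.
Proof.
elim/quotW=> f; elim/quotW=> g; elim/quotW=> h.
rewrite (Cremona_piM g h) (Cremona_piM f (birational_mul g h)).
rewrite (Cremona_piM f g) (Cremona_piM (birational_mul f g) h).
apply: Cremona_eq; exact: (comp_tripleA f g h).
Qed.
Fact Cremona_mul1 : left_id Cremona_one Cremona_mul.
Proof.
elim/quotW=> f; rewrite (Cremona_piM birational_one f).
apply: Cremona_eq; exact: (comp_id_triple f).
Qed.
Fact Cremona_mulr1 : right_id Cremona_one Cremona_mul.
Proof.
elim/quotW=> f; rewrite (Cremona_piM f birational_one).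
apply: Cremona_eq; exact: (comp_triple_id f).
Qed.
Fact Cremona_mulV : left_inverse Cremona_one Cremona_inv Cremona_mul.
Proof.
move=> u; rewrite -{2}[u]reprK (Cremona_piM (birational_inv (repr u)) (repr u)); apply/Cremona_eqP.
by have [_ []] := svalP (cid (birational_invP (repr u))).
Qed.
Fact Cremona_mulrV : right_inverse Cremona_one Cremona_inv Cremona_mul.
Proof.
move=> u; rewrite -{1}[u]reprK (Cremona_piM (repr u) (birational_inv (repr u))); apply/Cremona_eqP.
by have [[]] := svalP (cid (birational_invP (repr u))).
Qed.

Transparent Cremona_mul.

HB.instance Definition _ := isGroup.Build Cremona
  Cremona_mulA Cremona_mul1 Cremona_mulr1 Cremona_mulV Cremona_mulrV.

Definition no_common_factor F : Prop :=
  forall h : {mpoly K[3]}, (forall i, exists q, tnth F i = h * q) ->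
  h \is a GRing.unit.

Definition has_degree u (d : nat) : Prop :=
  exists f : birational_triple,
    [/\ \pi_Cremona f = u, forall i, tnth f i \is d.-homog & no_common_factor f].

(* [has_degree u] holds for exactly one d, because {mpoly K[3]} is a UFD. *)
Definition degree u : nat := xget 0%N [set d | has_degree u d].

(* K(x, y), with x and y the coordinates of the affine chart z = 1. *)
Definition ratfun := {fraction {mpoly K[2]}}.
HB.instance Definition _ := GRing.Field.on ratfun.
Definition ratC (c : K) : ratfun := tofrac c%:MP.
Definition ratX : ratfun := tofrac 'X_ord0.
Definition ratY : ratfun := tofrac 'X_ord_max.

Definition dehomog p : ratfun :=
  tofrac (p \mPo [tuple 'X_ord0; 'X_ord_max; 1]).

(* The pair (p, q) of rational functions such that u is (x, y) |-> (p, q) in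
   the chart [x : y : 1]. It does not depend on the representative, and it
   determines u; the third coordinate of a birational triple is never 0. *)
Definition affine_map u : ratfun * ratfun :=
  let F : triple := repr u in
  (dehomog F`_0 / dehomog F`_2, dehomog F`_1 / dehomog F`_2).

End Cremona.

Section DynamicalTypes.
Variable R : realType.
Implicit Types f : Cremona R[i].

Definition dyn_degree f : R :=
  limn (fun n => (degree (f ^+ n)%g)%:R `^ (n%:R^-1)).

(* d n = Theta (n ^ k). *)
Definition grows_like (d : nat -> nat) (k : nat) : Prop :=
  exists a b : R, [/\ 0 < a, 0 < b &
    \forall n \near \oo, a * n%:R ^+ k <= (d n)%:R <= b * n%:R ^+ k].

Definition elliptic_map f : Prop :=
  exists B : nat, forall n, (degree (f ^+ n)%g <= B)%N.

Definition parabolic_map f : Prop :=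
  grows_like (fun n => degree (f ^+ n)%g) 1 \/
  grows_like (fun n => degree (f ^+ n)%g) 2.

Definition hyperbolic_map f : Prop := 1 < dyn_degree f.

Definition preserves_type (theta : SL2Z -> Cremona R[i]) : Prop :=
  forall M, [/\ elliptic_mx M -> elliptic_map (theta M),
                parabolic_mx M -> parabolic_map (theta M) &
                hyperbolic_mx M -> hyperbolic_map (theta M)].

(* For theta a group morphism, these two values determine theta, since R and S
   generate SL(2, Z). *)
Definition is_theta (e : R) (theta : SL2Z -> Cremona R[i]) : Prop :=
  let x := ratX R[i] in let y := ratY R[i] in let c := ratC (e%:C)%C in
  affine_map (theta SL2Z_S) = (y, - x) /\
  affine_map (theta SL2Z_R) = ((x + c * y) / (c + x * y), c * y).

Definition is_standard (theta : SL2Z -> Cremona R[i]) : Prop :=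
  let x := ratX R[i] in let y := ratY R[i] in
  forall M : SL2Z,
    affine_map (theta M) = (x ^ M 0 0 * y ^ M 0 1, x ^ M 1 0 * y ^ M 1 1).

End DynamicalTypes.

(* Main.v *)
(* Types are read off the degrees. Up to conjugation and sign, an element of
   infinite order of SL(2, Z) is a positive word in R and L = S^-1 R^-1 S, pure
   when it is parabolic and mixed when it is hyperbolic. Composing theta(R) and
   theta(L) as pairs of fractions, the two fractions get degrees (m, n) which are
   multiplied by the matrix of the word. On the line x = y these fractions stay
   reduced: they have the same sign of real part at every point of C, whereas a
   cancellation would need the values +-1 and -+e (this uses e > 0). So the
   degrees of the word and of its image are comparable, and types are preserved;
   Fekete's lemma gives the convergence defining the dynamical degree, and unique
   factorization compares an arbitrary representative with a reduced one.

   For the non-conjugacy, theta_e(R) multiplies the coordinate y by e. If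
   theta_e(R) is conjugate to theta_e'(M), then M is parabolic, hence a conjugate
   of some +-R^n or its inverse. The line y = 0 is invariant under theta_e'(R)^n,
   which acts on it by x |-> x / e'^n and scales y by e'^n; comparing the lowest
   terms of an eigenfunction along this line shows that its eigenvalue is a power
   of e'^n, up to sign. So e is a power of e', and conversely.

   The standard embedding is conjugate to theta_1 by
   (x, y) |-> ((1 + x)/(1 - x), (1 + y)/(1 - y)). *)

From HB Require Import structures.
Require Import Defs.
From mathcomp Require Import all_boot all_order all_algebra fraction.
From mathcomp Require Import generic_quotient.
From mathcomp Require Import boolp classical_sets reals topology sequences exp.
From mathcomp Require Import -(notations) normedtype.
From mathcomp Require Import complex mpoly.
From mathcomp Require Import ring lra zify.

Set Implicit Arguments.
Unset Strict Implicit.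
Unset Printing Implicit Defensive.

Import Order.TTheory GRing.Theory Num.Theory.
Import numFieldTopology.Exports numFieldNormedType.Exports.

Local Open Scope classical_set_scope.
Local Open Scope quotient_scope.
Local Open Scope ring_scope.

(** * Unique factorization in polynomial rings *)

(** The obstacle is the lower bound for degrees. A triple obtained by composition may carry a common
    factor, and [degree] refers to a representative without one, so the composed triple alone gives
    only an upper bound. Restriction to a line can only lose degree, so it is enough to see the
    fractions reduced on one line; x = y is chosen because the two initial fractions coincide there,
    which gives them real parts of equal sign from the start. The signs stay equal because the real
    part of a new fraction is, up to a positive factor, a positively weighted sum of the two old
    ones.

    The same bound gives injectivity: a nonempty positive word has powers of degree above 1, and the
    other classes are torsion, excluded through the images of S^2 and R. That theta exists at all is
    read from the presentation: words are rewritten to a normal form valid in every group with these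
    relations, and one whose matrix is 1 is trivial.

    For non-conjugacy, squares are compared: the central -1 has square 1, so signs disappear, and
    positivity of e and e' allows taking square roots at the end. *)

Definition divides (A : idomainType) (a b : A) : Prop := exists c, b = c * a.

Definition irreducible_elt (A : idomainType) (p : A) : Prop :=
  [/\ p != 0, p \isn't a GRing.unit &
      forall a b, p = a * b -> a \is a GRing.unit \/ b \is a GRing.unit].

(** An additive measure stands in for the ascending chain condition: splitting off a non-unit
    strictly lowers [w], which drives the inductions below. *)
Definition factorial_measure (A : idomainType) (w : A -> nat) : Prop :=
  (forall a b, a != 0 -> b != 0 -> w (a * b) = (w a + w b)%N) /\
  (forall a, a != 0 -> w a = 0%N -> a \is a GRing.unit).

Definition factorial_ring (A : idomainType) : Prop :=
  (exists w : A -> nat, factorial_measure w) /\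
  (forall p a b : A, irreducible_elt p -> divides p (a * b) ->
    divides p a \/ divides p b).

Section Factorial.
Variables (A : idomainType) (w : A -> nat).
Hypothesis wP : factorial_measure w.

Lemma measure_gt0 (a : A) : a != 0 -> a \isn't a GRing.unit -> (0 < w a)%N.
Proof. by move=> a0; rewrite lt0n; apply: contra => /eqP; exact: wP.2. Qed.

Lemma irreducible_factor (a : A) : a != 0 -> a \isn't a GRing.unit ->
  exists2 p, irreducible_elt p & divides p a.
Proof.
have [n] := ubnP (w a); elim: n a => // n IH a /ltnSE le_an a0 aU.
case: (pselect (irreducible_elt a)) => [irr|nirr].
  by exists a => //; exists 1; rewrite mul1r.
have [b [c [eq_a bU cU]]] : exists b c, [/\ a = b * c,
    b \isn't a GRing.unit & c \isn't a GRing.unit].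
  apply: contrapT => h; apply: nirr; split=> // b c eq_a.
  case: (boolP (b \is a GRing.unit)) => [|bU]; first by left.
  case: (boolP (c \is a GRing.unit)) => [|cU]; first by right.
  by case: h; exists b, c.
have b0 : b != 0 by apply: contraNneq a0 => b0; rewrite eq_a b0 mul0r.
have c0 : c != 0 by apply: contraNneq a0 => c0; rewrite eq_a c0 mulr0.
have [|p irr [d eq_b]] := IH b _ b0 bU.
  apply: leq_trans le_an; rewrite eq_a wP.1 // -[ltnLHS]addn0 ltn_add2l.
  exact: measure_gt0.
by exists p => //; exists (d * c); rewrite eq_a eq_b; ring.
Qed.

Hypothesis primeP : forall p a b : A, irreducible_elt p -> divides p (a * b) ->
  divides p a \/ divides p b.

Lemma irreducible_measure (p : A) : irreducible_elt p -> (0 < w p)%N.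
Proof. by case=> p0 pU _; exact: measure_gt0. Qed.

(** Each irreducible factor of [a] fails to divide some [F i], hence divides [b] by primality; it is
    cancelled from [a] and [b], and the measure of [a] drops. *)
Lemma coprime_family_dvd (I : Type) (F : I -> A) (a b : A) :
  (forall h : A, (forall i, divides h (F i)) -> h \is a GRing.unit) ->
  a != 0 -> (forall i, divides a (b * F i)) -> divides a b.
Proof.
move=> copF; have [n] := ubnP (w a); elim: n a b => // n IH a b /ltnSE le_an a0 aF.
case: (boolP (a \is a GRing.unit)) => [aU|aU].
  by exists (b * a^-1); rewrite mulrVK.
have [p irr [a' eq_a]] := irreducible_factor a0 aU.
have [i npF] : exists i, ~ divides p (F i).
  by apply: contrapT => /forallNP h; case: irr => _ /negP[]; apply: copF => i;
    apply: contrapT; exact: h.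
have p0 : p != 0 by case: irr.
have pb : divides p b.
  have [|//|//] := @primeP p b (F i) irr.
  by have [c ->] := aF i; exists (c * a'); rewrite eq_a; ring.
have [b' eq_b] := pb.
have a'0 : a' != 0 by apply: contraNneq a0 => a'0; rewrite eq_a a'0 mul0r.
have [||j|c eq_b'] := IH a' b' => //.
- apply: leq_trans le_an; rewrite eq_a wP.1 // -[ltnLHS]addn0 ltn_add2l.
  exact: irreducible_measure.
- have [c] := aF j; rewrite eq_a eq_b => e; exists c; apply: (mulfI p0).
  by transitivity (b' * p * F j); [ring|rewrite e; ring].
by exists c; rewrite eq_b eq_b' eq_a; ring.
Qed.

End Factorial.

(** * Gauss's lemma: univariate polynomials over a factorial ring *)

Section Gauss.
Variables (A : idomainType).
Hypothesis factA : factorial_ring A.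
Implicit Types (p q f g h : {poly A}).

Let dvdC_coef c p : divides c%:P p <-> forall i, divides c p`_i.
Proof.
split=> [[q ->] i|h]; first by exists q`_i; rewrite coefMC.
pose d i := sval (cid (h i)).
have dE i : p`_i = d i * c := svalP (cid (h i)).
exists (\poly_(i < size p) d i); apply/polyP => i.
rewrite coefMC coef_poly; case: ltnP => [_|ge]; first exact: dE.
by rewrite nth_default // mul0r.
Qed.

Lemma divides_sub (B : idomainType) (a b c : B) :
  divides a b -> divides a c -> divides a (b - c).
Proof. by move=> [d ->] [e ->]; exists (d - e); rewrite mulrBl. Qed.

Lemma size_sub_lead f : f != 0 ->
  (size (f - (lead_coef f)%:P * 'X^((size f).-1))%R < size f)%N.
Proof.
move=> f0; rewrite -{2}(prednK (n := size f)) ?size_poly_gt0 // ltnS.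
apply/leq_sizeP => j; rewrite leq_eqVlt => /orP[/eqP<-|lt_j].
  by rewrite coefB coefCM coefXn eqxx mulr1 lead_coefE subrr.
rewrite coefB coefCM coefXn gtn_eqF // mulr0 subr0 nth_default //.
by rewrite -(prednK (n := size f)) ?size_poly_gt0.
Qed.

(** Since [c] divides the product of the leading coefficients, it divides one of them; removing that
    leading term keeps the hypothesis and shortens one factor. *)
Lemma prime_polyC c f g : irreducible_elt c ->
  divides c%:P (f * g) -> divides c%:P f \/ divides c%:P g.
Proof.
move=> irr.
have [n] := ubnP (size f + size g)%N; elim: n f g => // n IH f g /ltnSE le_n cfg.
have [->|f0] := eqVneq f 0; first by left; exists 0; rewrite mul0r.
have [->|g0] := eqVneq g 0; first by right; exists 0; rewrite mul0r.
have : divides c (lead_coef f * lead_coef g).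
  by rewrite -lead_coefM lead_coefE; apply: (dvdC_coef _ _).1.
have dvdCM p a : divides c a -> divides c%:P (p * (a%:P * 'X^((size p).-1))).
  by move=> [d ->]; exists (p * (d%:P * 'X^((size p).-1))); rewrite polyCM; ring.
have dvdT a p : divides c a -> divides c%:P (a%:P * p).
  by move=> [d ->]; exists (d%:P * p); rewrite polyCM; ring.
move=> /(factA.2 _ _ _ irr)[cl|cl].
- pose t := (lead_coef f)%:P * 'X^((size f).-1); have ct := dvdT _ 'X^((size f).-1) cl.
  case: (IH (f - t) g) => [||cf|cg]; [| |left|by right].
  + by apply: leq_trans le_n; rewrite ltn_add2r size_sub_lead.
  + rewrite mulrBl; apply: divides_sub => //.
    by rewrite -mulrA; exact: dvdT.
  + rewrite -[f](subrK t) -[t in _ + t]opprK; apply: divides_sub => //.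
    by case: ct => d e; exists (- d); rewrite /t e mulNr.
- pose t := (lead_coef g)%:P * 'X^((size g).-1); have ct := dvdT _ 'X^((size g).-1) cl.
  case: (IH f (g - t)) => [||cf|cg]; [| |by left|right].
  + by apply: leq_trans le_n; rewrite ltn_add2l size_sub_lead.
  + rewrite mulrBr; apply: divides_sub => //.
    by rewrite mulrCA; exact: dvdT.
  + rewrite -[g](subrK t) -[t in _ + t]opprK; apply: divides_sub => //.
    by case: ct => d e; exists (- d); rewrite /t e mulNr.
Qed.

Let primitive f := forall c : A, irreducible_elt c -> ~ divides c%:P f.

Let polyC_neq0 (c : A) : c != 0 -> c%:P != 0. Proof. by rewrite polyC_eq0. Qed.

Lemma primitive_part f : f != 0 ->
  exists2 c : A, c != 0 & exists2 g, f = c%:P * g & primitive g.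
Proof.
have [[w wP] _] := factA.
have [n] := ubnP (w (lead_coef f)); elim: n f => // n IH f /ltnSE le_n f0.
case: (pselect (primitive f)) => [pf|].
  by exists 1; rewrite ?oner_neq0 //; exists f; rewrite ?mul1r.
move=> /existsNP[c /not_implyP[irr /contrapT[g eq_f]]].
have c0 : c != 0 by case: irr.
have g0 : g != 0 by apply: contraNneq f0 => g0; rewrite eq_f g0 mul0r.
have [||d d0 [h eq_g ph]] := IH g => //.
  apply: leq_trans le_n; rewrite eq_f lead_coefM lead_coefC wP.1 ?lead_coef_eq0 //.
  by rewrite -[ltnLHS]addn0 ltn_add2l (irreducible_measure wP).
by exists (c * d); rewrite ?mulf_neq0 //; exists h; rewrite // eq_f eq_g polyCM; ring.
Qed.

(** The irreducible factors of [c] divide [q * f] but not the primitive [f], so [prime_polyC]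
    cancels them from [q] one at a time. This clears the constants left by pseudo-division. *)
Lemma primitive_cancel f g q (c : A) : primitive f -> c != 0 ->
  c%:P * g = q * f -> divides f g.
Proof.
have [[w wP] _] := factA => pf.
have [n] := ubnP (w c); elim: n c q => // n IH c q /ltnSE le_n c0 e.
case: (boolP (c \is a GRing.unit)) => cU.
  exists (c^-1%:P * q); rewrite -mulrA -e mulrA -polyCM mulVr //.
  by rewrite mul1r.
have [p irr [c' eq_c]] := irreducible_factor wP c0 cU.
have p0 : p != 0 by case: irr.
have c'0 : c' != 0 by apply: contraNneq c0 => c'0; rewrite eq_c c'0 mul0r.
have [|[q' eq_q]|//] := @prime_polyC p q f irr.
- by rewrite -e eq_c polyCM; exists (c'%:P * g); ring.
- apply: (IH c' q') => //.
    apply: leq_trans le_n; rewrite eq_c wP.1 //.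
    by rewrite -[ltnLHS]addn0 ltn_add2l (irreducible_measure wP).
  apply: (mulfI (polyC_neq0 p0)); move: e; rewrite eq_c eq_q polyCM => e.
  by rewrite mulrA [_ * c'%:P]mulrC e; ring.
- by move/pf: irr.
Qed.

Lemma irreducible_polyC (c : A) : irreducible_elt c%:P -> irreducible_elt c.
Proof.
case; rewrite polyC_eq0 poly_unitE size_polyC => c0.
rewrite c0 coefC eqxx /= => cU irr; split=> // a b e.
have := irr a%:P b%:P; rewrite -polyCM -e => /(_ erefl).
rewrite !poly_unitE !coefC !eqxx.
by case=> /andP[_ h]; [left|right].
Qed.

Lemma poly_factorial : factorial_ring {poly A}.
Proof.
have [[w wP] _] := factA; split.
  (* Degrees add and leading coefficients multiply; measure 0 leaves a constant that is a unit. *)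
  exists (fun p => ((size p).-1 + w (lead_coef p))%N); split=> [p q p0 q0|p p0].
    rewrite lead_coefM wP.1 ?lead_coef_eq0 // size_mul //.
    move: p0 q0; rewrite -!size_poly_gt0; lia.
  move/eqP; rewrite addn_eq0 => /andP[/eqP s0 /eqP/(wP.2 _ _)].
  have s1 : size p = 1%N by move: p0 s0; rewrite -size_poly_gt0; lia.
  by rewrite lead_coef_eq0 lead_coefE s0 poly_unitE s1 => /(_ p0) ->.
move=> f g h irr [k e].
have [f0 fU fI] := irr.
have [s1|s1] := leqP (size f) 1.
  have := size1_polyC s1 => fC; rewrite fC in irr e *.
  by apply: prime_polyC; [exact: irreducible_polyC|exists k].
have pf : primitive f.
  move=> c ic [q eq_f]; have [c0 cU _] := ic.
  have [] := fI _ _ eq_f; last by rewrite poly_unitE coefC eqxx (negbTE cU) andbF.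
  rewrite poly_unitE => /andP[/eqP sq _]; move: s1.
  by rewrite eq_f mulrC size_Cmul // sq.
have gcdl := dvdp_gcdl f g; have gcdr := dvdp_gcdr f g.
have d0 : gcdp f g != 0 by rewrite gcdp_eq0 (negbTE f0).
have [s1d|s1d] := eqVneq (size (gcdp f g)) 1%N.
  (* Constant gcd: a Bezout relation multiplied by [h] exhibits a nonzero constant times [h] as a
     multiple of [f]. *)
  right; have [[u v]] := Bezoutp f g => /=.
  move/eqpP => [[c1 c2] /= /andP[c10 c20] eB].
  have /size_poly1P[dd dd0 ed] : size (gcdp f g) == 1%N by apply/eqP.
  apply: (@primitive_cancel f h (c1%:P * u * h + c1%:P * v * k) (c2 * dd)) => //.
    by rewrite mulf_neq0.
  have -> : (c2 * dd)%:P = c1%:P * (u * f + v * g).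
    by rewrite mul_polyC eB ed polyCM mul_polyC.
  rewrite mulrDr mulrDl [RHS]mulrDl; congr (_ + _); first by ring.
  rewrite -!mulrA; congr (_ * _); rewrite e; ring.
(* Otherwise the primitive part [d'] of the gcd divides [f] and is not a unit, so [f] is an
   associate of [d'], which divides [g] up to constants. *)
have [e' e'0 [d' ed pd']] := primitive_part d0.
move: gcdl => /Pdiv.Idomain.dvdpP[[c q] /= c0 ec].
have [|q' eq_f] := @primitive_cancel d' f (q * e'%:P) c pd' c0.
  by rewrite mul_polyC ec ed; ring.
have [q'U|] := fI _ _ eq_f; last first.
  rewrite poly_unitE => /andP[/eqP sd' _].
  by move: s1d; rewrite ed size_Cmul // sd'.
left; move: gcdr => /Pdiv.Idomain.dvdpP[[c2 q2] /= c20 ec2].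
apply: (@primitive_cancel f g (q2 * e'%:P * q'^-1) c2) => //.
by rewrite mul_polyC ec2 ed [in RHS]eq_f -[RHS]mulrA mulKr // mulrA.
Qed.

End Gauss.

Lemma factorial_iso (A B : idomainType) (f : {rmorphism A -> B})
  (g : {rmorphism B -> A}) : cancel f g -> cancel g f ->
  factorial_ring A -> factorial_ring B.
Proof.
move=> fK gK [[w wP] primeP].
have finj := can_inj fK; have ginj := can_inj gK.
have g0 b : (g b != 0) = (b != 0) by rewrite -(inj_eq ginj b 0) rmorph0.
have gU b : (g b \is a GRing.unit) = (b \is a GRing.unit).
  by apply/idP/idP => [/(rmorph_unit f)|/(rmorph_unit g)//]; rewrite gK.
split.
  exists (w \o g); split=> [a b a0 b0|a a0 /=].
    by rewrite /= rmorphM wP.1 ?g0.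
  by move/(wP.2 _ _); rewrite g0 gU => /(_ a0).
move=> p a b [p0 pU pI] [c e].
have [||[d ed]|[d ed]] := primeP (g p) (g a) (g b).
- split; rewrite ?g0 ?gU // => x y /(congr1 f); rewrite gK rmorphM => /pI.
  by rewrite -!gU !fK.
- by exists (g c); rewrite -!rmorphM e.
- by left; exists (f d); rewrite -[a]gK ed rmorphM gK.
- by right; exists (f d); rewrite -[b]gK ed rmorphM gK.
Qed.

(** * Polynomial rings in several variables over a field *)

Section MPolyFactorial.
Variable K : fieldType.

Lemma mpoly0_factorial : factorial_ring {mpoly K[0]}.
Proof.
have unitP (a : {mpoly K[0]}) : a != 0 -> a \is a GRing.unit.
  rewrite (nvar0_mpolyC a) mpolyC_eq0 -unitfE => aU.
  by apply: (rmorph_unit (@mpolyC 0 K)).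
split; first by exists (fun=> 0%N); split=> // a /unitP.
by move=> p a b [p0 /negP pU _]; case: pU; exact: unitP.
Qed.

Lemma mpoly_rmorphism_ext n (B : comNzRingType) (f g : {rmorphism {mpoly K[n]} -> B}) :
  (forall c, f c%:MP = g c%:MP) -> (forall i, f 'X_i = g 'X_i) -> f =1 g.
Proof.
move=> fgC fgX p; rewrite (mpolyE p) !rmorph_sum; apply: eq_bigr => m _.
rewrite -mul_mpolyC !rmorphM fgC mpolyXE_id !rmorph_prod; congr (_ * _).
by apply: eq_bigr => i _; rewrite !rmorphXn /= fgX.
Qed.

Local Notation widen := (widen_ord (leqnSn _)).

Lemma widen_or_max n (i : 'I_n.+1) : (exists j : 'I_n, i = widen j) \/ i = ord_max.
Proof.
case: (unliftP ord_max i) => [j ->|->]; [left|by right].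
by exists j; apply/val_inj; rewrite /= /bump leqNgt ltn_ord.
Qed.

(** Inverse of [muni]; the pair carries [poly_factorial] through an induction on the number of
    variables. *)
Definition multi n : {poly {mpoly K[n]}} -> {mpoly K[n.+1]} :=
  horner_eval ('X_ord_max : {mpoly K[n.+1]}) \o map_poly (@mwiden n K).
Arguments multi : simpl never.
HB.instance Definition _ n := GRing.RMorphism.copy (@multi n)
  (horner_eval ('X_ord_max : {mpoly K[n.+1]}) \o map_poly (@mwiden n K)).

Lemma muni_widen n (j : 'I_n) : muni ('X_(widen j) : {mpoly K[n.+1]}) = ('X_j)%:P.
Proof.
rewrite muniE msuppX big_seq1 mcoeffX eqxx scale1r mnm1E.
rewrite -(inj_eq val_inj) /= ltn_eqF ?ltn_ord // expr0 alg_polyC; congr ('X_[_])%:P.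
by apply/mnmP => i; rewrite mnmE !mnm1E -!(inj_eq val_inj).
Qed.

Lemma muni_max n : muni ('X_ord_max : {mpoly K[n.+1]}) = 'X.
Proof.
rewrite muniE msuppX big_seq1 mcoeffX eqxx scale1r mnm1E eqxx expr1.
rewrite (_ : [multinom _ | _ < _] = 0%MM) ?mpolyX0 ?scale1r //.
apply/mnmP => i; rewrite mnmE mnm1E mnm0E -(inj_eq val_inj) /= gtn_eqF //.
Qed.

Lemma multiC n p : multi p%:P = mwiden p :> {mpoly K[n.+1]}.
Proof. by rewrite /multi /= map_polyC /= /horner_eval hornerC. Qed.

Lemma multiX n : multi 'X = 'X_ord_max :> {mpoly K[n.+1]}.
Proof. by rewrite /multi /= map_polyX /= /horner_eval hornerX. Qed.

Lemma mwidenXU n (i : 'I_n) : mwiden 'X_i = 'X_(widen i) :> {mpoly K[n.+1]}.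
Proof. by rewrite mwidenX mnmwiden1. Qed.

Lemma muniK n (p : {mpoly K[n.+1]}) : multi (muni p) = p.
Proof.
apply: (@mpoly_rmorphism_ext _ _ (@multi n \o @muni n K) idfun) => [c|i];
  rewrite -[LHS]/(multi (muni _)) -[RHS]/(_ : {mpoly K[n.+1]}).
  by rewrite muniC multiC mwidenC.
have [[j ->]|->] := widen_or_max i; last by rewrite muni_max multiX.
by rewrite muni_widen multiC mwidenXU.
Qed.

Lemma multiK n (q : {poly {mpoly K[n]}}) : muni (multi q) = q.
Proof.
have muni_mwiden (p : {mpoly K[n]}) : muni (mwiden p) = p%:P.
  apply: (@mpoly_rmorphism_ext _ _ (@muni n K \o @mwiden n K) polyC) => [c|i] /=.
    by rewrite mwidenC muniC.
  by rewrite mwidenXU muni_widen.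
elim/poly_ind: q => [|q c IH]; first by rewrite !rmorph0.
by rewrite !rmorphD !rmorphM /= IH multiX muni_max multiC muni_mwiden.
Qed.

Lemma mpoly_factorial n : factorial_ring {mpoly K[n]}.
Proof.
elim: n => [|n IH]; first exact: mpoly0_factorial.
pose f : {rmorphism {poly {mpoly K[n]}} -> {mpoly K[n.+1]}} := @multi n.
pose g : {rmorphism {mpoly K[n.+1]} -> {poly {mpoly K[n]}}} := @muni n K.
apply: (@factorial_iso _ _ f g).
- exact: multiK.
- exact: muniK.
- exact: (poly_factorial IH).
Qed.
End MPolyFactorial.

(** * Representatives and degrees of Cremona transformations *)

Section CremonaDegree.
Variable K : fieldType.
Local Notation triple := (3.-tuple {mpoly K[3]}).
Local Notation mp3 := {mpoly K[3]}.
Implicit Types (F G H : triple) (p q : mp3) (f g : birational_triple K)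
  (u v : Cremona K).

Lemma mmap_comp n (B : comNzRingType) (c : {rmorphism K -> B}) (h : 'I_n -> B)
    k (p : {mpoly K[k]}) (G : k.-tuple {mpoly K[n]}) :
  mmap c h (p \mPo G) = mmap c (fun i => mmap c h (tnth G i)) p.
Proof.
apply: (@mpoly_rmorphism_ext _ _ _ (mmap c h \o comp_mpoly G)
  (mmap c (fun i => mmap c h (tnth G i)))) => [a|i] /=.
  by rewrite comp_mpolyC !mmapC.
by rewrite comp_mpolyXU mmapX mmap1U -tnth_nth.
Qed.

Lemma mmap_homog n (B : comNzRingType) (c : {rmorphism K -> B}) (h h' : 'I_n -> B)
    (p : {mpoly K[n]}) d (a : B) : p \is d.-homog -> (forall i, h i = a * h' i) ->
  mmap c h p = a ^+ d * mmap c h' p.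
Proof.
move=> /dhomogP hp hh'; rewrite /mmap mulr_sumr big_seq [RHS]big_seq.
apply: eq_bigr => m mp; rewrite mulrCA; congr (_ * _).
rewrite -(hp m mp) /= mdegE /mmap1 -prodrXr -big_split /=.
by apply: eq_bigr => i _; rewrite hh' exprMn.
Qed.

(** Nonvanishing is transferred by [rational_comp], applied to the triple whose three coordinates
    all equal [p]. *)
Lemma comp_homog_neq0 p d G : p \is d.-homog -> p != 0 -> birational G ->
  p \mPo G != 0.
Proof.
move=> hp p0 bG; have [|hd [i hi]] := @rational_comp K [tuple p; p; p] G _ bG.
  split; last by exists ord0.
  by exists d; case=> [[|[|[|?]]] ?]; rewrite ?(tnth_nth 0).
by move: hi; rewrite tnth_comp; case: i => [[|[|[|?]]] ?]; rewrite ?(tnth_nth 0).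
Qed.

(** Common factors are allowed, so that composites can be written down unreduced; birationality of
    [G] follows from [represents_birational]. *)
Definition represents u G := rational_map G /\ same_map (repr u) G.

Lemma represents_pi f : represents (\pi_(Cremona K) f) f.
Proof.
split; first by case: (birationalP f).
by apply/Cremona_eqP; rewrite reprK.
Qed.

Lemma represents_same u F G : represents u F -> represents u G -> same_map F G.
Proof.
move=> [ratF uF] [ratG uG]; have [ratu _] := birationalP (repr u).
by apply: (same_map_trans ratu _ uG); rewrite same_map_sym.
Qed.

Lemma same_represents u F G : represents u F -> rational_map G ->
  same_map F G -> represents u G.
Proof. by move=> [ratF uF] ratG FG; split=> //; exact: (same_map_trans ratF uF FG). Qed.

Lemma represents_neq0 u G p d : represents u G -> p \is d.-homog -> p != 0 ->
  p \mPo G != 0.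
Proof.
move=> [ratG uG] hp p0; have [ratu _] := birationalP (repr u).
apply: (comp_same_neq0 ratu ratG hp uG _).
exact: (comp_homog_neq0 hp p0 (birationalP _)).
Qed.

Lemma represents_mul u v F G : represents u F -> represents v G ->
  represents (u * v)%g (comp_triple F G).
Proof.
move=> rF rG; have [ratF uF] := rF; have [ratG vG] := rG.
have ratFG : rational_map (comp_triple F G).
  have [[d hF] [i nzF]] := ratF; have [[e hG] _] := ratG; split.
    by exists (e * d)%N => j; rewrite tnth_comp; exact: comp_homog.
  by exists i; rewrite tnth_comp; exact: (represents_neq0 rG (hF i) nzF).
have /same_represents := represents_pi (birational_mul (repr u) (repr v)).
have -> : (u * v)%g = \pi_(Cremona K) (birational_mul (repr u) (repr v)) by [].
apply=> //; have [ratu _] := birationalP (repr u); have [ratv _] := birationalP (repr v).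
exact: same_comp.
Qed.

Lemma represents_eq u v F : represents u F -> represents v F -> u = v.
Proof.
move=> [ratF uF] [_ vF]; rewrite -[u]reprK -[v]reprK; apply/Cremona_eqP.
by apply: (same_map_trans ratF uF _); rewrite same_map_sym.
Qed.

Lemma represents_homog u G : represents u G -> exists d, forall i, tnth G i \is d.-homog.
Proof. by case=> [[]]. Qed.

(** A zero coordinate would confine the image to a line; [represents_neq0] is applied to the linear
    form ['X_i]. *)
Lemma represents_coord_neq0 u G i : represents u G -> tnth G i != 0.
Proof.
move=> rG; have h : ('X_i : mp3) \is 1.-homog by rewrite dhomogX /= mdeg1.
have := represents_neq0 rG h; rewrite comp_mpolyXU -tnth_nth; apply.
by rewrite -msupp_eq0 msuppX.
Qed.

Definition aff_point : 3.-tuple {mpoly K[2]} := [tuple 'X_ord0; 'X_ord_max; 1].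

Lemma dehomogM p q : dehomog (p * q) = dehomog p * dehomog q.
Proof. by rewrite /dehomog !rmorphM. Qed.

(** Homogeneity recovers p as z^d p(x/z, y/z, 1), an identity in the fraction field of the ring in
    three variables. *)
Lemma dehomog_inj p d : p \is d.-homog -> dehomog p = 0 -> p = 0.
Proof.
move=> hp /eqP; rewrite tofrac_eq0 => /eqP p0.
pose c : {rmorphism K -> {fraction mp3}} := @tofrac mp3 \o @mpolyC 3 K.
pose X (i : 'I_3) : {fraction mp3} := tofrac 'X_i.
have Z0 : X ord_max != 0.
  by rewrite /X tofrac_eq0 -msupp_eq0 msuppX.
have pX : tofrac p = mmap c X p.
  apply: (@mpoly_rmorphism_ext _ _ _ (@tofrac mp3) (mmap c X)) => [a|i] /=.
    by rewrite mmapC.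
  by rewrite mmapX mmap1U.
apply/eqP; rewrite -tofrac_eq0 pX; apply/eqP.
pose Y i := if i == ord0 :> 'I_2 then X ord0 / X ord_max else X 1 / X ord_max.
have -> := @mmap_homog _ _ c X (fun i => mmap c Y (tnth aff_point i)) p d (X ord_max) hp.
  by rewrite -mmap_comp p0 mmap0 mulr0.
case=> [[|[|[|//]]]] /= lt; rewrite (tnth_nth 0) /=.
- by rewrite mmapX mmap1U /Y /= mulrC divfK //; congr X; apply/val_inj.
- by rewrite mmapX mmap1U /Y /= mulrC divfK //; congr X; apply/val_inj.
- by rewrite rmorph1 mulr1; congr X; apply/val_inj.
Qed.

Let o0 : 'I_3 := ord0.
Let o1 : 'I_3 := 1.
Let o2 : 'I_3 := ord_max.

Lemma affine_mapE u G : represents u G ->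
  affine_map u = (dehomog (tnth G o0) / dehomog (tnth G o2),
                  dehomog (tnth G o1) / dehomog (tnth G o2)).
Proof.
move=> rG; have [d hG] := represents_homog rG.
have ru : represents u (repr u) by rewrite -{1}[u]reprK; exact: represents_pi.
have [e hu] := represents_homog ru.
have nz F k : represents u F -> dehomog (tnth F k) != 0.
  move=> rF; have [d' hF] := represents_homog rF.
  by apply/eqP => /(dehomog_inj (hF k)) /eqP; rewrite (negbTE (represents_coord_neq0 k rF)).
have [_ /same_mapP uG] := rG; rewrite /affine_map.
have tE k (lt : (k < 3)%N) : (repr u : triple)`_k = tnth (repr u : triple) (Ordinal lt).
  by rewrite (tnth_nth 0).
have q k : dehomog (tnth (repr u : triple) k) / dehomog (tnth (repr u : triple) o2)
    = dehomog (tnth G k) / dehomog (tnth G o2).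
  apply/eqP; rewrite eqr_div ?nz // -!dehomogM uG mulrC eqxx //.
rewrite -!q !(tnth_nth 0) /=; congr (_ / _, _ / _).
Qed.

(** This turns the affine formulas of [is_theta] into explicit homogeneous triples for the images of
    the generators. *)
Lemma affine_map_inj : injective (@affine_map K).
Proof.
move=> u v e.
have ru : represents u (repr u) by rewrite -{1}[u]reprK; exact: represents_pi.
have rv : represents v (repr v) by rewrite -{1}[v]reprK; exact: represents_pi.
have [d hu] := represents_homog ru; have [d' hv] := represents_homog rv.
have nz (w : Cremona K) k : dehomog (tnth (repr w : triple) k) != 0.
  have rF : represents w (repr w) by rewrite -{1}[w]reprK; exact: represents_pi.
  have [d'' hF] := represents_homog rF.
  by apply/eqP => /(dehomog_inj (hF k)) /eqP; rewrite (negbTE (represents_coord_neq0 k rF)).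
have cross k : tnth (repr u : triple) k * tnth (repr v : triple) o2
             = tnth (repr v : triple) k * tnth (repr u : triple) o2.
  have [->|nk2] := eqVneq k o2; first by rewrite mulrC.
  apply/eqP; rewrite -subr_eq0; apply/eqP.
  apply: (@dehomog_inj _ (d + d')).
    by apply: rpredB; [exact: dhomogM|rewrite addnC; exact: dhomogM].
  rewrite /dehomog !rmorphB /= -!/(dehomog _) !dehomogM.
  apply/eqP; rewrite subr_eq0 -eqr_div ?nz //.
  move: e; rewrite (affine_mapE ru) (affine_mapE rv) => -[e0 e1].
  case: k nk2 => [[|[|[|//]]]] lt // _; apply/eqP.
  - by move: e0; congr (_ = _); congr (dehomog (tnth _ _) / _); exact/val_inj.
  - by move: e1; congr (_ = _); congr (dehomog (tnth _ _) / _); exact/val_inj.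
apply: (represents_eq ru); apply: (same_represents rv _ _); first by case: ru.
apply/same_mapP => i j.
apply: (mulfI (represents_coord_neq0 o2 ru)).
transitivity (tnth (repr u) j * (tnth (repr v) i * tnth (repr u) o2)); first by ring.
rewrite -cross; transitivity (tnth (repr u) i * (tnth (repr u) j * tnth (repr v) o2)).
  by ring.
by rewrite cross; ring.
Qed.

End CremonaDegree.

Section CremonaTools.
Variable K : fieldType.
Local Notation triple := (3.-tuple {mpoly K[3]}).
Local Notation mp3 := {mpoly K[3]}.
Implicit Types (F G H : triple) (p q : mp3) (f g : birational_triple K)
  (u v : Cremona K).

Lemma ord3P (P : 'I_3 -> Prop) : P ord0 -> P 1 -> P ord_max -> forall i, P i.
Proof.
move=> P0 P1 P2; case=> [[|[|[|//]]]] lt.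
- by rewrite (_ : Ordinal lt = ord0) //; exact/val_inj.
- by rewrite (_ : Ordinal lt = 1) //; exact/val_inj.
- by rewrite (_ : Ordinal lt = ord_max) //; exact/val_inj.
Qed.

Lemma tnth3 (T : Type) (a b c : T) :
  (tnth [tuple a; b; c] ord0 = a) * (tnth [tuple a; b; c] 1 = b) *
  (tnth [tuple a; b; c] ord_max = c).
Proof. by rewrite !(tnth_nth a). Qed.

Lemma comp_triple3 (a b c : mp3) G :
  comp_triple [tuple a; b; c] G = [tuple a \mPo G; b \mPo G; c \mPo G].
Proof.
by apply: eq_from_tnth; apply: ord3P; rewrite tnth_comp !tnth3.
Qed.

Lemma comp_mpolyX_tnth n (G : 3.-tuple {mpoly K[n]}) i : 'X_i \mPo G = tnth G i.
Proof. by rewrite comp_mpolyXU -tnth_nth. Qed.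

Lemma mpolyXi_neq0 (i : 'I_3) : 'X_i != 0 :> mp3.
Proof. by rewrite -msupp_eq0 msuppX. Qed.

Lemma dhomogC (c : K) : (c%:MP : mp3) \is 0.-homog.
Proof. by rewrite -alg_mpolyC; apply: rpredZ; exact: dhomog1. Qed.

Lemma dhomogXi (i : 'I_3) : ('X_i : mp3) \is 1.-homog.
Proof. by rewrite dhomogX /= mdeg1. Qed.

Lemma mmapXi (B : comNzRingType) (c : {rmorphism K -> B}) (h : 'I_3 -> B) i :
  mmap c h 'X_i = h i.
Proof. by rewrite mmapX mmap1U. Qed.

Lemma neq0_mmap (B : comNzRingType) (c : {rmorphism K -> B}) (h : 'I_3 -> B) p :
  mmap c h p != 0 -> p != 0.
Proof. by apply: contra_neq => ->; rewrite mmap0. Qed.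

Lemma rational_map3 (a b c : mp3) d : a \is d.-homog -> b \is d.-homog ->
  c \is d.-homog -> c != 0 -> rational_map [tuple a; b; c].
Proof.
move=> ha hb hc c0; split; last by exists ord_max; rewrite tnth3.
by exists d; apply: ord3P; rewrite tnth3.
Qed.

Lemma same_map_scale F G (c c' : mp3) : c != 0 ->
  (forall i, c * tnth F i = c' * tnth G i) -> same_map F G.
Proof.
move=> c0 FG; apply/same_mapP => i j; apply: (mulfI c0).
by rewrite mulrA FG mulrA FG; ring.
Qed.

(** The polynomials [c] and [c'] are the common factors that appear when the two explicit triples
    are composed without simplification. *)
Lemma birational_intro F G c c' : rational_map F -> rational_map G ->
  c != 0 -> c' != 0 ->
  (forall i, tnth F i \mPo G = c * 'X_i) -> (forall i, tnth G i \mPo F = c' * 'X_i) ->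
  birational F.
Proof.
move=> ratF ratG c0 c'0 FG GF.
have inv F' G' d : rational_map F' -> rational_map G' -> d != 0 ->
    (forall i, tnth F' i \mPo G' = d * 'X_i) -> right_inverse_map F' G'.
  move=> [[a hF] _] [[b hG] _] d0 e; split; last first.
    apply: (@same_map_scale _ _ 1 d); first exact: oner_neq0.
    by move=> i; rewrite tnth_comp e tnth_mktuple mul1r.
  split; last by exists ord0; rewrite tnth_comp e mulf_neq0 // mpolyXi_neq0.
  by exists (b * a)%N => i; rewrite tnth_comp; exact: comp_homog.
by split=> //; exists G; split=> //; [exact: (inv _ _ c)|exact: (inv _ _ c')].
Qed.

Definition ratc : {rmorphism K -> {fraction {mpoly K[2]}}} :=
  @tofrac {mpoly K[2]} \o @mpolyC 2 K.

Definition aff (X Y : ratfun K) : 'I_3 -> {fraction {mpoly K[2]}} :=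
  tnth [tuple X; Y; 1].

Lemma dehomog_mmap p : dehomog p = mmap ratc (aff (ratX K) (ratY K)) p.
Proof.
pose f : {rmorphism mp3 -> {fraction {mpoly K[2]}}} :=
  @tofrac {mpoly K[2]} \o comp_mpoly (aff_point K).
have fC c : f c%:MP = mmap ratc (aff (ratX K) (ratY K)) c%:MP.
  by rewrite /f /= comp_mpolyC mmapC.
have fX i : f 'X_i = mmap ratc (aff (ratX K) (ratY K)) 'X_i.
  rewrite /f /= comp_mpolyX_tnth mmapXi /aff; elim/ord3P: i; rewrite !tnth3 //.

exact: (mpoly_rmorphism_ext fC fX p).
Qed.

(** Dividing the inner triple by its third coordinate rescales the three coordinates of [F] by the
    same power, so the quotients are unchanged. *)
Lemma affine_map_mul u v F X Y : represents u F -> affine_map v = (X, Y) ->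
  affine_map (u * v)%g =
    (mmap ratc (aff X Y) (tnth F ord0) / mmap ratc (aff X Y) (tnth F ord_max),
     mmap ratc (aff X Y) (tnth F 1) / mmap ratc (aff X Y) (tnth F ord_max)).
Proof.
move=> rF; have rv : represents v (repr v).
  by rewrite -{1}[v]reprK; exact: represents_pi.
rewrite (affine_mapE rv) => -[eX eY]; rewrite (affine_mapE (represents_mul rF rv)).
have [d hF] := represents_homog rF; have [e hv] := represents_homog rv.
have nz : dehomog (tnth (repr v : triple) ord_max) != 0.
  apply/eqP => /(dehomog_inj (hv _)) /eqP.
  by rewrite (negbTE (represents_coord_neq0 _ rv)).
have key k : dehomog (tnth F k \mPo repr v) =
    dehomog (tnth (repr v : triple) ord_max) ^+ d * mmap ratc (aff X Y) (tnth F k).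
  rewrite dehomog_mmap mmap_comp; apply: mmap_homog (hF k) _ => i.
  rewrite -dehomog_mmap /aff; elim/ord3P: i; rewrite !tnth3 -?eX -?eY.
  - by rewrite mulrC divfK.
  - by rewrite mulrC divfK.
  - by rewrite mulr1.
have nzd : dehomog (tnth (repr v : triple) ord_max) ^+ d != 0 by exact: expf_neq0.
have cancel (F1 : fieldType) (a b b' : F1) : a != 0 -> (a * b) / (a * b') = b / b'.
  by move=> a0; rewrite -mulf_div divff // mul1r.
by rewrite !tnth_comp (key ord0) (key 1) (key ord_max) !(cancel _ _ _ _ nzd).
Qed.

(** Proportionality says that the first coordinate of [F] divides that of [G] times every coordinate
    of [F]; as these have no common factor, [coprime_family_dvd] yields the quotient [q]. *)
Lemma represents_divides u d F G : (forall i, tnth F i \is d.-homog) ->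
  no_common_factor F -> represents u F -> represents u G ->
  exists q, forall i, tnth G i = q * tnth F i.
Proof.
move=> hF nF rF rG; have /same_mapP FG := represents_same rF rG.
have [[w wP] primeP] := @mpoly_factorial K 3.
have F0 := represents_coord_neq0 ord0 rF.
have [||q eq_G] := coprime_family_dvd wP primeP (F := tnth F) (b := tnth G ord0) _ F0.
- move=> h hh; apply: nF => i; have [q ->] := hh i; exists q; exact: mulrC.
- by move=> i; exists (tnth G i); rewrite mulrC FG mulrC.
exists q => i; apply: (mulfI F0); rewrite FG eq_G; ring.
Qed.

Lemma dhomog_msize_le p d : p \is d.-homog -> (msize p <= d.+1)%N.
Proof.
move=> hp; have [->|p0] := eqVneq p 0; first by rewrite msize0.
have e := dhomog_uniq p0 hp (dhomog_msize hp).
by move: e p0; rewrite -msize_poly_eq0; lia.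
Qed.

Lemma dhomog_msize_eq p d : p \is d.-homog -> p != 0 -> msize p = d.+1.
Proof.
move=> hp p0; have e := dhomog_uniq p0 hp (dhomog_msize hp).
by move: e p0; rewrite -msize_poly_eq0; lia.
Qed.

Lemma top_homog p d : (msize p <= d.+1)%N ->
  exists2 r, p = pihomog mdeg d p + r & (msize r <= d)%N.
Proof.
move=> sp; exists (\sum_(i < d) pihomog mdeg i p).
  by rewrite [LHS](pihomog_partitionE sp) big_ord_recr addrC.
apply: leq_trans (msize_sum _ _ _) _; apply/bigmax_leqP => i _.
exact: leq_trans (dhomog_msize_le (pihomogP _ _ _)) (ltn_ord i).
Qed.

Lemma msizeM_leq p q a b : (msize p <= a)%N -> (msize q <= b)%N ->
  (msize (p * q) <= (a + b).-1)%N.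
Proof.
move=> pa qb; have [->|p0] := eqVneq p 0; first by rewrite mul0r msize0.
have [->|q0] := eqVneq q 0; first by rewrite mulr0 msize0.
by rewrite msizeM // -!subn1; apply: leq_sub2r; exact: leq_add.
Qed.

(** The product of the top components accounts for everything in degree a + b; the rest has smaller
    size, and being homogeneous of degree a + b it vanishes. *)
Lemma homog_factor p q r a b : p = q * r -> p \is (a + b)%N.-homog ->
  (msize q <= a.+1)%N -> (msize r <= b.+1)%N ->
  p = pihomog mdeg a q * pihomog mdeg b r.
Proof.
move=> ep hp sq sr; have [q' eq sq'] := top_homog sq; have [r' er sr'] := top_homog sr.
set Q := pihomog _ a q in eq *; set R := pihomog _ b r in er *.
have hQ : Q \is (a).-homog by exact: pihomogP.
have hR : R \is b.-homog by exact: pihomogP.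
have hd : p - Q * R \is (a + b)%N.-homog by apply: rpredB => //; exact: dhomogM.
apply/eqP; rewrite -subr_eq0; apply/negPn/negP => /(dhomog_msize_eq hd).
have -> : p - Q * R = Q * r' + q' * r by rewrite ep {1}eq {1}er [in RHS]er; ring.
move=> e; have : (msize (Q * r' + q' * r) <= a + b)%N.
  apply: leq_trans (msizeD_le _ _) _; rewrite geq_max.
  have := msizeM_leq (dhomog_msize_le hQ) sr'.
  by have := msizeM_leq sq' sr; rewrite !addnS addSn /= => -> ->.
by rewrite e ltnn.
Qed.

Lemma represents_repr u : represents u (repr u).
Proof. by rewrite -{1}[u]reprK; exact: represents_pi. Qed.

Lemma represents1 : represents 1%g (id_triple K).
Proof. exact: (represents_pi (birational_one K)). Qed.

Lemma represents_birational u F : represents u F -> birational F.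
Proof.
move=> rF; split; first by case: rF.
have rV := represents_repr (u^-1)%g.
have inv v w F' G' : represents v F' -> represents w G' -> (v * w)%g = 1%g ->
    right_inverse_map F' G'.
  move=> rF' rG' e; have := represents_mul rF' rG'; rewrite e => r1.
  by split; [case: r1|exact: represents_same r1 represents1].
exists (repr (u^-1)%g); split; first by case: rV.
- by apply: inv rF rV _; rewrite mulgV.
- by apply: inv rV rF _; rewrite mulVg.
Qed.

(** A homogeneous representative of least degree has no common factor, since a factor of positive
    degree could be divided out. *)
Lemma has_degree_exists u : exists d, has_degree u d.
Proof.
pose P d := `[< exists F, represents u F /\ forall i, tnth F i \is d.-homog >].
have exP : exists d, P d.
  have [[[d hu] _] _] := birationalP (repr u).
  exists d; apply/asboolP; exists (repr u); split=> //.
  by rewrite -{1}[u]reprK; exact: represents_pi.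
case: (ex_minnP exP) => d /asboolP[F [rF hF]] dmin.
have bF := represents_birational rF.
exists d, (BirationalTriple (asboolT bF)); split=> //.
  exact: (@represents_eq _ _ u F (represents_pi (BirationalTriple (asboolT bF))) rF).
move=> h hdiv.
pose q i := sval (cid (hdiv i)); have qE i : tnth F i = h * q i := svalP (cid (hdiv i)).
have h0 : h != 0.
  by apply: contraNneq (represents_coord_neq0 ord0 rF) => h0; rewrite qE h0 mul0r.
have q0 i : q i != 0.
  by apply: contraNneq (represents_coord_neq0 i rF) => q0; rewrite qE q0 mulr0.
have szh : (0 < msize h)%N by rewrite lt0n msize_poly_eq0.
(* The factor [h] is not known to be homogeneous; its top component and those of the cofactors give
   a homogeneous triple of degree [b]. *)
pose a := (msize h).-1; pose b := (d - a)%N.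
have ab i : msize (q i) = b.+1 /\ (a + b)%N = d.
  have := dhomog_msize_eq (hF i) (represents_coord_neq0 i rF).
  rewrite qE msizeM // => e.
  have : (0 < msize (q i))%N by rewrite lt0n msize_poly_eq0.
  by rewrite /b /a; move: (msize h) (msize (q i)) szh e => m n; lia.
have d_ab := (ab ord0).2.
have FE i : tnth F i = pihomog mdeg a h * pihomog mdeg b (q i).
  apply: homog_factor (qE i) _ _ _; rewrite ?d_ab ?(ab i).1 //.
  by rewrite /a prednK.
pose G : triple := [tuple pihomog mdeg b (q i) | i < 3].
have GE i : tnth G i = pihomog mdeg b (q i) by rewrite tnth_mktuple.
have h'0 : pihomog mdeg a h != 0.
  apply: contraNneq (represents_coord_neq0 ord0 rF) => h'0.
  by rewrite FE h'0 mul0r.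
have rG : represents u G.
  apply: (same_represents rF).
    split; first by exists b => i; rewrite GE; exact: pihomogP.
    exists ord0; rewrite GE; apply: contraNneq (represents_coord_neq0 ord0 rF) => q'0.
    by rewrite FE q'0 mulr0.
  apply: (@same_map_scale _ _ 1 (pihomog mdeg a h)); rewrite ?oner_neq0 // => i.
  by rewrite mul1r FE GE.
have : (d <= b)%N.
  by apply: dmin; apply/asboolP; exists G; split=> // i; rewrite GE; exact: pihomogP.
move=> db; have /eqP/msize_poly1P[c c0 ->] : msize h = 1%N by rewrite /a in d_ab; lia.
by apply: (rmorph_unit (@mpolyC 3 K)); rewrite unitfE.
Qed.

End CremonaTools.

(** * Upper and lower bounds for the degree *)

Section CremonaDegreeBounds.
Variable K : fieldType.
Local Notation triple := (3.-tuple {mpoly K[3]}).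
Local Notation mp3 := {mpoly K[3]}.
Implicit Types (F G H : triple) (p q : mp3) (u v : Cremona K).

(** By [has_degree_exists] the default value of [xget] is never reached, so [degree] comes with a
    reduced representative. *)
Lemma degreeP u : exists F, [/\ represents u F,
  forall i, tnth F i \is (degree u).-homog & no_common_factor F].
Proof.
have [d hd] := has_degree_exists u.
have [f [eu hf nf]] : has_degree u (degree u) by exact: (xgetPex 0%N (ex_intro _ d hd)).
by exists f; split=> //; rewrite -eu; exact: represents_pi.
Qed.

Lemma degree_le u G d : represents u G -> (forall i, tnth G i \is d.-homog) ->
  (degree u <= d)%N.
Proof.
move=> rG hG; have [F [rF hF nF]] := degreeP u.
have [q qE] := represents_divides hF nF rF rG.
have F0 := represents_coord_neq0 ord0 rF; have G0 := represents_coord_neq0 ord0 rG.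
have := dhomog_msize_eq (hG ord0) G0; rewrite qE.
have q0 : q != 0 by apply: contraNneq G0 => q0; rewrite qE q0 mul0r.
rewrite msizeM // (dhomog_msize_eq (hF ord0) F0).
have : (0 < msize q)%N by rewrite lt0n msize_poly_eq0.
by move: (msize q) => m; lia.
Qed.

Lemma degree_mul u v : (degree (u * v)%g <= degree u * degree v)%N.
Proof.
have [F [rF hF _]] := degreeP u; have [G [rG hG _]] := degreeP v.
rewrite mulnC; apply: degree_le (represents_mul rF rG) _ => i.
by rewrite tnth_comp; exact: comp_homog.
Qed.

(** The points [t : t : 1] of the line x = y, with [t] as the polynomial variable. *)
Definition diag_line : 'I_3 -> {poly K} := tnth [tuple 'X; 'X; 1].
Definition on_line p : {poly K} := mmap polyC diag_line p.

Lemma size_on_line p d : p \is d.-homog -> (size (on_line p) <= d.+1)%N.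
Proof.
move=> /dhomogP hp; rewrite /on_line /mmap big_seq.
apply: leq_trans (size_sum _ _ _) _; apply/bigmax_leqP_seq => m mp _.
rewrite -(hp m mp) /= mul_polyC; apply: leq_trans (size_scale_leq _ _) _.
rewrite /mmap1 !big_ord_recl big_ord0 mulr1 mdegE !big_ord_recl big_ord0 addn0.
rewrite /diag_line !(tnth_nth 0) /= expr1n mulr1 -exprD size_polyXn.
lia.
Qed.

(* [G] is only proportional to a reduced representative [F]; unique
   factorization gives [G = q F], so that [F] does not vanish on the line x = y
   when [G] does not. *)
Lemma degree_ge u G i (N D : {poly K}) : represents u G ->
  on_line (tnth G ord_max) != 0 ->
  on_line (tnth G i) * D = on_line (tnth G ord_max) * N ->
  coprimep N D -> (maxn (size N) (size D) <= (degree u).+1)%N.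
Proof.
move=> rG g0 e cop; have [F [rF hF nF]] := degreeP u.
have [q qE] := represents_divides hF nF rF rG.
have onM k : on_line (tnth G k) = on_line q * on_line (tnth F k).
  by rewrite qE /on_line rmorphM.
have q0 : on_line q != 0 by apply: contraNneq g0 => q0; rewrite onM q0 mul0r.
have f0 : on_line (tnth F ord_max) != 0.
  by apply: contraNneq g0 => f0; rewrite onM f0 mulr0.
have {}e : on_line (tnth F i) * D = on_line (tnth F ord_max) * N.
  by apply: (mulfI q0); rewrite !mulrA -!onM.
rewrite geq_max; apply/andP; split.
  have [->|N0] := eqVneq N 0; first by rewrite size_poly0.
  apply: leq_trans (size_on_line (hF i)); apply: dvdp_leq.
    by apply: contraNneq (mulf_neq0 f0 N0) => fi0; rewrite -e fi0 mul0r.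
  by have : N %| on_line (tnth F i) * D; [rewrite e dvdp_mulIr|rewrite Gauss_dvdpl].
apply: leq_trans (size_on_line (hF ord_max)); apply: dvdp_leq => //.
have : D %| on_line (tnth F ord_max) * N by rewrite -e dvdp_mulIr.
by rewrite Gauss_dvdpl // coprimep_sym.
Qed.

Lemma degree1 : degree (1%g : Cremona K) = 1%N.
Proof.
apply/eqP; rewrite eqn_leq; apply/andP; split.
  apply: (degree_le (@represents1 K)) => i; rewrite tnth_mktuple; exact: dhomogXi.
have lX i : on_line (tnth (id_triple K) i) = diag_line i.
  by rewrite tnth_mktuple /on_line mmapXi.
have := @degree_ge _ _ ord0 'X 1 (@represents1 K).
rewrite !lX /diag_line !tnth3 oner_neq0 mulr1 mul1r => /(_ isT erefl).
by rewrite coprimep1 size_polyX => /(_ isT); rewrite geq_max => /andP[].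
Qed.

Lemma degree_gt0 u : (0 < degree u)%N.
Proof.
have := degree_mul u (u^-1)%g; rewrite mulgV degree1.
by case: (degree u).
Qed.

Lemma degree_conj u v n : (degree ((u ^ v) ^+ n)%g <=
  degree (v^-1)%g * degree v * degree (u ^+ n)%g)%N.
Proof.
rewrite -conjXg conjgE; apply: leq_trans (degree_mul _ _) _.
by rewrite -mulnA leq_mul2l mulnC degree_mul orbT.
Qed.

End CremonaDegreeBounds.

(** * Words in SL(2, Z) *)

Local Open Scope group_scope.

Definition SL2_relations (G : groupType) (r s : G) : Prop :=
  [/\ s ^+ 4 = 1, (r * s) ^+ 3 = 1 & s ^+ 2 * (r * s) = (r * s) * s ^+ 2].

(** In SL(2, Z) the letter [false] is the transpose of R, so positive words are products of
    nonnegative matrices. *)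
Definition pos_letter (G : groupType) (r s : G) (b : bool) : G :=
  if b then r else s^-1 * r^-1 * s.
Definition pos_word (G : groupType) (r s : G) (w : seq bool) : G :=
  foldr (fun b x => pos_letter r s b * x) 1 w.
(** There are no inverse letters: s and u = r s have finite order under the relations, so their
    inverses are words as well. *)
Definition su_word (G : groupType) (r s : G) (v : seq bool) : G :=
  foldr (fun b x => (if b then s else r * s) * x) 1 v.

(** * Consequences of the relations in an arbitrary group *)

Section Relations.
Variables (G : groupType) (r s z u l : G).
Hypothesis rel : SL2_relations r s.
Hypotheses (zE : z = s * s) (uE : u = r * s) (lE : l = s^-1 * r^-1 * s).

Lemma zz : z * z = 1.
Proof. by have [<- _ _] := rel; rewrite zE !expgS expg0 mulg1 !mulgA. Qed.

Lemma uuu : u * u * u = 1.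
Proof. by have [_ <- _] := rel; rewrite uE !expgS expg0 mulg1 !mulgA. Qed.

Lemma zs : z * s = s * z.
Proof. by rewrite zE mulgA. Qed.

Lemma zu : z * u = u * z.
Proof. by have [_ _] := rel; rewrite expg2 -zE -uE. Qed.

Lemma us : u * s = z * r.
Proof. by apply: (mulIg s); rewrite -[RHS]mulgA -uE zu zE !mulgA. Qed.

Lemma zr : z * r = r * z.
Proof. by rewrite -us uE zE mulgA. Qed.

Lemma uus : u * u * s = l.
Proof.
have -> : u * u = u^-1 by apply: (mulIg u); rewrite uuu mulVg.
by rewrite uE invgM lE.
Qed.

Lemma zl : z * l = l * z.
Proof.
by rewrite -uus -[RHS]mulgA -zs !mulgA zu -[u * z * u]mulgA zu !mulgA.
Qed.

Lemma ur : u * r = z * l.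
Proof.
have -> : r = z * (u * s) by rewrite us mulgA zz mul1g.
by rewrite -uus !mulgA zu.
Qed.

Lemma ul : u * l = s.
Proof. by rewrite -uus !mulgA uuu mul1g. Qed.

Lemma uur : u * u * r = z * s.
Proof. by rewrite -mulgA ur mulgA -zu -mulgA ul. Qed.

Lemma uul : u * u * l = z * r.
Proof. by rewrite -mulgA ul us. Qed.

Lemma ls : l * s = z * (u * u).
Proof. by rewrite -uus -[LHS]mulgA -zE !mulgA zu -[RHS]mulgA zu mulgA. Qed.

Lemma r_su : r = u * s * s * s.
Proof. by rewrite us -!mulgA -zE -zr mulgA zz mul1g. Qed.

Lemma zXC a x : z * x = x * z -> z ^+ a * x = x * z ^+ a.
Proof. by move=> h; apply/esym; apply: commuteX; exact/esym. Qed.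

End Relations.

Section Words.
Variables (G : groupType) (r s : G).

Lemma pos_word_cat w w' : pos_word r s (w ++ w') = pos_word r s w * pos_word r s w'.
Proof. by elim: w => [|b w IH] /=; rewrite ?mul1g // IH mulgA. Qed.

Lemma su_word_cat v v' : su_word r s (v ++ v') = su_word r s v * su_word r s v'.
Proof. by elim: v => [|b v IH] /=; rewrite ?mul1g // IH mulgA. Qed.

(* Modulo the central [z = s^2], the relations present the free product of the
   cyclic groups generated by [s] and [u = r s], of orders 2 and 3. In a reduced
   word the blocks [u s = z r] and [u^2 s = s^-1 r^-1 s] form a positive word. *)
Definition normal_form (a : nat) (b : bool) (w : seq bool) (t : nat) : G :=
  (s * s) ^+ a * (s ^+ b * (pos_word r s w * (r * s) ^+ t)).

(** Absorption of a letter on the left, by s s = z and u s = z r. *)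
Lemma normal_form_su (a : nat) (w : seq bool) (t : nat) :
  SL2_relations r s ->
  [/\ s * normal_form a false w t = normal_form a true w t,
      s * normal_form a true w t = normal_form a.+1 false w t &
      r * s * normal_form a true w t = normal_form a.+1 false (true :: w) t].
Proof.
move=> rel; rewrite /normal_form expg0 expg1 !mul1g expgSr /=.
have zE : exists z, z = s * s by exists (s * s).
have uE : exists u, u = r * s by exists (r * s).
case: zE uE => z zE [u uE]; rewrite -zE -uE.
have sZ x : s * (z ^+ a * x) = z ^+ a * (s * x).
  by rewrite !mulgA (zXC a (zs zE)).
have uZ x : u * (z ^+ a * x) = z ^+ a * (u * x).
  by rewrite !mulgA (zXC a (zu rel zE uE)).
rewrite !sZ uZ -!mulgA; split=> //; congr (_ * _).
  by rewrite mulgA -zE.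
by rewrite [LHS]mulgA (us rel zE uE) -!mulgA.
Qed.

(** Left multiplication by u when no s stands in front: exponents of u are taken modulo 3 on an
    empty word, and otherwise u r = z l or u l = s. *)
Lemma normal_form_u (a : nat) (w : seq bool) (t : nat) :
  SL2_relations r s ->
  [/\ r * s * normal_form a false [::] t = normal_form a false [::] t.+1,
      normal_form a false [::] 3 = normal_form a false [::] 0,
      r * s * normal_form a false (true :: w) t = normal_form a.+1 false (false :: w) t &
      r * s * normal_form a false (false :: w) t = normal_form a true w t].
Proof.
move=> rel; rewrite /normal_form !expg0 expg1 !mul1g [_ ^+ a.+1]expgSr /=.
have zE : exists z, z = s * s by exists (s * s).
have uE : exists u, u = r * s by exists (r * s).
have lE : exists l, l = s^-1 * r^-1 * s by exists (s^-1 * r^-1 * s).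
case: zE uE lE => z zE [u uE] [l lE]; rewrite -zE -uE -lE.
have uZ x : u * (z ^+ a * x) = z ^+ a * (u * x).
  by rewrite !mulgA (zXC a (zu rel zE uE)).
rewrite !uZ -!mulgA ?mul1g; split; congr (_ * _).
- by rewrite expgS.
- by rewrite !expgS expg0 mulg1 [LHS]mulgA (uuu rel uE).
- by rewrite [LHS]mulgA (ur rel zE uE lE) -!mulgA.
- by rewrite [LHS]mulgA (ul rel uE lE).
Qed.

End Words.

(** The data are chosen before the group: the same normal form holds in SL(2, Z) and in any target,
    which lets triviality pass from one to the other. *)
Lemma normal_formP (v : seq bool) : exists a b w t, (t < 3)%N /\
  forall (G : groupType) (r s : G), SL2_relations r s ->
    su_word r s v = normal_form r s a b w t.
Proof.
elim: v => [|c v [a [b [w [t [t3 IH]]]]]].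
  exists 0%N, false, [::], 0%N; split=> // G r s _.
  by rewrite /normal_form /= !expg0 !mulg1.
case: c.
  case: b IH => IH; [exists a.+1, false, w, t|exists a, true, w, t];
    split=> // G r s rel; rewrite /= (IH _ _ _ rel);
    by have [] := normal_form_su a w t rel.
case: b IH => IH.
  exists a.+1, false, (true :: w), t; split=> // G r s rel /=.
  by rewrite (IH _ _ _ rel); have [] := normal_form_su a w t rel.
case: w IH => [|[] w] IH.
- have [t2|t2] := ltnP t 2; [exists a, false, [::], t.+1|exists a, false, [::], 0%N];
    split=> // G r s rel; rewrite /= (IH _ _ _ rel);
    have [-> e _ _] := normal_form_u a [::] t rel => //.
  by have <- : 2 = t by lia.
- exists a.+1, false, (false :: w), t; split=> // G r s rel /=.
  by rewrite (IH _ _ _ rel); have [] := normal_form_u a w t rel.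
- exists a, true, w, t; split=> // G r s rel /=.
  by rewrite (IH _ _ _ rel); have [] := normal_form_u a w t rel.
Qed.

Local Close Scope group_scope.

(** * Matrices of SL(2, Z) and their words *)

Lemma mx2E (M : 'M[int]_2) : M = mx2 (M 0 0) (M 0 1) (M 1 0) (M 1 1).
Proof.
apply/matrixP => i j; rewrite mxE.
by case: i => [[|[|//]] ?]; case: j => [[|[|//]] ?] /=; congr (M _ _); exact/val_inj.
Qed.

Lemma mx2_entries a b c d :
  (mx2 a b c d 0 0 = a) * (mx2 a b c d 0 1 = b) *
  (mx2 a b c d 1 0 = c) * (mx2 a b c d 1 1 = d).
Proof. by rewrite !mxE. Qed.

Lemma mx2_mul a b c d a' b' c' d' : mx2 a b c d *m mx2 a' b' c' d' =
  mx2 (a * a' + b * c') (a * b' + b * d') (c * a' + d * c') (c * b' + d * d').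
Proof.
apply/matrixP => i j; rewrite mxE !big_ord_recl big_ord0 addr0 !mxE.
by case: i => [[|[|//]] ?]; case: j => [[|[|//]] ?].
Qed.

Lemma mx2_1 : 1%:M = mx2 1 0 0 1.
Proof. by rewrite [LHS]mx2E !mxE. Qed.

Lemma mx2_adj a b c d : \adj (mx2 a b c d) = mx2 d (- b) (- c) a.
Proof.
rewrite [LHS]mx2E !mxE /cofactor !det_mx11 !mxE /=.
rewrite (_ : (1 %% 2 = 1)%N) // !addn0 add0n addn1 expr0 expr1 expr2 mulrNN !mul1r.
by rewrite !mulN1r.
Qed.

Lemma SL2Z_eqP (M N : SL2Z) : (M : 'M_2) = N -> M = N.
Proof. exact: val_inj. Qed.

Lemma SL2Z_mulE (M N : SL2Z) : (M * N)%g = M *m N :> 'M_2. Proof. by []. Qed.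
Lemma SL2Z_1E : (1%g : SL2Z) = mx2 1 0 0 1 :> 'M_2. Proof. exact: mx2_1. Qed.
Lemma SL2Z_RE : SL2Z_R = mx2 1 1 0 1 :> 'M_2. Proof. by []. Qed.
Lemma SL2Z_SE : SL2Z_S = mx2 0 1 (-1) 0 :> 'M_2. Proof. by []. Qed.
Lemma SL2Z_VE (M : SL2Z) : (M^-1)%g = \adj M :> 'M_2. Proof. by []. Qed.
Definition SL2Z_sE := (SL2Z_mulE, SL2Z_1E, SL2Z_RE, SL2Z_SE, SL2Z_VE, mx2_adj, mx2_mul).

Lemma SL2Z_SL2_relations : SL2_relations SL2Z_R SL2Z_S.
Proof.
by split; apply: SL2Z_eqP; rewrite ?expgS expg0 ?mulg1 !SL2Z_sE; congr mx2.
Qed.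

Lemma SL2Z_ZE : (SL2Z_S * SL2Z_S)%g = mx2 (-1) 0 0 (-1) :> 'M_2.
Proof. by rewrite !SL2Z_sE; congr mx2. Qed.
Lemma SL2Z_UE : (SL2Z_R * SL2Z_S)%g = mx2 (-1) 1 (-1) 0 :> 'M_2.
Proof. by rewrite !SL2Z_sE; congr mx2. Qed.
Lemma SL2Z_LE : (SL2Z_S^-1 * SL2Z_R^-1 * SL2Z_S)%g = mx2 1 0 1 1 :> 'M_2.
Proof. by rewrite !SL2Z_sE; congr mx2. Qed.

Lemma SL2Z_Rn n : (SL2Z_R ^+ n)%g = mx2 1 n 0 1 :> 'M_2.
Proof.
elim: n => [|n IH]; first by rewrite expg0 SL2Z_1E.
by rewrite expgS SL2Z_mulE IH SL2Z_RE mx2_mul; congr mx2; lia.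
Qed.

Lemma SL2Z_det_entries (M : SL2Z) : M 0 0 * M 1 1 - M 0 1 * M 1 0 = 1.
Proof. by rewrite -det_mx2 -mx2E; exact/eqP/SL2Z_det. Qed.

(** By the relations the inverses of R and S are products of R and S, so both hypotheses can be run
    backwards; the Euclidean algorithm on the first column then reaches the upper triangular
    case. *)
Lemma SL2Z_ind (P : SL2Z -> Prop) : P 1%g ->
  (forall M, P M -> P (SL2Z_S * M)%g) -> (forall M, P M -> P (SL2Z_R * M)%g) ->
  forall M, P M.
Proof.
move=> P1 PS PR.
have rel := SL2Z_SL2_relations.
have PS' M : P (SL2Z_S * M)%g -> P M.
  move=> /PS/PS/PS; rewrite !mulgA.
  have [e _ _] := rel; move: e; rewrite !expgS expg0 mulg1 !mulgA => ->.
  by rewrite mul1g.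
have PR' M : P (SL2Z_R * M)%g -> P M.
  have RV : (SL2Z_R^-1 = SL2Z_S * SL2Z_R * SL2Z_S * SL2Z_R * SL2Z_S)%g.
    have [_ e _] := rel; apply: mulg1_eq; move: e.
    by rewrite !expgS expg0 mulg1 !mulgA.
  by move=> /PS/PR/PS/PR/PS; rewrite !mulgA -RV mulVg mul1g.
have PSE M : P M <-> P (SL2Z_S * M)%g by split; [exact: PS|exact: PS'].
have PRE M : P M <-> P (SL2Z_R * M)%g by split; [exact: PR|exact: PR'].
have PRV M : P (SL2Z_R^-1 * M)%g -> P M.
  by move=> /PRE; rewrite mulVKg.
have entS (M : SL2Z) : ((SL2Z_S * M)%g 0 0 = M 1 0) * ((SL2Z_S * M)%g 1 0 = - M 0 0).
  by rewrite SL2Z_mulE [X in _ *m X]mx2E SL2Z_SE mx2_mul !mx2_entries; split; ring.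
have entR (M : SL2Z) : ((SL2Z_R * M)%g 0 0 = M 0 0 + M 1 0) *
    ((SL2Z_R * M)%g 1 0 = M 1 0).
  by rewrite SL2Z_mulE [X in _ *m X]mx2E SL2Z_RE mx2_mul !mx2_entries; split; ring.
have entRV (M : SL2Z) : ((SL2Z_R^-1 * M)%g 0 0 = M 0 0 - M 1 0) *
    ((SL2Z_R^-1 * M)%g 1 0 = M 1 0).
  rewrite !SL2Z_mulE SL2Z_VE [X in _ *m X]mx2E SL2Z_RE mx2_adj mx2_mul !mx2_entries.
  by split; ring.
have base0 (M : SL2Z) : M 0 0 = 1 -> M 1 0 = 0 -> P M.
  move=> a1 c0; have d1 : M 1 1 = 1.
    by have := SL2Z_det_entries M; rewrite a1 c0 mul1r mulr0 subr0.
  case b: (M 0 1) => [n|n].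
    rewrite (_ : M = SL2Z_R ^+ n)%g; last first.
      by apply: SL2Z_eqP; rewrite SL2Z_Rn [LHS]mx2E a1 c0 d1 b.
    by elim: n {b} => [|n IH]; rewrite ?expg0 // expgS; exact: PR.
  have : (SL2Z_R ^+ n.+1 * M = 1)%g.
    apply: SL2Z_eqP; rewrite SL2Z_mulE SL2Z_Rn [X in _ *m X]mx2E mx2_mul a1 c0 d1 b.
    by rewrite SL2Z_1E; congr mx2; lia.
  move=> e; have : P (SL2Z_R ^+ n.+1 * M)%g by rewrite e.
  by elim: (n.+1) => [|k IH]; rewrite ?expg0 ?mul1g // expgS -mulgA => /PR'.
have base (M : SL2Z) : M 1 0 = 0 -> P M.
  move=> c0; have : M 0 0 * M 1 1 = 1.
    by have := SL2Z_det_entries M; rewrite c0 mulr0 subr0.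
  move=> /(congr1 absz) /eqP; rewrite abszM muln_eq1 => /andP[/eqP abs1 _].
  have [a1|a1] : M 0 0 = 1 \/ M 0 0 = -1 by lia.
    exact: base0.
  by apply/PS'/PS'/base0; rewrite !entS ?a1 ?c0 ?opprK ?oppr0.
(* R^-1 or R, according to the signs, subtracts the smaller entry of the first column from the
   larger, after S when the larger one is below. *)
suff main n (M : SL2Z) : (absz (M 0%R 0%R) + absz (M 1%R 0%R) < n)%N -> P M.
  by move=> M; exact: (main _ M (ltnSn _)).
elim: n M => // n IH M; rewrite ltnS => le_n.
have [c0|c0] := eqVneq (M 1 0) 0; first exact: base.
have [a0|a0] := eqVneq (M 0 0) 0.
  by apply/PS'/base; rewrite entS a0 oppr0.
have [ca|ac] := leqP (absz (M 1 0)) (absz (M 0 0)).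
  have [same|opp] := boolP ((0 < M 0 0) == (0 < M 1 0)).
    by apply: PRV; apply: IH; rewrite !entRV; lia.
  by apply: PR'; apply: IH; rewrite !entR; lia.
apply: PS'; have [same|opp] := boolP ((0 < M 0 0) == (0 < M 1 0)).
  by apply: PR'; apply: IH; rewrite !entR !entS; lia.
by apply: PRV; apply: IH; rewrite !entRV !entS; lia.
Qed.

Lemma SL2Z_multiplicative_uniq (G : groupType) (f g : {multiplicative SL2Z -> G}) :
  f SL2Z_R = g SL2Z_R -> f SL2Z_S = g SL2Z_S -> f =1 g.
Proof.
have one (h : {multiplicative SL2Z -> G}) : h 1%g = 1%g.
  by apply: (mulgI (h 1%g)); rewrite -gmulfM !mulg1.
move=> eR eS; elim/SL2Z_ind => [|M IH|M IH]; first by rewrite !one.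
  by rewrite !gmulfM IH eS.
by rewrite !gmulfM IH eR.
Qed.

Lemma SL2Z_word (M : SL2Z) : exists v, su_word SL2Z_R SL2Z_S v = M.
Proof.
elim/SL2Z_ind: M => [|M [v <-]|M [v <-]]; first by exists [::].
  by exists (true :: v).
exists [:: false, true, true, true & v] => /=; rewrite !mulgA.
by rewrite -(r_su SL2Z_SL2_relations erefl erefl).
Qed.

Local Notation WS := (pos_word SL2Z_R SL2Z_S).
Local Notation ZS := (SL2Z_S * SL2Z_S)%g.
Local Notation US := (SL2Z_R * SL2Z_S)%g.

Lemma pos_wordE b w : WS (b :: w) =
  (if b then mx2 1 1 0 1 else mx2 1 0 1 1) *m WS w :> 'M_2.
Proof.
rewrite -[pos_word _ _ (b :: w)]/(pos_letter _ _ b * WS w)%g SL2Z_mulE.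
by case: b => //; rewrite /pos_letter SL2Z_LE.
Qed.

Lemma pos_word_entries w : [/\ 1 <= WS w 0 0, 1 <= WS w 1 1, 0 <= WS w 0 1 &
  0 <= WS w 1 0].
Proof.
elim: w => [|b w [a d b0 c0]]; first by rewrite SL2Z_1E !mx2_entries.
by rewrite pos_wordE [X in _ *m X]mx2E; case: b; rewrite mx2_mul !mx2_entries;
  split; lia.
Qed.

Lemma pos_word_upper w : true \in w -> 1 <= WS w 0 1.
Proof.
elim: w => // b w IH; rewrite in_cons pos_wordE [X in _ *m X]mx2E.
have [a d b0 c0] := pos_word_entries w.
case: b => /= [_|/IH]; rewrite mx2_mul !mx2_entries; lia.
Qed.

Lemma pos_word_lower w : false \in w -> 1 <= WS w 1 0.
Proof.
elim: w => // b w IH; rewrite in_cons pos_wordE [X in _ *m X]mx2E.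
have [a d b0 c0] := pos_word_entries w.
case: b => /= [/IH|_]; rewrite mx2_mul !mx2_entries; lia.
Qed.

Lemma mem_nil_bool (w : seq bool) : w != [::] -> true \in w \/ false \in w.
Proof. by case: w => // -[] w _; [left|right]; rewrite in_cons eqxx. Qed.

Lemma mxtrace2 (M : 'M[int]_2) : \tr M = M 0 0 + M 1 1.
Proof.
rewrite /mxtrace !big_ord_recl big_ord0 addr0; congr (M _ _ + M _ _); exact/val_inj.
Qed.

(** Both off-diagonal entries are at least 1, so a d = 1 + b c >= 2 and the positive integers a, d
    are not both 1. *)
Lemma pos_word_trace w : true \in w -> false \in w -> 3 <= \tr (WS w).
Proof.
move=> /pos_word_upper ub /pos_word_lower lb; rewrite mxtrace2.
have [a d _ _] := pos_word_entries w; have := SL2Z_det_entries (WS w).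
move: (WS w 0 0) (WS w 0 1) (WS w 1 0) (WS w 1 1) ub lb a d => a b c d; nia.
Qed.

Lemma pure_word (G : groupType) (r s : G) n b :
  pos_word r s (nseq n b) = (pos_letter r s b ^+ n)%g.
Proof. by elim: n => [|n IH]; rewrite ?expg0 // expgS /= IH. Qed.

Lemma pure_word_trace n b : \tr (WS (nseq n b)) = 2.
Proof.
rewrite mxtrace2.
have [-> [-> _]] : WS (nseq n b) 0 0 = 1 /\ WS (nseq n b) 1 1 = 1 /\
   (if b then WS (nseq n b) 1 0 else WS (nseq n b) 0 1) = 0.
  elim: n => [|n [a1 [d1 c0]]]; first by rewrite SL2Z_1E !mx2_entries; case: b.
  rewrite -[nseq _ _]/(b :: nseq n b) pos_wordE [X in _ *m X]mx2E.
  by case: b a1 d1 c0 => a1 d1 c0; rewrite mx2_mul !mx2_entries; split; lia.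
by [].
Qed.

Lemma mixed_or_pure (w : seq bool) : (true \in w /\ false \in w) \/
  exists b, w = nseq (size w) b.
Proof.
elim: w => [|b w [[t f]|[c ->]]]; first by right; exists true.
  by left; rewrite !in_cons t f !orbT.
case: w => [|b' w'] /=; first by right; exists b.
rewrite size_nseq !in_cons.
case: b; case: c; rewrite /= ?orbT; first [by left|right].
- by exists true.
- by exists false.
Qed.

Lemma SL2Z_Zn a : (ZS ^+ a)%g = (if odd a then mx2 (-1) 0 0 (-1) else mx2 1 0 0 1)
  :> 'M_2.
Proof.
elim: a => [|a IH]; first by rewrite expg0 SL2Z_1E.
by rewrite expgS SL2Z_mulE SL2Z_ZE IH /=; case: (odd a); rewrite mx2_mul; congr mx2.
Qed.

(** A positive word times one of the six matrices U^t S^b would be a scalar sign; the entry bounds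
    of [pos_word_entries] leave only the trivial case. *)
Lemma normal_form_trivial a b w t : (t < 3)%N ->
  normal_form SL2Z_R SL2Z_S a b w t = 1%g ->
  [/\ ~~ odd a, b = false, w = [::] & t = 0%N].
Proof.
move=> t3; rewrite /normal_form => e.
have {}e : (WS w * US ^+ t * SL2Z_S ^+ b)%g = (ZS ^+ a)%g.
  have zz : (ZS ^+ a * ZS ^+ a = 1)%g.
    rewrite -expgnDr addnn -mul2n expgnA expg2.
    by rewrite (zz SL2Z_SL2_relations erefl) expg1n.
  have {}e : (SL2Z_S ^+ b * (WS w * US ^+ t) = ZS ^+ a)%g.
    by rewrite -[RHS]mulg1 -e [RHS]mulgA zz mul1g.
  have comm : (ZS ^+ a * SL2Z_S ^+ b = SL2Z_S ^+ b * ZS ^+ a)%g.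
    apply/esym/commuteX; rewrite /commute.
    by case: b {e} => /=; rewrite ?expg0 ?mulg1 ?mul1g // expg1 mulgA.
  by apply: (mulgI (SL2Z_S ^+ b)%g); rewrite mulgA e comm.
have [aw dw bw cw] := pos_word_entries w.
move: e => /(congr1 SL2Z_mx); rewrite !SL2Z_mulE SL2Z_Zn.
have bE : SL2Z_mx (SL2Z_S ^+ b)%g = if b then mx2 0 1 (-1) 0 else mx2 1 0 0 1.
  by case: b; rewrite ?expg1 ?expg0 ?SL2Z_1E.
have tE : SL2Z_mx (US ^+ t)%g = nth (mx2 1 0 0 1) [:: mx2 1 0 0 1; mx2 (-1) 1 (-1) 0;
    mx2 0 (-1) 1 (-1)] t.
  case: t t3 => [|[|[|//]]] _; rewrite ?expg0 ?expg1 ?expg2 ?SL2Z_1E ?SL2Z_UE //.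
  by rewrite SL2Z_mulE SL2Z_UE mx2_mul.
rewrite bE tE [SL2Z_mx (WS w)]mx2E.
have entE (A B : 'M[int]_2) : A = B -> (A 0 0, A 0 1, A 1 0, A 1 1) =
    (B 0 0, B 0 1, B 1 0, B 1 1) by move=> ->.
have wnil : WS w 0 1 = 0 -> WS w 1 0 = 0 -> w = [::].
  move=> b0 c0; apply: contrapT => /eqP/mem_nil_bool.
  by case=> [/pos_word_upper|/pos_word_lower]; rewrite ?b0 ?c0.
case: t t3 {tE} => [|[|[|//]]] _; case: b {bE}; case: (odd a) => /=;
  rewrite !mx2_mul => /entE; rewrite !mx2_entries => -[e1 e2 e3 e4]; try lia.
by split=> //; apply: wnil; lia.
Qed.

(** A word trivial in SL(2, Z) has a trivial normal form, hence is trivial in [G]; sending a matrix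
    to the value of any word for it is therefore well defined. *)
Lemma SL2Z_extend (G : groupType) (r s : G) : SL2_relations r s ->
  exists f : {multiplicative SL2Z -> G}, f SL2Z_R = r /\ f SL2Z_S = s.
Proof.
move=> rel; have relS := SL2Z_SL2_relations.
have trivial v : su_word SL2Z_R SL2Z_S v = 1%g -> su_word r s v = 1%g.
  have [a [b [w [t [t3 nf]]]]] := normal_formP v.
  rewrite (nf _ _ _ relS) => /(normal_form_trivial t3)[oa b0 w0 t0].
  rewrite (nf _ _ _ rel) b0 w0 t0 /normal_form !expg0 /= !mulg1 -(odd_double_half a) (negbTE oa).
  by rewrite add0n -mul2n expgnA expg2 (zz rel erefl) expg1n.
(* Letters are inverted by s^-1 = s^3 and u^-1 = u^2. *)
pose inv_word v : seq bool := flatten [seq (if b then [:: true; true; true]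
  else [:: false; false]) | b <- rev v].
have inv_wordE (H : groupType) (r' s' : H) v : SL2_relations r' s' ->
    su_word r' s' (inv_word v) = (su_word r' s' v)^-1%g.
  move=> [e1 e2 _]; elim: v => [|b v IH]; first by rewrite /= invg1.
  rewrite /inv_word rev_cons map_rcons flatten_rcons su_word_cat IH /= invgM.
  congr (_ * _)%g; case: b; rewrite /= mulg1; apply/esym/mulg1_eq.
    by rewrite -[RHS]e1 !expgS expg0 mulg1.
  by rewrite -[RHS]e2 !expgS expg0 mulg1.
have wd v v' : su_word SL2Z_R SL2Z_S v = su_word SL2Z_R SL2Z_S v' ->
    su_word r s v = su_word r s v'.
  move=> e; apply: divg1_eq; rewrite -(inv_wordE _ _ _ _ rel) -su_word_cat.
  by apply: trivial; rewrite su_word_cat (inv_wordE _ _ _ _ relS) e mulgV.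
pose word M := sval (cid (SL2Z_word M)).
have wordE M : su_word SL2Z_R SL2Z_S (word M) = M := svalP (cid (SL2Z_word M)).
pose f M := su_word r s (word M).
have fM : {morph f : M N / (M * N)%g}.
  by move=> M N; rewrite /f -su_word_cat; apply: wd; rewrite su_word_cat !wordE.
pose F : {multiplicative SL2Z -> G} :=
  HB.pack f (isMultiplicative.Build _ _ f fM).
have fE v : f (su_word SL2Z_R SL2Z_S v) = su_word r s v.
  by apply: wd; rewrite wordE.
have rE (H : groupType) (r' s' : H) : SL2_relations r' s' ->
    su_word r' s' [:: false; true; true; true] = r'.
  by move=> rel'; rewrite /= mulg1 !mulgA -(r_su rel' erefl erefl).
exists F; split; rewrite /=.
  by rewrite -{1}(rE _ _ _ relS) fE rE.
by have := fE [:: true]; rewrite /= !mulg1.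
Qed.

Lemma SL2Z_Z_central (M : SL2Z) : (ZS * M = M * ZS)%g.
Proof.
apply: SL2Z_eqP; rewrite !(SL2Z_mulE _ M) !(SL2Z_mulE M) SL2Z_ZE [SL2Z_mx M]mx2E !mx2_mul.
by congr mx2; ring.
Qed.

(** * Representatives up to conjugacy and sign *)

Definition reduced_elt (x : SL2Z) : Prop :=
  [\/ exists w, x = WS w, x = SL2Z_S, x = US | x = US * US]%g.

Definition conj_reduced (x : SL2Z) : Prop :=
  exists g a y, reduced_elt y /\ (x ^ g = ZS ^+ a * y)%g.

Lemma conj_reducedJ x g : conj_reduced (x ^ g)%g -> conj_reduced x.
Proof. by case=> h [a [y [ry e]]]; exists (g * h)%g, a, y; rewrite conjgM. Qed.

Lemma conj_reducedZ x : conj_reduced x -> conj_reduced (ZS * x)%g.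
Proof.
case=> g [a [y [ry e]]]; exists g, a.+1, y; split=> //.
by rewrite conjMg e mulgA expgS conjgE (SL2Z_Z_central g) mulKg.
Qed.

Lemma reduced_conj x : reduced_elt x -> conj_reduced x.
Proof. by move=> rx; exists 1%g, 0%N, x; rewrite conjg1 expg0 mul1g. Qed.

Lemma conj_reduced_word n w : size w = n ->
  [/\ conj_reduced (SL2Z_S * WS w), conj_reduced (US * WS w) &
      conj_reduced (US * US * WS w)]%g.
Proof.
have rel := SL2Z_SL2_relations.
have urE := ur rel erefl erefl erefl; have ulE := ul rel erefl erefl.
have uurE := uur rel erefl erefl erefl; have uulE := uul rel erefl erefl erefl.
have lsE := ls rel erefl erefl erefl.
elim: n w => [|n IH] w.
  move/size0nil => -> /=; rewrite !mulg1.
  by split; apply: reduced_conj; [apply: Or42|apply: Or43|apply: Or44].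
move=> sw; split.
- case/lastP: w sw => // w b; rewrite size_rcons => -[/IH[_ hu huu]].
  apply: (@conj_reducedJ _ SL2Z_S); rewrite conjgE -mulgA mulKg -cats1 pos_word_cat /= mulg1.
  rewrite -mulgA; case: b => /=.
    by apply: (@conj_reducedJ _ (US^-1)%g); rewrite conjgE invgK mulgK.
  rewrite lsE mulgA -SL2Z_Z_central -mulgA; apply: conj_reducedZ.
  by apply: (@conj_reducedJ _ ((US * US)^-1)%g); rewrite conjgE invgK mulgK.
- case: w sw => // b w [/IH[hs _ _]]; rewrite /= mulgA; case: b => /=.
    rewrite urE -mulgA; apply: conj_reducedZ; apply: reduced_conj.
    by apply: Or41; exists (false :: w).
  by rewrite ulE.
- case: w sw => // b w [/IH[hs _ _]]; rewrite /= mulgA; case: b => /=.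
    by rewrite uurE -mulgA; apply: conj_reducedZ.
  rewrite uulE -mulgA; apply: conj_reducedZ; apply: reduced_conj.
  by apply: Or41; exists (true :: w).
Qed.

Lemma SL2Z_conj_reduced (M : SL2Z) : conj_reduced M.
Proof.
have rel := SL2Z_SL2_relations.
have usE := us rel erefl erefl; have uusE := uus rel erefl erefl.
have [v <-] := SL2Z_word M; have [a [b [w [t [t3 nf]]]]] := normal_formP v.
rewrite (nf _ _ _ rel) /normal_form; elim: a {nf} => [|a IH]; last first.
  by rewrite expgS -mulgA; exact: conj_reducedZ.
(* Conjugation brings the trailing power of U to the front, where it meets S^b. *)
rewrite expg0 mul1g mulgA; apply: (@conj_reducedJ _ (US ^+ t)^-1%g).
rewrite conjgE invgK mulgK.
have [hs hu huu] := conj_reduced_word (erefl (size w)).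
case: t t3 => [|[|[|//]]] _; case: b; rewrite ?expg0 ?expg1 ?expg2 ?mul1g //.
- by apply: reduced_conj; apply: Or41; exists w.
- rewrite mulgA usE -mulgA; apply: conj_reducedZ; apply: reduced_conj.
  by apply: Or41; exists (true :: w).
- rewrite mulgA uusE; apply: reduced_conj.
  by apply: Or41; exists (false :: w).
Qed.

Lemma finite_orderJ (G : groupType) (x g : G) : finite_order (x ^ g)%g -> finite_order x.
Proof.
case=> n [n0 e]; exists n; split=> //.
by move: e; rewrite -conjXg => /eqP; rewrite conjg_eq1 => /eqP.
Qed.

Lemma SL2Z_infinite_order (M : SL2Z) : ~ finite_order M ->
  exists g a w, w != [::] /\ (M ^ g = ZS ^+ a * WS w)%g.
Proof.
move=> inf; have [g [a [y [ry e]]]] := SL2Z_conj_reduced M.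
have Zfin x n : (0 < n)%N -> (x ^+ n = 1)%g -> finite_order (ZS ^+ a * x)%g.
  move=> n0 xn; exists (2 * n)%N; split; first by rewrite muln_gt0.
  have comm : commute (ZS ^+ a)%g x.
    by apply/commute_sym/commuteX; rewrite /commute SL2Z_Z_central.
  rewrite expgMn // [X in (x ^+ X)%g]mulnC [X in (_ * X)%g]expgnA xn expg1n mulg1.
  by rewrite -expgnA mulnCA expgnA expg2 (zz SL2Z_SL2_relations erefl) expg1n.
have [s4 u3 _] := SL2Z_SL2_relations.
case: ry => [[w yw]|y_|y_|y_]; last 3 first.
- by case: inf; apply: (@finite_orderJ _ _ g); rewrite e y_; apply: (Zfin _ 4).
- by case: inf; apply: (@finite_orderJ _ _ g); rewrite e y_; apply: (Zfin _ 3).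
- case: inf; apply: (@finite_orderJ _ _ g); rewrite e y_; apply: (Zfin _ 3) => //.
  by rewrite -expg2 expgnAC u3 expg1n.
exists g, a, w; rewrite -yw; split=> //; apply/eqP => w0.
case: inf; apply: (@finite_orderJ _ _ g); rewrite e yw w0; apply: (Zfin _ 1) => //.
Qed.

Lemma SL2Z_trace_conj (M g : SL2Z) a N : (M ^ g = ZS ^+ a * N)%g ->
  \tr M = \tr N \/ \tr M = - \tr N.
Proof.
move=> e; have -> : \tr M = \tr (SL2Z_mx (M ^ g)%g).
  have -> : SL2Z_mx (M ^ g)%g = SL2Z_mx (g^-1)%g *m (M *m g) by [].
  rewrite mxtrace_mulC -mulmxA -[SL2Z_mx g *m _]/(SL2Z_mx (g * g^-1)%g) mulgV.
  by rewrite SL2Z_1E -mx2_1 mulmx1.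
rewrite e SL2Z_mulE SL2Z_Zn [SL2Z_mx N]mx2E !mxtrace2.
by case: (odd a); rewrite mx2_mul !mx2_entries; [right|left]; ring.
Qed.

Lemma parabolic_conj (M : SL2Z) : parabolic_mx M ->
  exists g a n b, (0 < n)%N /\ (M ^ g = ZS ^+ a * WS (nseq n b))%g.
Proof.
move=> [inf tr2]; have [g [a [w [w0 e]]]] := SL2Z_infinite_order inf.
have [[t f]|[b eb]] := mixed_or_pure w.
  have := pos_word_trace t f; have := SL2Z_trace_conj e; lia.
by exists g, a, (size w), b; rewrite -eb lt0n size_eq0.
Qed.

Lemma hyperbolic_conj (M : SL2Z) : hyperbolic_mx M ->
  exists g a w, [/\ true \in w, false \in w & (M ^ g = ZS ^+ a * WS w)%g].
Proof.
move=> [inf tr2]; have [g [a [w [w0 e]]]] := SL2Z_infinite_order inf.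
have [[t f]|[b eb]] := mixed_or_pure w; first by exists g, a, w.
have := SL2Z_trace_conj e; rewrite eb pure_word_trace => tM.
by case: tr2; case: tM.
Qed.

(** * The maps theta(R), theta(S) and their positive words *)

Section ExplicitMaps.
Variable K : fieldType.
Local Notation mp3 := {mpoly K[3]}.
Local Notation x := ('X_ord0 : mp3).
Local Notation y := ('X_1 : mp3).
Local Notation z := ('X_ord_max : mp3).
Implicit Types (u v : Cremona K).

Lemma comp_mpolyM n (G : 3.-tuple {mpoly K[n]}) (p q : mp3) :
  (p * q) \mPo G = (p \mPo G) * (q \mPo G).
Proof. exact: rmorphM. Qed.

Definition compE := (comp_mpolyD, comp_mpolyB, comp_mpolyN, comp_mpolyM,
  comp_mpolyC, @comp_mpolyX_tnth K, tnth3, @tnth_comp K).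

Lemma birational_represents F : birational F -> exists u : Cremona K, represents u F.
Proof.
move=> bF; exists (\pi_(Cremona K) (BirationalTriple (asboolT bF))).
exact: represents_pi.
Qed.

Definition S_triple : 3.-tuple mp3 := [tuple y; - x; z].

Variable e : K.
Hypothesis e0 : e != 0.
Local Notation c := (e%:MP : mp3).

Definition R_triple : 3.-tuple mp3 :=
  [tuple z * z * (x + c * y); c * y * (c * z * z + x * y); z * (c * z * z + x * y)].

Lemma birational_S : birational S_triple.
Proof.
have hX := @dhomogXi K.
apply: (@birational_intro _ _ [tuple - y; x; z] 1 1); rewrite ?oner_neq0 //.
- by apply: (@rational_map3 _ _ _ _ 1); rewrite ?rpredN ?hX // mpolyXi_neq0.
- by apply: (@rational_map3 _ _ _ _ 1); rewrite ?rpredN ?hX // mpolyXi_neq0.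
- by apply: ord3P; rewrite /S_triple !compE; ring.
- by apply: ord3P; rewrite /S_triple !compE; ring.
Qed.

(** The point [0 : 0 : 1] witnesses that the explicit polynomials below are nonzero. *)
Lemma at_origin_neq0 (p : mp3) : mmap idfun (tnth [tuple 0; 0; 1 : K]) p != 0 -> p != 0.
Proof. exact: neq0_mmap. Qed.

Ltac nz := apply: at_origin_neq0;
  rewrite ?(rmorphM, rmorphD, rmorphB, rmorphN, rmorph1) /= ?mmapXi ?mmapC ?tnth3 /=
    ?(mul0r, mulr0, add0r, addr0, mul1r, mulr1, subr0, oppr0, oner_neq0);
  rewrite ?(mulf_neq0, oner_neq0, e0) //.

Let hD (s : K) : e%:MP * z * z + s%:MP * (x * y) \is 2.-homog.
Proof.
have hX := @dhomogXi K.
apply: rpredD; first exact: (dhomogM (dhomogM (dhomogC _) (hX _)) (hX _)).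
exact: (dhomogM (dhomogC _) (dhomogM (hX _) (hX _))).
Qed.

Lemma birational_R : birational R_triple.
Proof.
have hX := @dhomogXi K; have hC := @dhomogC K.
have hDp : c * z * z + x * y \is 2.-homog.
  by have := hD 1; rewrite mpolyC1 mul1r.
have hDm : c * z * z - x * y \is 2.-homog.
  by have := hD (-1); rewrite mpolyCN mpolyC1 mulN1r.
have hl : c * x - y \is 1.-homog.
  by apply: rpredB => //; exact: (dhomogM (hC _) (hX _)).
pose Dm := c * z * z - x * y.
(* The inverse is (x, y) |-> (c (c x - y) / (c - x y), y / c); the last two arguments are the common
   factors of the two composites. *)
apply: (@birational_intro _ _ [tuple c * c * z * z * (c * x - y); y * Dm; c * z * Dm]
  (c * Dm * (c * (c * z * Dm) * (c * z * Dm) + (c * c * z * z * (c * x - y)) * (y * Dm)))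
  (c * c * c * (c * z * z + x * y) * (c * z * z + x * y) * z * z * (z * z - y * y))).
- apply: (@rational_map3 _ _ _ _ 3).
  + apply: (dhomogM (dhomogM (hX _) (hX _))); apply: rpredD => //.
    exact: (dhomogM (hC _) (hX _)).
  + exact: (dhomogM (dhomogM (hC _) (hX _)) hDp).
  + exact: (dhomogM (hX _) hDp).
  + by nz.
- apply: (@rational_map3 _ _ _ _ 3).
  + apply: (dhomogM (dhomogM (dhomogM (dhomogM (hC _) (hC _)) (hX _)) (hX _))).
    exact: hl.
  + exact: (dhomogM (hX _) hDm).
  + exact: (dhomogM (dhomogM (hC _) (hX _)) hDm).
  + by rewrite /Dm; nz.
- by rewrite /Dm; nz.
- by nz.
- by apply: ord3P; rewrite /R_triple /Dm !compE; ring.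
- by apply: ord3P; rewrite /R_triple /Dm !compE; ring.
Qed.

(** A common factor is divided out here to keep the polynomial identities for (r s)^3 and for L
    small. *)
Lemma represents_UU r s : represents r R_triple -> represents s S_triple ->
  represents (r * s * (r * s))%g [tuple - (y * (c * z * z - x * y));
    c * c * z * z * (c * x - y); c * z * (c * z * z - x * y)].
Proof.
move=> rr rs; have ru := represents_mul rr rs.
pose D := c * z * z - x * y.
have hX := @dhomogXi K; have hC := @dhomogC K.
have hDm : D \is 2.-homog.
  by have := hD (-1); rewrite mpolyCN mpolyC1 mulN1r.
have hl : c * x - y \is 1.-homog.
  by apply: rpredB => //; exact: (dhomogM (hC _) (hX _)).
apply: (same_represents (represents_mul ru ru)).
  apply: (@rational_map3 _ _ _ _ 3).
  - by rewrite rpredN; exact: (dhomogM (hX _) hDm).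
  - apply: (dhomogM (dhomogM (dhomogM (dhomogM (hC _) (hC _)) (hX _)) (hX _))).
    exact: hl.
  - exact: (dhomogM (dhomogM (hC _) (hX _)) hDm).
  - by rewrite /D; nz.
apply: (@same_map_scale _ _ _ 1 (c * z * z * D * (z * z - x * x))).
  exact: oner_neq0.
by apply: ord3P; rewrite !tnth_comp /S_triple /R_triple /D !compE; ring.
Qed.

Lemma S_R_relations r s : represents r R_triple -> represents s S_triple ->
  SL2_relations r s.
Proof.
move=> rr rs.
have rz : represents (s * s)%g [tuple - x; - y; z].
  apply: (same_represents (represents_mul rs rs)).
    have hX := @dhomogXi K.
    by apply: (@rational_map3 _ _ _ _ 1); rewrite ?rpredN ?hX // mpolyXi_neq0.
  apply: (@same_map_scale _ _ _ 1 1); rewrite ?oner_neq0 //.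
  by apply: ord3P; rewrite tnth_comp /S_triple !compE; ring.
have ru := represents_mul rr rs.
have ruu := represents_UU rr rs.
split.
- have -> : (s ^+ 4 = s * s * (s * s))%g by rewrite !expgS expg0 mulg1 !mulgA.
  apply: (@represents_eq _ _ _ (id_triple K)); last exact: represents1.
  apply: (same_represents (represents_mul rz rz)); first exact: rational_id.
  apply: (@same_map_scale _ _ _ 1 1); rewrite ?oner_neq0 //.
  by apply: ord3P; rewrite !tnth_comp !tnth_mktuple !compE; ring.
- have -> : ((r * s) ^+ 3 = (r * s) * (r * s * (r * s)))%g.
    by rewrite !expgS expg0 mulg1 !mulgA.
  apply: (@represents_eq _ _ _ (id_triple K)); last exact: represents1.
  apply: (same_represents (represents_mul ru ruu)); first exact: rational_id.
  apply: (@same_map_scale _ _ _ 1 (c * c * c * z * z * (c * z * z - x * y) * (c * z * z - x * y) * (c * c * z * z - y * y))).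
    exact: oner_neq0.
  by apply: ord3P; rewrite !tnth_comp !tnth_mktuple /S_triple /R_triple !compE; ring.
- rewrite expg2.
  apply: (represents_eq (represents_mul rz ru)).
  apply: (same_represents (represents_mul ru rz)).
    by have [] := represents_mul rz ru.
  apply: (@same_map_scale _ _ _ 1 1); rewrite ?oner_neq0 //.
  by apply: ord3P; rewrite !tnth_comp /S_triple /R_triple !compE; ring.
Qed.

Definition L_triple : 3.-tuple mp3 :=
  [tuple x * (c * z * z + x * y); c * c * z * z * (x + c * y);
         c * z * (c * z * z + x * y)].

(** By [uus], s^-1 r^-1 s equals (r s)^2 s, so no inverse has to be composed. *)
Lemma represents_L r s : represents r R_triple -> represents s S_triple ->
  represents (s^-1 * r^-1 * s)%g L_triple.
Proof.
move=> rr rs; have rel := S_R_relations rr rs.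
rewrite -(uus rel erefl erefl); have rl := represents_mul (represents_UU rr rs) rs.
suff <- : comp_triple [tuple - (y * (c * z * z - x * y));
    c * c * z * z * (c * x - y); c * z * (c * z * z - x * y)] S_triple = L_triple by [].
by apply: eq_from_tnth; apply: ord3P; rewrite /L_triple /S_triple !compE; ring.
Qed.

End ExplicitMaps.

(** * Composition of a positive word as a pair of fractions *)

Section StepMachine.

(* The state [((p, q), (p', q'))] stands for the affine map (p/q, p'/q'), and
   [step] composes it on the left with theta(R) (for [true]) or with
   theta(S^-1 R^-1 S) : (x, y) |-> (x/c, c(x + c y)/(c + x y)) (for [false]),
   without simplifying the fractions. *)
Definition state (B : Type) : Type := ((B * B) * (B * B))%type.

Definition step (B : comNzRingType) (c : B) (b : bool) (st : state B) : state B :=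
  let: ((p, q), (p', q')) := st in
  let n := p * q' + c * p' * q in let d := c * q * q' + p * p' in
  if b then ((n, d), (c * p', q')) else ((p, c * q), (c * n, d)).

Definition word_state (B : comNzRingType) (c x y z : B) (w : seq bool) : state B :=
  foldr (step c) ((x, z), (y, z)) w.

Definition map_state (B B' : Type) (f : B -> B') (st : state B) : state B' :=
  let: ((p, q), (p', q')) := st in ((f p, f q), (f p', f q')).

Lemma map_word_state (B B' : comNzRingType) (f : {rmorphism B -> B'}) c x y z w :
  map_state f (word_state c x y z w) = word_state (f c) (f x) (f y) (f z) w.
Proof.
elim: w => //= b w <-; case: (word_state _ _ _ _ _) => [[p q] [p' q']] /=.
by case: b; rewrite /= !(rmorphD, rmorphM).
Qed.

Definition word_degrees (w : seq bool) : nat * nat :=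
  foldr (fun (b : bool) d => if b then (d.1 + d.2, d.2)%N else (d.1, d.1 + d.2)%N)
    (1, 1)%N w.

Variable K : fieldType.
Local Notation mp3 := {mpoly K[3]}.
Local Notation x := ('X_ord0 : mp3).
Local Notation y := ('X_1 : mp3).
Local Notation z := ('X_ord_max : mp3).

Definition state_triple (st : state mp3) : 3.-tuple mp3 :=
  let: ((p, q), (p', q')) := st in [tuple p * q'; p' * q; q * q'].

Variable e : K.
Hypothesis e0 : e != 0.
Local Notation c := (e%:MP : mp3).

Definition state_homog (st : state mp3) (d : nat * nat) : Prop :=
  let: ((p, q), (p', q')) := st in
  [/\ p \is (d.1).-homog, q \is (d.1).-homog,
      p' \is (d.2).-homog & q' \is (d.2).-homog].

Lemma word_state_homog w : state_homog (word_state c x y z w) (word_degrees w).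
Proof.
have hC p d : p \is d.-homog -> c * p \is d.-homog.
  by move=> hp; rewrite -[d]add0n; apply: dhomogM => //; exact: dhomogC.
elim: w => [|b w] /=; first by split; exact: dhomogXi.
case: (word_state _ _ _ _ _) => [[p q] [p' q']]; case: (word_degrees w) => d d' /=.
move=> [hp hq hp' hq'].
have h1 : p * q' + c * p' * q \is (d + d')%N.-homog.
  apply: rpredD; first exact: dhomogM.
  by rewrite addnC; apply: dhomogM => //; exact: hC.
have h2 : c * q * q' + p * p' \is (d + d')%N.-homog.
  by apply: rpredD; apply: dhomogM => //; exact: hC.
by case: b; split=> //=; exact: hC.
Qed.

Lemma state_triple_homog w : let d := word_degrees w in
  forall i, tnth (state_triple (word_state c x y z w)) i \is (d.1 + d.2)%N.-homog.
Proof.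
move=> d; have := word_state_homog w; rewrite -/d.
case: (word_state _ _ _ _ _) => [[p q] [p' q']] [hp hq hp' hq'] /=.
by apply: ord3P; rewrite !tnth3; [exact: dhomogM|rewrite addnC; exact: dhomogM|exact: dhomogM].
Qed.

Definition state_nz (B : comNzRingType) (st : state B) : Prop :=
  let: ((p, q), (p', q')) := st in q != 0 /\ q' != 0.

Lemma word_state_nz w : state_nz (word_state c x y z w).
Proof.
(* At [0 : 0 : 1] both numerators remain 0, so the new denominators are products of old ones and
   [e], hence nonzero. *)
pose at0 : {rmorphism mp3 -> K} := mmap idfun (tnth [tuple 0; 0; 1 : K]).
suff : let: ((p, q), (p', q')) := map_state at0 (word_state c x y z w) in
    [/\ p = 0, q != 0, p' = 0 & q' != 0].
  case: (word_state _ _ _ _ _) => [[p q] [p' q']] /= [_ nq _ nq'].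
  by split; [apply: contraNneq nq|apply: contraNneq nq'] => ->; rewrite rmorph0.
have [ax ay az ac] : [/\ at0 x = 0, at0 y = 0, at0 z = 1 & at0 c = e].
  by rewrite /at0 /= !mmapXi mmapC !tnth3.
rewrite map_word_state ax ay az ac.
elim: w => [|b w] /=; first by split; rewrite ?oner_neq0.
case: (word_state _ _ _ _ _) => [[p q] [p' q']] [-> nq -> nq'].
by case: b; rewrite /= ?(mul0r, mulr0, addr0); split; rewrite ?mulf_neq0.
Qed.

Lemma represents_word r s w : represents r (R_triple e) -> represents s (S_triple K) ->
  represents (pos_word r s w) (state_triple (word_state c x y z w)).
Proof.
move=> rr rs; have rl := represents_L e0 rr rs.
have rat v : rational_map (state_triple (word_state c x y z v)).
  split; first by exists ((word_degrees v).1 + (word_degrees v).2)%N; exact: state_triple_homog.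
  exists ord_max; have := word_state_nz v.
  case: (word_state _ _ _ _ _) => [[p q] [p' q']] [nq nq'].
  by rewrite /state_triple tnth3 mulf_neq0.
elim: w => [|b w IH].
  apply: (same_represents (represents1 K) (rat _)).
  apply: (@same_map_scale _ _ _ z 1); first exact: mpolyXi_neq0.
  by apply: ord3P; rewrite /= !tnth3 !tnth_mktuple mul1r mulrC.
have rm : represents (pos_word r s (b :: w)) (comp_triple
    (if b then R_triple e else L_triple e) (state_triple (word_state c x y z w))).
  by rewrite /=; case: b; exact: represents_mul.
apply: (same_represents rm (rat _)); move: (word_state_nz w).
rewrite /=; case: (word_state _ _ _ _ _) => [[p q] [p' q']] [nq nq'].
(* The composite with R or L carries this common factor, which disappears in the next state. *)
apply: (@same_map_scale _ _ _ 1 (q * q' * (if b then q else q'))).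
  exact: oner_neq0.
by apply: ord3P; clear rm; case: b; rewrite /= !tnth_comp /R_triple /L_triple !compE; ring.
Qed.

End StepMachine.

(** * The fractions on the line x = y *)

Section PositiveCurve.
Variable R : realType.
Local Notation C := R[i].
Implicit Types (p q : {poly C}) (a b : C).

(* [half_plane a b] is Re (a * b^* ), which has the sign of Re (a / b). *)
Definition half_plane a b : R :=
  complex.Re a * complex.Re b + complex.Im a * complex.Im b.

Definition sqnorm a : R := complex.Re a ^+ 2 + complex.Im a ^+ 2.

Lemma sqnorm_gt0 a : a != 0 -> 0 < sqnorm a.
Proof.
case: a => a1 a2 nz; rewrite /sqnorm /= lt0r addr_ge0 ?sqr_ge0 // andbT.
apply: contraNneq nz => /eqP; rewrite paddr_eq0 ?sqr_ge0 // !sqrf_eq0.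
by case/andP=> /eqP-> /eqP->.
Qed.

Lemma half_planeaa a : half_plane a a = sqnorm a.
Proof. by rewrite /half_plane /sqnorm !expr2. Qed.

Lemma half_plane_scale (e : R) a b :
  (half_plane ((e%:C)%C * a) b = e * half_plane a b) *
  (half_plane a ((e%:C)%C * b) = e * half_plane a b).
Proof. by case: a b => [a1 a2] [b1 b2]; rewrite /half_plane /=; split; ring. Qed.

(** For e > 0 the two weights are nonnegative, so two fractions with real parts of the same sign
    cannot produce one with the opposite sign. *)
Lemma half_plane_step (e : R) a b a' b' : let c := (e%:C)%C in
  half_plane (a * b' + c * a' * b) (c * b * b' + a * a') =
  half_plane a b * (e * (sqnorm a' + sqnorm b')) +
  half_plane a' b' * (e ^+ 2 * sqnorm b + sqnorm a).
Proof.
case: a b a' b' => [a1 a2] [b1 b2] [a1' a2'] [b1' b2'].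
by rewrite /half_plane /sqnorm /=; ring.
Qed.

(* A common zero of the numerator and the denominator forces a' = +-b' and
   a = -+c b, that is, a/b and a'/b' on opposite sides of the imaginary axis. *)
Lemma half_plane_coprime (e : R) a b a' b' : 0 < e -> ~ (a = 0 /\ b = 0) ->
  ~ (a' = 0 /\ b' = 0) -> Num.sg (half_plane a b) = Num.sg (half_plane a' b') ->
  let c := (e%:C)%C in
  ~ (a * b' + c * a' * b = 0 /\ c * b * b' + a * a' = 0).
Proof.
move=> e0 ab ab' sg c [n0 d0].
have c0 : c != 0.
  by rewrite /c; apply/eqP => -[] /eqP; rewrite gt_eqF.
have : c * b * ((b' - a') * (b' + a')) = 0.
  transitivity (b' * (c * b * b' + a * a') - a' * (a * b' + c * a' * b)); first by ring.
  by rewrite n0 d0 !mulr0 subr0.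
move/eqP; rewrite !mulf_eq0 (negbTE c0) /= => /orP[/eqP b0|].
  apply: ab'; move: n0 d0; rewrite b0 !mulr0 mul0r addr0 add0r.
  have a0 : a != 0 by apply/eqP => a0; exact: ab.
  move/eqP; rewrite mulf_eq0 (negbTE a0) => /eqP b'0.
  by move/eqP; rewrite mulf_eq0 (negbTE a0) => /eqP a'0.
have [b'0|b'0] := eqVneq b' 0.
  rewrite b'0 sub0r add0r oppr_eq0 orbb => /eqP a'0; exact: ab'.
have key s : a' = s * b' -> s * s = 1 -> a = - s * (c * b).
  move=> ea' ss; apply: (mulIf b'0); apply/eqP; rewrite -subr_eq0; apply/eqP.
  by rewrite -[RHS]n0 ea'; ring.
have nb : b != 0 -> 0 < half_plane (c * b) b.
  by move=> b0; rewrite half_plane_scale half_planeaa mulr_gt0 ?sqnorm_gt0.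
have b0 : b != 0.
  apply/eqP => b0; apply: ab; split=> //.
  have : a * b' = 0 by rewrite -[RHS]n0 b0 mulr0 addr0.
  by move/eqP; rewrite mulf_eq0 (negbTE b'0) orbF => /eqP.
have Nhp u v : half_plane (- u) v = - half_plane u v.
  by case: u v => [u1 u2] [v1 v2]; rewrite /half_plane /=; ring.
have s1 : Num.sg (half_plane b' b') = 1.
  by rewrite gtr0_sg // half_planeaa sqnorm_gt0.
rewrite subr_eq0 addr_eq0 => /orP[/eqP eb|/eqP eb].
- have ea := key 1 (etrans (esym eb) (esym (mul1r _))) (mulr1 1).
  move: sg; rewrite ea -eb mulN1r Nhp s1 ltr0_sg ?oppr_lt0 ?nb // => /eqP.
  by rewrite eq_sym -subr_eq0 opprK -mulr2n pnatr_eq0.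
- have ea' : a' = (-1) * b' by rewrite eb mulN1r opprK.
  have ea := key (-1) ea' (etrans (mulrNN _ _) (mulr1 _)).
  move: sg; rewrite ea ea' mulN1r opprK mul1r Nhp sgrN s1 gtr0_sg ?nb // => /eqP.
  by rewrite -subr_eq0 opprK -mulr2n pnatr_eq0.
Qed.

(** The four products pair each of [a], [b] with each of [a'], [b'], so the largest degree is the
    sum of the two largest; the predecessors come from size = degree + 1. *)
Lemma max_size_step (a b a' b' d d' : nat) : (0 < a)%N -> (0 < b)%N -> (0 < a')%N ->
  (0 < b')%N -> maxn a b = d.+1 -> maxn a' b' = d'.+1 ->
  maxn (maxn (a + b').-1 (a' + b).-1) (maxn (b + b').-1 (a + a').-1) = (d + d').+1.
Proof. lia. Qed.

(** In [R[i]], [0 <= a] means that a is real and nonnegative, so leading terms cannot cancel in a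
    sum and degrees stay exact. *)
Definition nonneg_poly p := forall i, 0 <= p`_i.

Lemma nonneg_polyD p q : nonneg_poly p -> nonneg_poly q -> nonneg_poly (p + q).
Proof. by move=> hp hq i; rewrite coefD addr_ge0. Qed.

Lemma nonneg_polyM p q : nonneg_poly p -> nonneg_poly q -> nonneg_poly (p * q).
Proof. by move=> hp hq i; rewrite coefM sumr_ge0 // => j _; rewrite mulr_ge0. Qed.

Lemma size_nonnegD p q : nonneg_poly p -> nonneg_poly q ->
  size (p + q) = maxn (size p) (size q).
Proof.
have le f g : nonneg_poly f -> nonneg_poly g -> (size f <= size (f + g)%R)%N.
  move=> hf hg; have [->|f0] := eqVneq f 0; first by rewrite size_poly0.
  rewrite -(prednK (n := size f)) ?size_poly_gt0 // ltnNge; apply/negP => ge.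
  have : (f + g)`_(size f).-1 = 0 by rewrite nth_default.
  rewrite coefD => /eqP; rewrite paddr_eq0 // => /andP[].
  by rewrite -lead_coefE lead_coef_eq0 (negbTE f0).
move=> hp hq; apply/eqP; rewrite eqn_leq size_polyD geq_max le //=.
by rewrite addrC le.
Qed.

Variable e : R.
Hypothesis e0 : 0 < e.
Let c : {poly C} := ((e%:C)%C)%:P.

(** Nonnegative coefficients fix the degrees. The pointwise clause, both fractions reduced with real
    parts of equal sign, is the input of [half_plane_coprime] at the next step. *)
Definition curve_inv (st : state {poly C}) (d : nat * nat) : Prop :=
  let: ((p, q), (p', q')) := st in
  [/\ [/\ nonneg_poly p, nonneg_poly q, nonneg_poly p' & nonneg_poly q'],
      [/\ p != 0, q != 0, p' != 0 & q' != 0],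
      maxn (size p) (size q) = d.1.+1 /\ maxn (size p') (size q') = d.2.+1 &
      forall t, [/\ ~ (p.[t] = 0 /\ q.[t] = 0), ~ (p'.[t] = 0 /\ q'.[t] = 0) &
        Num.sg (half_plane p.[t] q.[t]) = Num.sg (half_plane p'.[t] q'.[t])]].

Lemma curve_word w : curve_inv (word_state c 'X 'X 1 w) (word_degrees w).
Proof.
have c0 : (e%:C)%C != 0 :> C by apply/eqP => -[] /eqP; rewrite gt_eqF.
have nnc : nonneg_poly c.
  by move=> i; rewrite coefC; case: (i == 0%N); rewrite ?lexx // lecE /= eqxx ltW.
have szc p : size (c * p) = size p by rewrite size_Cmul.
have sgM (k r : R) : 0 < k -> Num.sg (k * r) = Num.sg r.
  by move=> k0; rewrite sgrM gtr0_sg // mul1r.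
elim: w => [|b w] /=.
  split.
  - by split=> i; rewrite ?coefX ?coef1 ler0n.
  - by rewrite polyX_eq0 oner_neq0.
  - by rewrite size_polyX size_poly1.
  - by move=> t; rewrite hornerX hornerC; split=> // -[_ /eqP]; rewrite oner_eq0.
case: (word_state _ _ _ _ _) => [[p q] [p' q']]; case: (word_degrees w) => d d' /=.
move=> [[np nq np' nq'] [zp zq zp' zq'] [sz sz'] pt].
have nn : nonneg_poly (p * q' + c * p' * q).
  by apply: nonneg_polyD; do ?[exact: nonneg_polyM]; apply: nonneg_polyM => //;
    exact: nonneg_polyM.
have nd : nonneg_poly (c * q * q' + p * p').
  by apply: nonneg_polyD; do ?[exact: nonneg_polyM]; apply: nonneg_polyM => //;
    exact: nonneg_polyM.
have zc : c != 0 by rewrite polyC_eq0.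
have szn : size (p * q' + c * p' * q) = maxn (size p + size q').-1 (size p' + size q).-1.
  rewrite size_nonnegD; last by apply: nonneg_polyM => //; exact: nonneg_polyM.
    by rewrite -mulrA szc !size_mul.
  exact: nonneg_polyM.
have szd : size (c * q * q' + p * p') = maxn (size q + size q').-1 (size p + size p').-1.
  rewrite size_nonnegD; first by rewrite -mulrA szc !size_mul.
    by apply: nonneg_polyM => //; exact: nonneg_polyM.
  exact: nonneg_polyM.
have gt0s : [/\ (0 < size p)%N, (0 < size q)%N, (0 < size p')%N & (0 < size q')%N].
  by rewrite !size_poly_gt0.
have zn : p * q' + c * p' * q != 0.
  by rewrite -size_poly_gt0 szn; case: gt0s; lia.
have zd : c * q * q' + p * p' != 0.
  by rewrite -size_poly_gt0 szd; case: gt0s; lia.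
(* The new fraction is reduced at t and its real part has the common sign of the old ones; the two
   weights are strictly positive because the old fractions are reduced at t. *)
have new t : ~ ((p * q' + c * p' * q).[t] = 0 /\ (c * q * q' + p * p').[t] = 0) /\
    Num.sg (half_plane (p * q' + c * p' * q).[t] (c * q * q' + p * p').[t]) =
    Num.sg (half_plane p.[t] q.[t]).
  have [npq npq' sg] := pt t; rewrite !hornerE.
  split; first exact: half_plane_coprime.
  rewrite half_plane_step.
  have k1 : 0 < e * (sqnorm p'.[t] + sqnorm q'.[t]).
    rewrite mulr_gt0 //.
    have ge a : 0 <= sqnorm a by rewrite addr_ge0 ?sqr_ge0.
    have [z|nz] := eqVneq p'.[t] 0; last by rewrite ltr_wpDr // sqnorm_gt0.
    by rewrite ltr_wpDl // sqnorm_gt0 //; apply/eqP => z'; exact: npq'.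
  have k2 : 0 < e ^+ 2 * sqnorm q.[t] + sqnorm p.[t].
    have ge a : 0 <= sqnorm a by rewrite addr_ge0 ?sqr_ge0.
    have [z|nz] := eqVneq p.[t] 0.
      rewrite ltr_wpDr // mulr_gt0 ?exprn_gt0 ?sqnorm_gt0 //.
      by apply/eqP => z'; exact: npq.
    apply: ltr_wpDl; last exact: sqnorm_gt0.
    by apply: mulr_ge0 => //; exact: sqr_ge0.
  move: sg; set r1 := half_plane p.[t] q.[t]; set r2 := half_plane p'.[t] q'.[t].
  case: (ltrgtP r1 0) => [lt|gt|->].
  - rewrite (ltr0_sg lt) => /esym s2; have lt2 : r2 < 0 by rewrite -sgr_lt0 s2 ltrN10.
    by rewrite ltr0_sg // ltr_wnDr ?nmulr_rlt0 // ltW // pmulr_llt0.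
  - rewrite (gtr0_sg gt) => /esym s2; have gt2 : 0 < r2 by rewrite -sgr_gt0 s2 ltr01.
    by rewrite gtr0_sg // addr_gt0 // mulr_gt0.
  - rewrite sgr0 => /esym /eqP; rewrite sgr_eq0 => /eqP ->.
    by rewrite !mul0r addr0 sgr0.
have sgl t : Num.sg (half_plane (c * p').[t] q'.[t]) = Num.sg (half_plane p'.[t] q'.[t]).
  by rewrite hornerM hornerC half_plane_scale sgM.
have cz p1 t : (c * p1).[t] = 0 -> p1.[t] = 0.
  by rewrite hornerM hornerC => /eqP; rewrite mulf_eq0 (negbTE c0) => /eqP.
case: b; split; rewrite ?szc ?szn ?szd.
- by split=> //; exact: nonneg_polyM.
- by split=> //; rewrite mulf_neq0.
- by case: gt0s => *; split=> //; exact: max_size_step.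
- move=> t; have [nt sgt] := new t; have [h1 h2 h3] := pt t; split=> //.
    by move=> [/cz h4 h5]; exact: h2.
  by rewrite sgt sgl.
- by split=> //; exact: nonneg_polyM.
- by split=> //; rewrite mulf_neq0.
- by case: gt0s => *; split=> //; exact: max_size_step.
- move=> t; have [nt sgt] := new t; have [h1 h2 h3] := pt t; split=> //.
  + by move=> [h4 /cz h5]; exact: h1.
  + by move=> [/cz h4 h5]; exact: nt.
  + rewrite ![(c * _).[t]]hornerM !hornerC !half_plane_scale !sgM //.
Qed.

End PositiveCurve.

Section WordDegrees.

Definition degree_step (w : seq bool) (d : nat * nat) : nat * nat :=
  foldr (fun (b : bool) d => if b then (d.1 + d.2, d.2)%N else (d.1, d.1 + d.2)%N) d w.

Lemma word_degrees_cat w w' :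
  word_degrees (w ++ w') = degree_step w (word_degrees w').
Proof. exact: foldr_cat. Qed.

(** A letter adds one component to the other, so neither decreases, and the one that grows reaches
    [m.*2]. A word with both letters thus doubles the lower bound. *)
Lemma degree_step_mono w m d : (m <= minn d.1 d.2)%N ->
  let d' := degree_step w d in
  [/\ (m <= minn d'.1 d'.2)%N, true \in w -> (m.*2 <= d'.1)%N &
      false \in w -> (m.*2 <= d'.2)%N].
Proof.
move=> hm; elim: w => [|b w] //=; case: (degree_step w d) => d1 d2 /= [h ht hf].
rewrite !in_cons; case: b => /=; split.
- by lia.
- by lia.
- by move=> /hf; lia.
- by lia.
- by move=> /ht; lia.
- by lia.
Qed.

Lemma mixed_word_degrees w n : true \in w -> false \in w ->
  (2 ^ n <= minn (word_degrees (flatten (nseq n w))).1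
                 (word_degrees (flatten (nseq n w))).2)%N.
Proof.
move=> t f; elim: n => [|n IH] //=; rewrite word_degrees_cat.
have [_ /(_ t) h1 /(_ f) h2] := degree_step_mono w IH.
by rewrite expnS mul2n leq_min h1.
Qed.

Lemma pure_word_degrees n (b : bool) :
  word_degrees (nseq n b) = if b then (n.+1, 1%N) else (1%N, n.+1).
Proof. by case: b; elim: n => //= n ->; rewrite ?addn1. Qed.

Lemma pos_word_power (G : groupType) (r s : G) w n :
  pos_word r s (flatten (nseq n w)) = (pos_word r s w ^+ n)%g.
Proof. by elim: n => [|n IH]; rewrite ?expg0 // expgS -IH /= pos_word_cat. Qed.

End WordDegrees.

Section WordDegreeBounds.
Variables (R : realType) (e : R).
Hypothesis e_gt0 : 0 < e.
Local Notation C := R[i].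
Variables (r s : Cremona C).
Hypotheses (rr : represents r (R_triple (e%:C)%C)) (rs : represents s (S_triple C)).

Let e0 : (e%:C)%C != 0 :> C. Proof. by apply/eqP => -[] /eqP; rewrite gt_eqF. Qed.

(** The upper bound is the degree of the unreduced triple. For the lower one, each fraction is
    reduced on the line x = y, where [degree_ge] applies. *)
Lemma degree_pos_word w :
  (maxn (word_degrees w).1 (word_degrees w).2 <= degree (pos_word r s w) <=
   (word_degrees w).1 + (word_degrees w).2)%N.
Proof.
have rw := represents_word e0 w rr rs.
apply/andP; split; last first.
  by apply: degree_le rw _; exact: state_triple_homog.
pose f : {rmorphism {mpoly C[3]} -> {poly C}} := mmap polyC (diag_line C).
have [fx fy fz fc] : [/\ f 'X_ord0 = 'X, f 'X_1 = 'X, f 'X_ord_max = 1 &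
    f (e%:C)%C%:MP = ((e%:C)%C)%:P].
  by rewrite /f /= !mmapXi mmapC /diag_line !tnth3.
have := curve_word e_gt0 w.
have <- : map_state f (word_state (e%:C)%C%:MP 'X_ord0 'X_1 'X_ord_max w) =
    word_state ((e%:C)%C)%:P 'X 'X 1 w by rewrite map_word_state fx fy fz fc.
move: rw; case: (word_state _ _ _ _ _) => [[p q] [p' q']] /= rw.
move=> [_ [zp zq zp' zq'] [sz sz'] pt].
have onE k : on_line (tnth [tuple p * q'; p' * q; q * q'] k) =
    tnth [tuple f p * f q'; f p' * f q; f q * f q'] k.
  by elim/ord3P: k; rewrite !tnth3 /on_line rmorphM.
have z0 : on_line (tnth [tuple p * q'; p' * q; q * q'] ord_max) != 0.
  by rewrite onE tnth3 mulf_neq0.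
(* Over an algebraically closed field, coprime means without common root. *)
have cop : coprimep (f p) (f q).
  apply/Pdiv.ClosedField.coprimepP => t /rootP pt0; apply/eqP => qt0.
  by have [[]] := pt t.
have cop' : coprimep (f p') (f q').
  apply/Pdiv.ClosedField.coprimepP => t /rootP pt0; apply/eqP => qt0.
  by have [_ []] := pt t.
have h1 : (maxn (size (f p)) (size (f q)) <= (degree (pos_word r s w)).+1)%N.
  by apply: (degree_ge (i := ord0) rw z0 _ cop); rewrite !onE !tnth3; ring.
have h2 : (maxn (size (f p')) (size (f q')) <= (degree (pos_word r s w)).+1)%N.
  by apply: (degree_ge (i := 1) rw z0 _ cop'); rewrite !onE !tnth3; ring.
by move: h1 h2; rewrite sz sz' !ltnS geq_max => -> ->.
Qed.

Local Notation z := (s * s)%g.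

Lemma degree_Z : (degree z <= 1)%N.
Proof.
have rz := represents_mul rs rs; apply: degree_le rz _ => i.
have hX := @dhomogXi C.
by elim/ord3P: i; rewrite /S_triple !compE ?rpredN; exact: hX.
Qed.

(** Multiplication by z^a does not raise the degree and is an involution, which gives both
    inequalities. *)
Lemma degree_ZX a u : degree (z ^+ a * u)%g = degree u.
Proof.
have rel := S_R_relations e0 rr rs.
have le b v : (degree (z ^+ b * v)%g <= degree v)%N.
  elim: b => [|b IH]; first by rewrite expg0 mul1g.
  rewrite expgS -mulgA; apply: leq_trans (degree_mul _ _) _.
  by apply: leq_trans IH; rewrite -[leqRHS]mul1n leq_mul2r degree_Z orbT.
apply/eqP; rewrite eqn_leq le /=.
have {1}-> : u = (z ^+ a * (z ^+ a * u))%g.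
  by rewrite mulgA -expgnDr addnn -mul2n expgnA expg2 (zz rel erefl) expg1n mul1g.
exact: le.
Qed.

Lemma Z_word_power a w n : ((z ^+ a * pos_word r s w) ^+ n =
  z ^+ (a * n) * pos_word r s (flatten (nseq n w)))%g.
Proof.
have rel := S_R_relations e0 rr rs.
rewrite pos_word_power expgMn ?expgnA //.
apply/commute_sym/commuteX; rewrite /commute.
elim: w => [|b w IH] /=; first by rewrite mulg1 mul1g.
rewrite -[LHS]mulgA IH [LHS]mulgA [RHS]mulgA; congr (_ * _)%g; apply/esym.
by case: b => /=; [exact: (zr rel erefl erefl)|exact: (zl rel erefl erefl erefl)].
Qed.

Lemma mixed_growth a w n : true \in w -> false \in w ->
  (2 ^ n <= degree ((z ^+ a * pos_word r s w) ^+ n)%g)%N.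
Proof.
move=> t f; rewrite Z_word_power degree_ZX.
have /andP[le _] := degree_pos_word (flatten (nseq n w)).
apply: leq_trans le; apply: leq_trans (mixed_word_degrees n t f) _.
by rewrite geq_min leq_maxl.
Qed.

Lemma pure_growth a k (b : bool) n :
  (k * n <= degree ((z ^+ a * pos_word r s (nseq k b)) ^+ n)%g <= k * n + 2)%N.
Proof.
rewrite Z_word_power degree_ZX.
have -> : flatten (nseq n (nseq k b)) = nseq (n * k) b.
  by elim: n => //= n ->; rewrite mulSn nseqD.
have := degree_pos_word (nseq (n * k) b).
by rewrite pure_word_degrees mulnC; case: b => /= /andP[]; lia.
Qed.

End WordDegreeBounds.

(** * Degree growth and preservation of the type *)

Section Fekete.
Variable R : realType.

Lemma subadditive_mul (u : nat -> R) q m r : u 0%N = 0 ->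
  (forall m n, u (m + n)%N <= u m + u n) -> u (q * m + r)%N <= q%:R * u m + u r.
Proof.
move=> u0 uD; elim: q => [|q IH]; first by rewrite mul0n add0n mul0r add0r.
rewrite mulSn -addnA; apply: le_trans (uD _ _) _.
by rewrite -natr1 mulrDl mul1r; lra.
Qed.

Lemma fekete (u : nat -> R) : u 0%N = 0 -> (forall n, 0 <= u n) ->
  (forall m n, u (m + n)%N <= u m + u n) ->
  (fun n => u n / n%:R) @ \oo --> inf [set u n.+1 / n.+1%:R | n in setT].
Proof.
move=> u0 u_ge0 uD; set A := [set _ | _ in _]; set L := inf A.
have infA : has_inf A.
  split; first by exists (u 1%N / 1%:R); exists 0%N.
  by exists 0 => _ [n _ <-]; rewrite divr_ge0.
have Lle n : (0 < n)%N -> L <= u n / n%:R.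
  case: n => // n _; apply: ge_inf; last by exists n.
  exact: infA.2.
apply/cvgrPdist_le => eps eps0.
have eps2 : 0 < eps / 2 by rewrite divr_gt0.
(* With n = q (m + 1) + r, subadditivity bounds u n by q u(m + 1) + u r: the first term divided by n
   is within [eps / 2] of the infimum, the second is at most the constant [M]. *)
have [_ [m _ <-] mL] := inf_adherent eps2 infA.
pose M := \sum_(r < m.+1) u r.
have M0 : 0 <= M by rewrite sumr_ge0.
have uM r : (r < m.+1)%N -> u r <= M.
  by move=> rm; rewrite /M (bigD1 (Ordinal rm)) //= lerDl sumr_ge0.
exists (Num.truncn (M / (eps / 2))).+1 => // n /= nN.
have n0 : (0 < n)%N by apply: leq_trans nN.
have nR : 0 < n%:R :> R by rewrite ltr0n.
have Mn : M / n%:R <= eps / 2.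
  rewrite ler_pdivrMr // mulrC -ler_pdivrMr //; apply: ltW.
  apply: lt_le_trans (truncnS_gt _) _.
  by rewrite ler_nat.
rewrite ler0_norm ?subr_le0 ?Lle // opprB lerBlDl.
have -> : L + eps = L + eps / 2 + eps / 2 by rewrite -addrA -splitr.
apply: le_trans (lerD (ltW mL) Mn).
rewrite ler_pdivrMr // mulrDl divfK ?gt_eqF //.
rewrite {1}(divn_eq n m.+1); apply: le_trans (subadditive_mul _ _ _ u0 uD) _.
apply: lerD; last by apply: uM; rewrite ltn_mod.
have -> : u m.+1 / m.+1%:R * n%:R = n%:R / m.+1%:R * u m.+1 by ring.
apply: ler_wpM2r => //.
rewrite ler_pdivlMr ?ltr0n // -natrM ler_nat.
exact: leq_trunc_div.
Qed.

(** Fekete's lemma for the logarithms identifies the limit as an infimum, so it suffices to bound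
    every term ln(a n) / n below by ln 2; the constant [C] is absorbed by passing to multiples of
    n. *)
Lemma root_limit (a : nat -> nat) : a 0%N = 1%N -> (forall n, (0 < a n)%N) ->
  (forall m n, (a (m + n) <= a m * a n)%N) ->
  (exists C, forall n, (2 ^ n <= C * a n)%N) ->
  1 < limn (fun n => (a n)%:R `^ (n%:R^-1) : R).
Proof.
move=> a0 a_gt0 aM [C aC]; pose u n : R := ln (a n)%:R.
have aR n : 0 < (a n)%:R :> R by rewrite ltr0n.
have u0 : u 0%N = 0 by rewrite /u a0 ln1.
have u_ge0 n : 0 <= u n by rewrite ln_ge0 // ler1n.
have uD m n : u (m + n)%N <= u m + u n.
  by rewrite -lnM ?posrE // -natrM ler_ln ?posrE ?ltr0n ?muln_gt0 ?a_gt0 // ler_nat.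
have := fekete u0 u_ge0 uD; set L := inf _ => cvL.
have -> : (fun n => (a n)%:R `^ (n%:R^-1) : R) = (fun n => expR (u n / n%:R)).
  apply/funext => n; rewrite /powR gt_eqF // mulrC //.
have cvE : (fun n => expR (u n / n%:R)) @ \oo --> expR L.
  exact: (continuous_cvg _ (@continuous_expR R L) cvL).
rewrite (cvg_lim _ cvE) //.
rewrite -expR0 ltr_expR; apply: (@lt_le_trans _ _ (ln 2)); first by rewrite ln_gt0 // ltr1n.
apply: lb_le_inf; first by exists (u 1%N / 1%:R); exists 0%N.
move=> _ [n _ <-]; rewrite ler_pdivlMr ?ltr0n //.
(* A term below ln 2 has a deficit [d] that accumulates: k d <= ln C for every k, which is
   impossible. *)
rewrite leNgt; apply/negP => lt; set d := ln 2 * n.+1%:R - u n.+1.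
have d0 : 0 < d by rewrite subr_gt0.
have C0 : (0 < C)%N by have := aC 0%N; rewrite a0 expn0 muln1.
have CR : 0 < C%:R :> R by rewrite ltr0n.
have bd k : k%:R * d <= ln C%:R.
  have := aC (k * n.+1)%N; rewrite -(ler_nat R) natrM natrX => h.
  have {}h : (k * n.+1)%:R * ln 2 <= ln C%:R + u (k * n.+1)%N.
    rewrite mulr_natl -lnXn // -lnM ?posrE // ler_ln ?posrE ?exprn_gt0 ?mulr_gt0 //.
  have := subadditive_mul k n.+1 0 u0 uD; rewrite addn0 u0 addr0 => h2.
  rewrite /d mulrBr lerBlDr; apply: le_trans (lerD (lexx _) h2).
  by apply: le_trans h; rewrite natrM mulrA mulrAC.
have := bd (Num.truncn (ln C%:R / d)).+1; apply/negP; rewrite -ltNge.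
by rewrite -ltr_pdivrMr // truncnS_gt.
Qed.

End Fekete.

Section MultiplicativeMaps.
Variables (G H : groupType) (f : {multiplicative G -> H}).

Lemma multiplicative1 : f 1%g = 1%g.
Proof. by apply: (mulgI (f 1%g)); rewrite -gmulfM !mulg1. Qed.

Lemma multiplicativeX x n : f (x ^+ n)%g = (f x ^+ n)%g.
Proof. by elim: n => [|n IH]; rewrite ?multiplicative1 // !expgS gmulfM IH. Qed.

Lemma multiplicativeV x : f (x^-1)%g = (f x)^-1%g.
Proof. by apply/esym/mulg1_eq; rewrite -gmulfM mulgV multiplicative1. Qed.

Lemma multiplicativeJ x y : f (x ^ y)%g = (f x ^ f y)%g.
Proof. by rewrite !conjgE !gmulfM multiplicativeV. Qed.

Lemma multiplicative_pos_word r s w :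
  f (pos_word r s w) = pos_word (f r) (f s) w.
Proof.
elim: w => [|b w IH]; first exact: multiplicative1.
by rewrite /= gmulfM IH; case: b => //=; rewrite !gmulfM !multiplicativeV.
Qed.
End MultiplicativeMaps.

Section AffineGenerators.
Variable K : fieldType.
Implicit Types (p q : {mpoly K[3]}) (u : Cremona K).

Lemma dehomogE :
  (forall p q : {mpoly K[3]}, dehomog (p + q) = dehomog p + dehomog q) *
  (forall p : {mpoly K[3]}, dehomog (- p) = - dehomog p) *
  (forall p q : {mpoly K[3]}, dehomog (p * q) = dehomog p * dehomog q) *
  (forall a : K, dehomog (a%:MP : {mpoly K[3]}) = ratC a) *
  (dehomog ('X_ord0 : {mpoly K[3]}) = ratX K) * (dehomog ('X_1 : {mpoly K[3]}) = ratY K) *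
  (dehomog ('X_ord_max : {mpoly K[3]}) = 1).
Proof.
have mE p : dehomog p = mmap (ratc K) (aff (ratX K) (ratY K)) p := dehomog_mmap p.
do !split.
- by move=> p q; rewrite !mE rmorphD.
- by move=> p; rewrite !mE rmorphN.
- by move=> p q; rewrite !mE rmorphM.
- by move=> a; rewrite mE mmapC.
- by rewrite mE mmapXi /aff tnth3.
- by rewrite mE mmapXi /aff tnth3.
- by rewrite mE mmapXi /aff tnth3.
Qed.

Lemma affine_S u : represents u (S_triple K) -> affine_map u = (ratY K, - ratX K).
Proof. by move/affine_mapE ->; rewrite /S_triple !tnth3 !dehomogE !divr1. Qed.

Lemma affine_R (e : K) u : represents u (R_triple e) ->
  let x := ratX K in let y := ratY K in let c := ratC e in
  affine_map u = ((x + c * y) / (c + x * y), c * y).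
Proof.
move=> ru /=; have [d hR] := represents_homog ru.
have nz : dehomog (tnth (R_triple e) ord_max) != 0.
  apply/eqP => /(dehomog_inj (hR _)) /eqP.
  by rewrite (negbTE (represents_coord_neq0 _ ru)).
move: nz; rewrite (affine_mapE ru) /R_triple !tnth3 !dehomogE !mulr1 !mul1r => nz.
by rewrite mulfK.
Qed.

End AffineGenerators.

(** * Existence, type preservation and injectivity of theta *)

Section Theta.
Variable R : realType.
Local Notation C := R[i].
Implicit Types (e : R) (theta : {multiplicative SL2Z -> Cremona C}).

Lemma real_complex_neq0 e : 0 < e -> (e%:C)%C != 0 :> C.
Proof. by move=> e0; apply/eqP => -[] /eqP; rewrite gt_eqF. Qed.

Lemma theta_generators e theta : 0 < e -> is_theta e theta ->
  represents (theta SL2Z_R) (R_triple (e%:C)%C) /\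
  represents (theta SL2Z_S) (S_triple C).
Proof.
move=> e0 [eS eR]; have en0 := real_complex_neq0 e0.
have [u ru] := birational_represents (birational_R en0).
have [v rv] := birational_represents (birational_S C).
have eu : u = theta SL2Z_R by apply: affine_map_inj; rewrite eR (affine_R ru).
have ev : v = theta SL2Z_S by apply: affine_map_inj; rewrite eS (affine_S rv).
by rewrite -eu -ev; exact: (conj ru rv).
Qed.

Lemma theta_exists e : 0 < e -> exists theta, is_theta e theta.
Proof.
move=> e0; have en0 := real_complex_neq0 e0.
have [u ru] := birational_represents (birational_R en0).
have [v rv] := birational_represents (birational_S C).
have [theta [tR tS]] := SL2Z_extend (S_R_relations en0 ru rv).
exists theta; split; first by rewrite tS (affine_S rv).
by rewrite tR (affine_R ru).
Qed.

Section FixTheta.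
Variables (e : R) (theta : {multiplicative SL2Z -> Cremona C}).
Hypotheses (e0 : 0 < e) (thetaP : is_theta e theta).

Let rr := (theta_generators e0 thetaP).1.
Let rs := (theta_generators e0 thetaP).2.

Lemma theta_Z_word a w : theta ((SL2Z_S * SL2Z_S) ^+ a * pos_word SL2Z_R SL2Z_S w)%g =
  ((theta SL2Z_S * theta SL2Z_S) ^+ a * pos_word (theta SL2Z_R) (theta SL2Z_S) w)%g.
Proof. by rewrite gmulfM multiplicativeX gmulfM multiplicative_pos_word. Qed.

Lemma theta_mixed_growth a w n : true \in w -> false \in w ->
  (2 ^ n <= degree (theta ((SL2Z_S * SL2Z_S) ^+ a * pos_word SL2Z_R SL2Z_S w) ^+ n)%g)%N.
Proof. by move=> t f; rewrite theta_Z_word; exact: (mixed_growth e0 rr rs). Qed.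

Lemma theta_pure_growth a k b n :
  (k * n <= degree (theta ((SL2Z_S * SL2Z_S) ^+ a *
     pos_word SL2Z_R SL2Z_S (nseq k b)) ^+ n)%g <= k * n + 2)%N.
Proof. by rewrite theta_Z_word; exact: (pure_growth e0 rr rs). Qed.

Lemma degree_conj_bounds (u v : Cremona C) : exists2 c, (0 < c)%N & forall n,
  (degree ((u ^ v) ^+ n)%g <= c * degree (u ^+ n)%g)%N /\
  (degree (u ^+ n)%g <= c * degree ((u ^ v) ^+ n)%g)%N.
Proof.
exists (degree (v^-1)%g * degree v)%N => [|n]; first by rewrite muln_gt0 !degree_gt0.
split; first exact: degree_conj.
by have := degree_conj (u ^ v)%g (v^-1)%g n; rewrite conjgK invgK [X in (_ <= X * _)%N]mulnC.
Qed.

Lemma theta_elliptic M : elliptic_mx M -> elliptic_map (theta M).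
Proof.
move=> [n [n0 Mn]]; exists (\max_(k < n) degree (theta M ^+ k)%g) => k.
have -> : (theta M ^+ k = theta M ^+ (k %% n))%g.
  rewrite {1}(divn_eq k n) expgnDr mulnC expgnA -multiplicativeX Mn multiplicative1.
  by rewrite expg1n mul1g.
exact: (leq_bigmax (Ordinal (ltn_pmod k n0))).
Qed.

Lemma theta_parabolic M : parabolic_mx M -> parabolic_map (theta M).
Proof.
move=> /parabolic_conj[g [a [k [b [k0 eM]]]]]; left.
have [c c0 bd] := degree_conj_bounds (theta M) (theta g).
have cR : 0 < c%:R :> R by rewrite ltr0n.
exists c%:R^-1, (c * (k + 2))%:R; split; rewrite ?invr_gt0 //.
  by rewrite ltr0n muln_gt0 c0 addn2.
(* From n = 1 on, k n + 2 <= (k + 2) n. *)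
exists 1%N => // n /= n0; rewrite expr1.
have := bd n; rewrite -multiplicativeJ eM => -[lo hi].
have /andP[lo' hi'] := theta_pure_growth a k b n.
apply/andP; split.
  rewrite mulrC ler_pdivrMr // -natrM ler_nat mulnC; apply: leq_trans lo.
  by apply: leq_trans lo'; rewrite -[leqLHS]mul1n leq_mul2r k0 orbT.
rewrite -natrM ler_nat; apply: (leq_trans hi); rewrite -mulnA leq_mul2l.
by apply/orP; right; apply: leq_trans hi' _; nia.
Qed.

Lemma hyperbolic_degree M : hyperbolic_mx M ->
  exists c, forall n, (2 ^ n <= c * degree (theta M ^+ n)%g)%N.
Proof.
move=> /hyperbolic_conj[g [a [w [t f eM]]]].
have [c c0 bd] := degree_conj_bounds (theta M) (theta g).
exists c => n; have [lo _] := bd n; apply: leq_trans lo.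
by rewrite -multiplicativeJ eM; exact: theta_mixed_growth.
Qed.

Lemma theta_hyperbolic M : hyperbolic_mx M -> hyperbolic_map (theta M).
Proof.
move=> hM; apply: root_limit.
- by rewrite expg0 degree1.
- by move=> n; exact: degree_gt0.
- by move=> m n; rewrite expgnDr; exact: degree_mul.
- exact: hyperbolic_degree.
Qed.

Lemma theta_preserves_type : preserves_type theta.
Proof.
move=> M; split; [exact: theta_elliptic|exact: theta_parabolic|exact: theta_hyperbolic].
Qed.

Lemma theta_Z_neq1 : theta (SL2Z_S * SL2Z_S)%g <> 1%g.
Proof.
rewrite gmulfM => ez; have := represents_mul rs rs; rewrite ez => r1.
have /same_mapP/(_ ord0 ord_max) := represents_same r1 (represents1 C).
rewrite !tnth_comp !tnth_mktuple /S_triple !compE mulNr [RHS]mulrC => e1.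
have /eqP : ('X_ord0 * 'X_ord_max : {mpoly C[3]}) * 2%:R = 0.
  by rewrite mulr_natr mulr2n -{1}e1 addNr.
by rewrite !mulf_eq0 !(negbTE (mpolyXi_neq0 _ _)) /= -mpolyC_nat mpolyC_eq0 pnatr_eq0.
Qed.

Lemma theta_word_infinite a w n : w != [::] -> (0 < n)%N ->
  theta (((SL2Z_S * SL2Z_S) ^+ a * pos_word SL2Z_R SL2Z_S w) ^+ n)%g <> 1%g.
Proof.
move=> w0 n0 e1.
(* The lower bound for a pure word may be just 1, the degree of the identity; doubling the exponent
   pushes it above 1. *)
have e2 : theta ((((SL2Z_S * SL2Z_S) ^+ a * pos_word SL2Z_R SL2Z_S w) ^+ n) ^+ 2)%g = 1%g.
  by rewrite multiplicativeX e1 expg1n.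
move: e2; rewrite -expgnA multiplicativeX => e2.
have := degree1 C; rewrite -e2.
have [[t f]|[b eb]] := mixed_or_pure w.
  move=> d1; have := theta_mixed_growth a (n * 2) t f; rewrite d1 leqNgt.
  by rewrite -[1%N](expn0 2) ltn_exp2l // muln_gt0 n0.
have /andP[lo _] := theta_pure_growth a (size w) b (n * 2).
rewrite eb => d1; move: lo; rewrite d1.
have : (0 < size w)%N by rewrite lt0n size_eq0.
by nia.
Qed.

Lemma theta_injective : injective theta.
Proof.
suff ker M : theta M = 1%g -> M = 1%g.
  move=> M N e1; apply: divg1_eq; apply: ker.
  by rewrite gmulfM multiplicativeV e1 mulgV.
move=> M1; have [g [a [y [ry eM]]]] := SL2Z_conj_reduced M.
have Zy1 : theta ((SL2Z_S * SL2Z_S) ^+ a * y)%g = 1%g.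
  by rewrite -eM multiplicativeJ M1 conj1g.
have rel := SL2Z_SL2_relations; have [s4 u3 _] := rel.
have zzE := zz rel erefl.
(* If z^b u maps to 1, then R has the same image as z^-b s^-1, whose fourth power is 1, against the
   infinite order of the image of R. *)
have noU b : theta ((SL2Z_S * SL2Z_S) ^+ b * (SL2Z_R * SL2Z_S))%g <> 1%g.
  move=> e1; apply: (@theta_word_infinite 0 [:: true] 4) => //.
  rewrite expg0 mul1g /= mulg1.
  have -> : SL2Z_R = (((SL2Z_S * SL2Z_S) ^+ b)^-1 * ((SL2Z_S * SL2Z_S) ^+ b *
      (SL2Z_R * SL2Z_S)) * SL2Z_S^-1)%g by rewrite mulKg mulgK.
  rewrite multiplicativeX gmulfM [theta (_^-1 * _)%g]gmulfM e1 mulg1 -gmulfM.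
  rewrite -multiplicativeX -invgM -expg2 -expgnA -expgS.
  by rewrite expVgn -expgnA mulnC expgnA s4 expg1n invg1 multiplicative1.
case: ry => [[w yw]|yw|yw|yw].
- have [w0|w0] := eqVneq w [::]; last first.
    by have := @theta_word_infinite a w 1 w0 isT; rewrite expg1 -yw Zy1.
  move: Zy1 eM; rewrite yw w0 /= !mulg1 -(odd_double_half a) expgnDr -mul2n expgnA expg2.
  rewrite zzE expg1n mulg1; case: (odd a) => /=.
    by rewrite expg1 => /theta_Z_neq1.
  by rewrite expg0 => _ /eqP; rewrite conjg_eq1 => /eqP.
- have := congr1 (fun v => v ^+ 2)%g Zy1; rewrite expg1n -multiplicativeX yw.
  rewrite -[((SL2Z_S * SL2Z_S) ^+ a * SL2Z_S)%g]/(_ * _)%g.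
  have -> : (((SL2Z_S * SL2Z_S) ^+ a * SL2Z_S) ^+ 2 = SL2Z_S * SL2Z_S)%g.
    rewrite -expg2 -expgnA -expgSr -expgnA.
    have -> : ((2 * a).+1 * 2 = 4 * a + 2)%N by lia.
    by rewrite expgnDr expgnA s4 expg1n mul1g.
  by move/theta_Z_neq1.
- by move: Zy1; rewrite yw => /noU.
(* The square of z^a u^2 is u^4 = u, so the previous case applies. *)
- have := congr1 (fun v => v ^+ 2)%g Zy1; rewrite expg1n -multiplicativeX yw.
  have -> : (((SL2Z_S * SL2Z_S) ^+ a * (SL2Z_R * SL2Z_S * (SL2Z_R * SL2Z_S))) ^+ 2
      = (SL2Z_S * SL2Z_S) ^+ 0 * (SL2Z_R * SL2Z_S))%g.
    rewrite expgMn; last by rewrite /commute (zXC _ (SL2Z_Z_central _)).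
    rewrite -expgnA mulnC expgnA expg2 zzE expg1n -expg2 -expgnA expg0.
    by rewrite -[(2 * 2)%N]/(3 + 1)%N expgnDr u3 expg1 !mul1g.
  by move/noU.
Qed.

End FixTheta.
End Theta.

(** * Eigenvalues, non-conjugacy and the standard embedding *)

Section Eigenvalue.
Variable K : fieldType.
Local Notation mp3 := {mpoly K[3]}.
Local Notation x := ('X_ord0 : mp3).
Local Notation y := ('X_1 : mp3).
Local Notation z := ('X_ord_max : mp3).
Implicit Types (p q : mp3).

Lemma split_y p : exists q, p = (p \mPo [tuple x; 0; z]) + y * q.
Proof.
have mon (m : 'X_{1..3}) : exists q, 'X_[m] = ('X_[m] \mPo [tuple x; 0; z]) + y * q.
  have em : 'X_[m] = x ^+ m ord0 * y ^+ m 1 * z ^+ m ord_max.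
    rewrite mpolyXE_id !big_ord_recl big_ord0 mulr1 mulrA.
    by congr ('X__ ^+ m _ * 'X__ ^+ m _ * 'X__ ^+ m _); exact/val_inj.
  rewrite em !rmorphM !rmorphXn /= !comp_mpolyX_tnth !tnth3.
  case: (m 1) => [|k]; first by exists 0; rewrite !expr0 mulr0 addr0.
  exists (x ^+ m ord0 * y ^+ k * z ^+ m ord_max).
  by rewrite !exprS mul0r mulr0 mul0r add0r; ring.
elim/mpolyind: p => [|a m p _ _ [q eq]]; first by exists 0; rewrite rmorph0 mulr0 addr0.
have [q' eq'] := mon m; exists (a *: q' + q).
by rewrite {1}eq {1}eq' rmorphD /= comp_mpolyZ -!mul_mpolyC; ring.
Qed.

Lemma homog_y p q d : p \is d.-homog -> p = y * q -> p != 0 ->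
  exists2 d', d = d'.+1 & q \is d'.-homog.
Proof.
move=> hp ep p0; have q0 : q != 0 by apply: contraNneq p0 => q0; rewrite ep q0 mulr0.
have y0 : y != 0 by exact: mpolyXi_neq0.
have := dhomog_msize_eq hp p0; rewrite ep msizeM // (dhomog_msize_eq (@dhomogXi K 1) y0).
move=> sz; have sq : msize q = d by move: sz => /=; case.
have : (0 < d)%N by rewrite -sq lt0n msize_poly_eq0.
case: d hp sq {sz} => // d hp sq _; exists d => //.
have := @homog_factor _ p y q 1 d ep hp.
rewrite (dhomog_msize_eq (@dhomogXi K 1) y0) sq => /(_ isT (ltnSn _)).
rewrite (pihomog_dE (@dhomogXi K 1)) {1}ep => /(mulfI y0) ->; exact: pihomogP.
Qed.

(** Sets z = 1 and reads the result as a polynomial in y over K[x]: evaluation at 0 restricts to the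
    line y = 0, and powers of ['X] measure the order of vanishing along it. *)
Definition xy_hom : {rmorphism mp3 -> {poly {poly K}}} :=
  mmap (polyC \o polyC) (tnth [tuple ('X : {poly K})%:P; 'X; 1]).

Lemma xy_homE : [/\ xy_hom x = ('X)%:P, xy_hom y = 'X, xy_hom z = 1 &
  forall a, xy_hom a%:MP = a%:P%:P].
Proof. by rewrite /xy_hom /= !mmapXi !tnth3; split=> // a; rewrite mmapC. Qed.

Lemma xy_hom_inj p d : p \is d.-homog -> p != 0 -> xy_hom p != 0.
Proof.
move=> hp; apply: contra_neq => p0; apply: (dehomog_inj hp).
pose inner : {rmorphism {poly K} -> {mpoly K[2]}} :=
  horner_eval ('X_ord0 : {mpoly K[2]}) \o map_poly (@mpolyC 2 K).
pose outer : {rmorphism {poly {poly K}} -> {mpoly K[2]}} :=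
  horner_eval ('X_ord_max : {mpoly K[2]}) \o map_poly inner.
have innerC a : inner a%:P = a%:MP by rewrite /inner /= map_polyC /horner_eval hornerC.
have innerX : inner 'X = 'X_ord0 by rewrite /inner /= map_polyX /horner_eval hornerX.
have outerC a : outer a%:P = inner a by rewrite /outer /= map_polyC /horner_eval hornerC.
have outerX : outer 'X = 'X_ord_max by rewrite /outer /= map_polyX /horner_eval hornerX.
have [ex ey ez ec] := xy_homE.
have e : p \mPo aff_point K = outer (xy_hom p).
  apply: (@mpoly_rmorphism_ext _ _ _ (comp_mpoly (aff_point K)) (outer \o xy_hom)) => [a|i].
    by rewrite -[LHS]/(_ \mPo _) -[RHS]/(outer (xy_hom _)) comp_mpolyC ec outerC innerC.
  rewrite -[LHS]/(_ \mPo _) -[RHS]/(outer (xy_hom _)) comp_mpolyX_tnth.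
  by elim/ord3P: i; rewrite ?ex ?ey ?ez !tnth3 ?outerC ?innerX ?outerX ?rmorph1.
by rewrite /dehomog e p0 rmorph0 tofrac0.
Qed.

Variable e : K.
Hypothesis e0 : e != 0.

Definition R_power_triple N := state_triple (word_state (e%:MP : mp3) x y z (nseq N true)).

(** In the chart z = 1 the second fraction stays e^N y over 1; [A] and [B] form the first, of which
    only the values on y = 0 matter. *)
Lemma R_power_xy N : exists A B : {poly {poly K}},
  [/\ [/\ xy_hom (tnth (R_power_triple N) ord0) = A,
          xy_hom (tnth (R_power_triple N) 1) = (e ^+ N)%:P%:P * 'X * B &
          xy_hom (tnth (R_power_triple N) ord_max) = B],
      A.[0] = 'X & B.[0] = (e ^+ N)%:P].
Proof.
have [ex ey ez ec] := xy_homE.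
have : exists A B, map_state xy_hom (word_state (e%:MP : mp3) x y z (nseq N true)) =
    ((A, B), ((e ^+ N)%:P%:P * 'X, 1)) /\ A.[0] = 'X /\ B.[0] = (e ^+ N)%:P.
  rewrite map_word_state ex ey ez ec; elim: N => [|N [A [B [eS [A0 B0]]]]].
    exists ('X)%:P, 1; rewrite expr0 !polyC1 mul1r; split=> //.
    by rewrite !hornerE.
  rewrite [word_state _ _ _ _ _]/= -/(word_state _ _ _ _ _) eS /=.
  exists (A * 1 + e%:P%:P * ((e ^+ N)%:P%:P * 'X) * B),
    (e%:P%:P * B * 1 + A * ((e ^+ N)%:P%:P * 'X)).
  split; first by rewrite exprS !polyCM mulrA.
  rewrite !hornerD !hornerM !hornerC hornerX A0 B0 ?(mulr0, mul0r, addr0, mulr1).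
  by rewrite exprS polyCM; split.
case=> A [B [eS [A0 B0]]]; exists A, B; split=> //; move: eS.
rewrite /R_power_triple; case: (word_state _ _ _ _ _) => [[p q] [p' q']] /=.
case=> ep eq ep' eq'; rewrite !tnth3 !rmorphM /= ep eq ep' eq' !mulr1; split=> //.
Qed.

Lemma mmap_y0 p : (xy_hom p).[0] = mmap polyC (tnth [tuple 'X : {poly K}; 0; 1]) p.
Proof.
have [ex ey ez ec] := xy_homE.
apply: (@mpoly_rmorphism_ext _ _ _ (horner_eval 0 \o xy_hom)
  (mmap polyC (tnth [tuple 'X : {poly K}; 0; 1]))) => [a|i];
  rewrite -[LHS]/((xy_hom _).[0]).
  by rewrite ec hornerC [RHS]mmapC.
by rewrite [RHS]mmapXi; elim/ord3P: i; rewrite ?ex ?ey ?ez !tnth3 ?hornerC ?hornerX.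
Qed.

(** By homogeneity p(x, 0, e^N) = (e^N)^d p(x / e^N, 0, 1); the exponent [k] is d minus the degree
    in x of the restriction. *)
Lemma lowest_term0 N p d : p \is d.-homog -> (xy_hom p).[0] != 0 ->
  exists k : int, lead_coef (xy_hom (p \mPo R_power_triple N)).[0] =
    (e ^+ N) ^ k * lead_coef (xy_hom p).[0].
Proof.
move=> hp al0; have [A [B [[eA eC eB] A0 B0]]] := R_power_xy N.
have eN0 : e ^+ N != 0 by rewrite expf_neq0.
have -> : (xy_hom (p \mPo R_power_triple N)).[0] =
    mmap polyC (tnth [tuple 'X : {poly K}; 0; (e ^+ N)%:P]) p.
  apply: (@mpoly_rmorphism_ext _ _ _ (horner_eval 0 \o (xy_hom \o comp_mpoly (R_power_triple N)))
    (mmap polyC (tnth [tuple 'X : {poly K}; 0; (e ^+ N)%:P]))) => [a|i];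
    rewrite -[LHS]/((xy_hom (_ \mPo _)).[0]).
    by have [_ _ _ ec] := xy_homE; rewrite comp_mpolyC ec hornerC [RHS]mmapC.
  rewrite comp_mpolyX_tnth [RHS]mmapXi; elim/ord3P: i; rewrite ?eA ?eC ?eB !tnth3 //.
  by rewrite !hornerM hornerX mulr0 mul0r.
rewrite (@mmap_homog _ _ _ _ _ (tnth [tuple (e ^+ N)^-1 *: 'X : {poly K}; 0; 1]) p d
  ((e ^+ N)%:P) hp); last first.
  apply: ord3P; rewrite !tnth3 ?mulr0 ?mulr1 //.
  by rewrite mul_polyC scalerA divff // scale1r.
have -> : mmap polyC (tnth [tuple (e ^+ N)^-1 *: 'X : {poly K}; 0; 1]) p =
    (xy_hom p).[0] \Po ((e ^+ N)^-1 *: 'X).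
  rewrite mmap_y0; apply/esym.
  apply: (@mpoly_rmorphism_ext _ _ _ (comp_poly ((e ^+ N)^-1 *: 'X) \o
      mmap polyC (tnth [tuple 'X : {poly K}; 0; 1]))
    (mmap polyC (tnth [tuple (e ^+ N)^-1 *: 'X : {poly K}; 0; 1]))) => [a|i] /=.
    by rewrite !mmapC comp_polyC.
  rewrite !mmapXi; elim/ord3P: i; rewrite !tnth3 ?comp_polyX //.
    by rewrite rmorph0.
  by rewrite rmorph1.
rewrite -rmorphXn mul_polyC lead_coefZ lead_coef_comp; last first.
  by rewrite size_scale ?invr_eq0 // size_polyX.
rewrite lead_coefZ lead_coefX mulr1.
exists (Posz d - Posz (size (xy_hom p).[0]).-1).
rewrite expfzDr // -exprnN -[_ ^ Posz d]/(_ ^+ d) exprVn.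
by rewrite mulrA [RHS]mulrAC.
Qed.


Lemma vanish_y0 p d : p \is d.-homog -> p != 0 -> (xy_hom p).[0] = 0 ->
  exists2 q, p = y * q & exists2 d', d = d'.+1 & q \is d'.-homog.
Proof.
move=> hp p0 al0; have [q eq] := split_y p.
have [ex ey ez ec] := xy_homE.
have hT : p \mPo [tuple x; 0; z] \is (1 * d)%N.-homog.
  by apply: (comp_homog hp); apply: ord3P; rewrite !tnth3 ?rpred0 ?dhomogXi.
have eT : xy_hom (p \mPo [tuple x; 0; z]) = (xy_hom p).[0]%:P.
  rewrite mmap_y0.
  apply: (@mpoly_rmorphism_ext _ _ _ (xy_hom \o comp_mpoly [tuple x; 0; z])
    (polyC \o mmap polyC (tnth [tuple 'X : {poly K}; 0; 1]))) => [a|i];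
    rewrite -[LHS]/(xy_hom (_ \mPo _)) -[RHS]/((mmap _ _ _)%:P).
    by rewrite comp_mpolyC ec mmapC.
  rewrite comp_mpolyX_tnth mmapXi; elim/ord3P: i; rewrite !tnth3 ?ex ?ez //.
  by rewrite rmorph0.
have {}pT : p \mPo [tuple x; 0; z] = 0.
  apply/eqP/negPn/negP => nz; have := xy_hom_inj hT nz.
  by rewrite eT al0 eqxx.
have ep : p = y * q by rewrite {1}eq pT add0r.
by exists q => //; exact: homog_y hp ep p0.
Qed.

(* theta(R)^N preserves the line y = 0, on which it acts by x |-> x / e^N, and
   multiplies y by e^N. *)
Lemma lowest_term N p d : p \is d.-homog -> p != 0 ->
  exists a v w (k : int),
    [/\ xy_hom p = 'X^a * v, xy_hom (p \mPo R_power_triple N) = 'X^a * w,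
        v.[0] != 0 & lead_coef w.[0] = (e ^+ N) ^ k * lead_coef v.[0]].
Proof.
have [A [B [[eA eC eB] A0 B0]]] := R_power_xy N.
have [ex ey ez ec] := xy_homE.
elim: d p => [|d IH] p hp p0; (have [al0|al0] := eqVneq (xy_hom p).[0] 0; last first).
1,3: have [k ek] := lowest_term0 N hp al0;
  by exists 0%N, (xy_hom p), (xy_hom (p \mPo R_power_triple N)), k; rewrite !expr0 !mul1r.
  by have [q _ []] := vanish_y0 hp p0 al0.
have [q ep [d' [ed] hq]] := vanish_y0 hp p0 al0; rewrite -ed in hq.
have q0 : q != 0 by apply: contraNneq p0 => q0; rewrite ep q0 mulr0.
have [a [v [w [k [ev ew v0 lw]]]]] := IH q hq q0.
have eN0 : e ^+ N != 0 by rewrite expf_neq0.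
(* The factor y becomes e^N y B, and B is e^N on y = 0, hence two more factors e^N. *)
exists a.+1, v, ((e ^+ N)%:P%:P * B * w), (2 + k); split=> //.
- by rewrite ep rmorphM /= ey ev exprS mulrA.
- rewrite ep rmorphM /= rmorphM /= comp_mpolyX_tnth eC ew exprS; ring.
- rewrite !hornerM hornerC B0 !lead_coefM !lead_coefC lw expfzDr // !mulrA.
  by rewrite -[_ ^ 2]/(_ ^+ 2) expr2.
Qed.

Lemma div_eq_cross (F : fieldType) (a b c d l : F) : b != 0 -> d != 0 ->
  a / b = l * (c / d) -> a * d = l * c * b.
Proof. by move=> b0 d0; rewrite mulrA => /eqP; rewrite eqr_div // => /eqP. Qed.

(** The second component of [v] is an eigenfunction of [u]. Applied to its numerator and
    denominator, [lowest_term] gives orders along y = 0 that [u] preserves and that cancel; leading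
    coefficients then give [lam]. *)
Lemma eigenvalue_power (u v : Cremona K) N (lam : K) :
  represents u (R_power_triple N) -> lam != 0 ->
  (affine_map (v * u)%g).2 = ratC lam * (affine_map v).2 ->
  exists k : int, lam = (e ^+ N) ^ k.
Proof.
move=> ru lam0 ev.
have rv := represents_repr v; set V := repr v in rv.
have rvu := represents_mul rv ru.
have [d hV] := represents_homog rv; have [d2 hW] := represents_homog rvu.
have V1 := represents_coord_neq0 1 rv; have V2 := represents_coord_neq0 ord_max rv.
have W2 := represents_coord_neq0 ord_max rvu.
have dn p d' : p \is d'.-homog -> p != 0 -> dehomog p != 0.
  by move=> hp; apply: contra_neq; exact: dehomog_inj hp.
move: ev; rewrite (affine_mapE rv) (affine_mapE rvu) /= !tnth_comp.
have d2' := dn _ _ (hV ord_max) V2; have dW := dn _ _ (hW ord_max) W2.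
rewrite tnth_comp in dW.
move=> /(div_eq_cross dW d2').
have ec : ratC lam = dehomog (lam%:MP : mp3).
  by rewrite dehomog_mmap mmapC.
rewrite ec -!dehomogM => eq.
have {}eq : (tnth V 1 \mPo R_power_triple N) * tnth V ord_max =
    lam%:MP * tnth V 1 * (tnth V ord_max \mPo R_power_triple N).
  apply/eqP; rewrite -subr_eq0; apply/eqP; apply: (@dehomog_inj _ _ (d2 + d)).
    have hW' k : tnth V k \mPo R_power_triple N \is d2.-homog by rewrite -tnth_comp.
    apply: rpredB; first exact: dhomogM.
    by rewrite addnC mul_mpolyC -scalerAl; apply: rpredZ; exact: dhomogM.
  by rewrite /dehomog rmorphB /= tofracB -!/(dehomog _) eq subrr.
have [a1 [v1 [w1 [k1 [e1 f1 n1 l1]]]]] := lowest_term N (hV 1) V1.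
have [a2 [v2 [w2 [k2 [e2 f2 n2 l2]]]]] := lowest_term N (hV ord_max) V2.
have [_ _ _ ec'] := xy_homE.
move: eq => /(congr1 xy_hom); rewrite !rmorphM /= e1 e2 f1 f2 ec' => eq.
have {}eq : w1 * v2 = lam%:P%:P * v1 * w2.
  have X0 a : 'X^a != 0 :> {poly {poly K}} by rewrite expf_neq0 // polyX_eq0.
  apply: (mulfI (mulf_neq0 (X0 a1) (X0 a2))).
  transitivity ('X^a1 * w1 * ('X^a2 * v2)); first by ring.
  by rewrite eq; ring.
move: eq => /(congr1 (horner^~ 0)); rewrite !hornerM hornerC => /(congr1 lead_coef).
rewrite !lead_coefM lead_coefC l1 l2 => eq.
exists (k1 - k2); have nl : lead_coef v1.[0] * lead_coef v2.[0] != 0.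
  by rewrite mulf_neq0 // lead_coef_eq0.
have eN0 : e ^+ N != 0 by rewrite expf_neq0.
have ek : (e ^+ N) ^ (k1 - k2) * (e ^+ N) ^ k2 = (e ^+ N) ^ k1 by rewrite -expfzDr // subrK.
apply: (mulIf (mulf_neq0 nl (expfz_neq0 k2 eN0))).
transitivity (lam * lead_coef v1.[0] * ((e ^+ N) ^ k2 * lead_coef v2.[0])); first by ring.
by rewrite -eq -ek; ring.
Qed.

End Eigenvalue.

(** * Non-conjugate images *)

Section NonConjugate.
Variable R : realType.
Local Notation C := R[i].
Implicit Types (e : R) (theta : {multiplicative SL2Z -> Cremona C}).

Lemma affine_R_mul e (r u : Cremona C) : 0 < e -> represents r (R_triple (e%:C)%C) ->
  (affine_map (r * u)%g).2 = ratC (e%:C)%C * (affine_map u).2.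
Proof.
move=> e0 rr; have ru := represents_repr u; have rru := represents_mul rr ru.
have Z0 : dehomog (tnth (comp_triple (R_triple (e%:C)%C) (repr u)) ord_max) != 0.
  have [d hd] := represents_homog rru.
  apply/eqP => /(dehomog_inj (hd _)) /eqP.
  by rewrite (negbTE (represents_coord_neq0 _ rru)).
rewrite (affine_mapE rru) (affine_mapE ru) /=.
move: Z0; rewrite !tnth_comp /R_triple !compE !dehomogE mulf_eq0 negb_or => /andP[Z0 D0].
by rewrite -[LHS]mulf_div divff // mulr1 mulrA.
Qed.

Lemma affine_RV_mul e (r u : Cremona C) : 0 < e -> represents r (R_triple (e%:C)%C) ->
  (affine_map (r^-1 * u)%g).2 = (ratC (e%:C)%C)^-1 * (affine_map u).2.
Proof.
move=> e0 rr.
have c0 : ratC (e%:C)%C != 0 by rewrite tofrac_eq0 mpolyC_eq0; exact: real_complex_neq0.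
have h := affine_R_mul (r^-1 * u)%g e0 rr.
have k : (r * (r^-1 * u))%g = u by exact: mulVKg.
apply: (mulfI c0); rewrite (mulVKf c0).
by apply/esym; rewrite -[in LHS]k.
Qed.

Lemma affine_R2_mul e (r u : Cremona C) : 0 < e -> represents r (R_triple (e%:C)%C) ->
  (affine_map (r ^+ 2 * u)%g).2 = ratC ((e%:C)%C ^+ 2) * (affine_map u).2.
Proof.
move=> e0 rr; have -> : (r ^+ 2 * u = r * (r * u))%g by rewrite expg2 mulgA.
apply: (etrans (affine_R_mul (r * u)%g e0 rr)).
apply: (etrans (congr1 ( *%R (ratC (e%:C)%C)) (affine_R_mul u e0 rr))).
rewrite mulrA; congr (_ * _).
by rewrite expr2 /ratC mpolyCM tofracM.
Qed.

Lemma affine_R2V_mul e (r u : Cremona C) : 0 < e -> represents r (R_triple (e%:C)%C) ->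
  (affine_map ((r ^+ 2)^-1 * u)%g).2 = ratC (((e%:C)%C ^+ 2)^-1) * (affine_map u).2.
Proof.
move=> e0 rr; have en0 := real_complex_neq0 e0.
have -> : ((r ^+ 2)^-1 * u = r^-1 * (r^-1 * u))%g by rewrite expg2 invgM mulgA.
apply: (etrans (affine_RV_mul (r^-1 * u)%g e0 rr)).
apply: (etrans (congr1 ( *%R (ratC (e%:C)%C)^-1) (affine_RV_mul u e0 rr))).
rewrite mulrA; congr (_ * _).
rewrite -invfM -[RHS]/(ratc C _) fmorphV; congr (_^-1).
by rewrite expr2 /ratC -tofracM -mpolyCM.
Qed.

Lemma mulg_conj (G : groupType) (x y : G) : (y * x ^ y = x * y)%g.
Proof. by rewrite conjgE mulVKg. Qed.

Lemma exp_beats_linear (K : nat) : exists n, (K * (n + 2) < 2 ^ n)%N.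
Proof.
pose m := (2 * K + 1)%N; exists (m + m)%N; rewrite expnD.
have lt : (m < 2 ^ m)%N by exact: ltn_expl.
apply: leq_trans (leq_mul lt lt); rewrite /m; nia.
Qed.

Lemma real_complexXz e (k : int) : 0 < e -> ((e ^ k)%:C)%C = (e%:C)%C ^ k :> C.
Proof. by move=> e0; rewrite rmorphXz // unitfE gt_eqF. Qed.

Lemma conjugate_power e e' theta theta' (v : Cremona C) M : 0 < e -> 0 < e' ->
  is_theta e theta -> is_theta e' theta' ->
  theta' M = (theta SL2Z_R ^ v)%g -> exists k : int, e = e' ^ k.
Proof.
move=> e0 e'0 tP tP' eM.
have [rr rs] := theta_generators e0 tP; have [rr' rs'] := theta_generators e'0 tP'.
have en0 := real_complex_neq0 e0; have en'0 := real_complex_neq0 e'0.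
have inf : ~ finite_order M.
  move=> [n [n0 Mn]]; apply: (@theta_word_infinite _ _ _ e0 tP 0 [:: true] n) => //.
  have : (theta' M ^+ n)%g = 1%g by rewrite -multiplicativeX Mn multiplicative1.
  rewrite eM -conjXg => /eqP; rewrite conjg_eq1 => /eqP.
  by rewrite expg0 mul1g /= mulg1 multiplicativeX.
(* Conjugation changes degrees by at most a constant factor, so the linear growth for theta(R)
   excludes the exponential growth of a hyperbolic [M]. *)
have par : parabolic_mx M.
  split=> //; apply: contrapT => ntr.
  have [c hc] : exists c, forall n, (2 ^ n <= c * degree (theta' M ^+ n)%g)%N.
    apply: hyperbolic_degree e'0 tP' _ _; split=> //.
    by split=> tr; apply: ntr; [left|right].
  have [c' _ hc'] := degree_conj_bounds (theta SL2Z_R) v.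
  have [n] := exp_beats_linear (c * c'); apply/negP; rewrite -leqNgt.
  apply: leq_trans (hc n) _; rewrite -mulnA leq_mul2l; apply/orP; right.
  rewrite eM; apply: leq_trans (hc' n).1 _; rewrite leq_mul2l; apply/orP; right.
  have /andP[_] := theta_pure_growth e0 tP 0 1 true n.
  by rewrite expg0 mul1g /= mulg1 mul1n.
have [g [a [n [b [n0 eg]]]]] := parabolic_conj par.
(* Squaring removes the central factor z^a left by [parabolic_conj]. *)
have z'2 : ((theta' SL2Z_S * theta' SL2Z_S) ^+ (a * 2) = 1)%g.
  by rewrite mulnC expgnA expg2 (zz (S_R_relations en'0 rr' rs') erefl) expg1n.
have flat : flatten (nseq 2 (nseq n b)) = nseq (n * 2) b.
  by rewrite /= cats0 -nseqD addnn muln2.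
have X2 : ((theta SL2Z_R ^+ 2) ^ (v * theta' g))%g =
    pos_word (theta' SL2Z_R) (theta' SL2Z_S) (nseq (n * 2) b).
  rewrite conjXg conjgM -eM -multiplicativeJ eg theta_Z_word.
  by rewrite (Z_word_power e'0 rr' rs') z'2 mul1g flat.
pose N := (n * 2)%N.
have rpow : represents (theta' SL2Z_R ^+ N)%g (R_power_triple (e'%:C)%C N).
  have := represents_word en'0 (nseq N true) rr' rs'.
  by rewrite pure_word.
(* Since N = 2 n, both sides are squares of positive reals. *)
have fin (k : int) : e ^+ 2 = (e' ^+ N) ^ k -> exists k : int, e = e' ^ k.
  move=> ek; exists (Posz n * k).
  have p0 : 0 < e' ^ (Posz n * k) by rewrite exprz_gt0.
  apply/eqP; rewrite -(eqrXn2 (n := 2)) ?ltW // ek.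
  by rewrite -[_ ^+ 2]/(_ ^ Posz 2) -[e' ^+ N]/(e' ^ Posz N) !exprz_exp; apply/eqP; congr (_ ^ _); rewrite /N; lia.
case: b flat X2 {eg} => _ X2.
- have [|k ek] := eigenvalue_power en'0 (v := (v * theta' g)%g)
    (lam := (e%:C)%C ^+ 2) rpow (expf_neq0 _ en0).
    have -> : (theta' SL2Z_R ^+ N = (theta SL2Z_R ^+ 2) ^ (v * theta' g))%g.
      by rewrite X2 pure_word.
    by rewrite (mulg_conj _ (v * theta' g)%g); exact: affine_R2_mul e0 rr.
  apply: (fin k).
  by apply: (@complexI R); rewrite rmorphXn ek real_complexXz ?exprn_gt0 // rmorphXn.
(* A power of L is conjugate through S to a power of R^-1, so the eigenvalue becomes e^-2. *)
- have [|k ek] := eigenvalue_power en'0 (v := (v * theta' g * (theta' SL2Z_S)^-1)%g)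
    (lam := ((e%:C)%C ^+ 2)^-1) rpow (invr_neq0 (expf_neq0 _ en0)).
    set w := (_ * _ * _)%g.
    have e1 : (theta' SL2Z_R ^+ N = (theta SL2Z_R ^+ 2)^-1 ^ w)%g.
      rewrite conjVg /w conjgM X2 pure_word /pos_letter.
      rewrite -[(_^-1 * _^-1 * _)%g]mulgA -conjgE -conjXg conjgK.
      by rewrite expVgn invgK.
    by rewrite e1 (mulg_conj _ w); exact: affine_R2V_mul e0 rr.
  apply: (fin (- k)).
  apply: (@complexI R); rewrite real_complexXz ?exprn_gt0 // !rmorphXn /=.
  by rewrite -invr_expz -ek invrK.
Qed.

Lemma nonconjugate e e' theta theta' : 0 < e -> 0 < e' -> e <> e' -> e * e' <> 1 ->
  is_theta e theta -> is_theta e' theta' ->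
  ~ exists phi : Cremona C,
    [set (phi * f * phi^-1)%g | f in range theta] = range theta'.
Proof.
move=> e0 e'0 ne ne1 tP tP' [phi img].
have [k ek] : exists k : int, e = e' ^ k.
  have [M _ eM] : range theta' (phi * theta SL2Z_R * phi^-1)%g.
    by rewrite -img; exists (theta SL2Z_R) => //; exists SL2Z_R.
  apply: (conjugate_power (v := (phi^-1)%g) (M := M) e0 e'0 tP tP').
  by rewrite eM conjgE invgK mulgA.
have [l el] : exists l : int, e' = e ^ l.
  have : range theta' (theta' SL2Z_R) by exists SL2Z_R.
  rewrite -img => -[_ [M _ <-] eM].
  apply: (conjugate_power (v := phi) e'0 e0 tP' tP (M := M)).
  by rewrite -eM conjgE !mulgA mulgVK mulVg mul1g.
have [e1|e1] := eqVneq e 1.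
  by apply: ne; rewrite el e1 exp1rz.
(* Here e = (e^l)^k; for a positive e <> 1 this forces l k = 1, so k is 1 or -1, that is e = e' or e
   e' = 1. *)
have : e ^ (l * k - 1) == 1.
  have en0 : e != 0 by rewrite gt_eqF.
  have lkE : (e ^ l) ^ k = e ^ (l * k) := exprz_exp e l k.
  by rewrite expfzDr // -lkE -el -ek exprN1 divff.
rewrite pexprz_eq1 ?ltW // (negbTE e1) orbF subr_eq0 => /eqP lk.
have [k1|k1] : k = 1 \/ k = -1.
  by move: lk => /(congr1 absz)/eqP; rewrite abszM muln_eq1 => /andP[_ /eqP]; lia.
- by apply: ne; rewrite ek k1 expr1z.
- by apply: ne1; rewrite ek k1 exprN1 mulVf // gt_eqF.
Qed.

End NonConjugate.

(** * The standard embedding *)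

Section Standard.
Variable R : realType.
Local Notation C := R[i].
Local Notation mp3 := {mpoly C[3]}.
Local Notation x := ('X_ord0 : mp3).
Local Notation y := ('X_1 : mp3).
Local Notation z := ('X_ord_max : mp3).

Definition cayley : 3.-tuple mp3 :=
  [tuple (z + x) * (z - y); (z + y) * (z - x); (z - x) * (z - y)].
Definition cayley_inv : 3.-tuple mp3 :=
  [tuple (x - z) * (y + z); (y - z) * (x + z); (x + z) * (y + z)].

Let hX := @dhomogXi C.
Let hD i j : ('X_i + 'X_j : mp3) \is 1.-homog. Proof. by apply: rpredD; exact: dhomogXi. Qed.
Let hB i j : ('X_i - 'X_j : mp3) \is 1.-homog. Proof. by apply: rpredB; exact: dhomogXi. Qed.

Ltac nz3 := apply: at_origin_neq0;
  rewrite ?(rmorph_nat, rmorphM, rmorphD, rmorphB, rmorphN, rmorph1) /= ?mmapXi ?mmapC ?tnth3 /=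
    ?(mul0r, mulr0, add0r, addr0, mul1r, mulr1, subr0, oppr0, oner_neq0, pnatr_eq0) //.

Lemma rational_cayley : rational_map cayley.
Proof.
by apply: (@rational_map3 _ _ _ _ 2); [exact: (dhomogM (hD _ _) (hB _ _))|exact: (dhomogM (hD _ _) (hB _ _))|
  exact: (dhomogM (hB _ _) (hB _ _))|nz3].
Qed.

Lemma rational_cayley_inv : rational_map cayley_inv.
Proof.
by apply: (@rational_map3 _ _ _ _ 2); [exact: (dhomogM (hB _ _) (hD _ _))|exact: (dhomogM (hB _ _) (hD _ _))|
  exact: (dhomogM (hD _ _) (hD _ _))|nz3].
Qed.

Lemma cayleyK i : tnth cayley i \mPo cayley_inv = 4%:R * z * (x + z) * (y + z) * 'X_i.
Proof. by elim/ord3P: i; rewrite /cayley /cayley_inv !compE; ring. Qed.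

Lemma cayley_invK i : tnth cayley_inv i \mPo cayley = 4%:R * z * (z - x) * (z - y) * 'X_i.
Proof. by elim/ord3P: i; rewrite /cayley /cayley_inv !compE; ring. Qed.

Let nzK : 4%:R * z * (x + z) * (y + z) != 0. Proof. by nz3. Qed.
Let nzK' : 4%:R * z * (z - x) * (z - y) != 0. Proof. by nz3. Qed.

Lemma represents_cayley : exists phi : Cremona C,
  represents phi cayley /\ represents (phi^-1)%g cayley_inv.
Proof.
have [phi rp] := birational_represents (birational_intro rational_cayley
  rational_cayley_inv nzK nzK' cayleyK cayley_invK).
have [psi rq] := birational_represents (birational_intro rational_cayley_inv
  rational_cayley nzK' nzK cayley_invK cayleyK).
exists phi; split; first exact: rp.
suff -> : (phi^-1 = psi)%g by exact: rq.
apply: mulg1_eq; apply: (@represents_eq _ _ _ (id_triple C)); last exact: represents1.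
apply: (same_represents (represents_mul rp rq)); first exact: rational_id.
apply: (@same_map_scale _ _ _ 1 (4%:R * z * (x + z) * (y + z))); first exact: oner_neq0.
by move=> i; rewrite tnth_comp cayleyK tnth_mktuple mul1r.
Qed.

(** In affine coordinates the triple is (y, 1/x), the standard image of S. *)
Lemma represents_standard_S phi s : represents phi cayley ->
  represents (phi^-1)%g cayley_inv -> represents s (S_triple C) ->
  represents (phi * s * phi^-1)%g [tuple x * y; z * z; x * z].
Proof.
move=> rp rq rs.
apply: (same_represents (represents_mul (represents_mul rp rs) rq)).
  apply: (@rational_map3 _ _ _ _ 2); try exact: (dhomogM (hX _) (hX _)).
  by rewrite mulf_neq0 // mpolyXi_neq0.
apply: (@same_map_scale _ _ _ 1 (4%:R * (x + z) * (y + z))); first exact: oner_neq0.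
by apply: ord3P; rewrite !tnth_comp /cayley /cayley_inv /S_triple !compE; ring.
Qed.

Lemma same_map3 (k a b c a' b' c' : mp3) : a = k * a' -> b = k * b' -> c = k * c' ->
  same_map [tuple a; b; c] [tuple a'; b'; c'].
Proof.
move=> ea eb ec; apply: (@same_map_scale _ _ _ 1 k); first exact: oner_neq0.
by apply: ord3P; rewrite mul1r !tnth3.
Qed.

Lemma cayley_comp (a b c : mp3) : comp_triple cayley [tuple a; b; c] =
  [tuple (c + a) * (c - b); (c + b) * (c - a); (c - a) * (c - b)].
Proof. by rewrite comp_triple3 !compE. Qed.

(** For e = 1 the first component (x + y) / (1 + x y) is the addition law of tanh, which the Cayley
    map turns into multiplication; the result is (x y, y). *)
Lemma represents_standard_R phi r : represents phi cayley ->
  represents (phi^-1)%g cayley_inv -> represents r (R_triple (1 : C)) ->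
  represents (phi * r * phi^-1)%g [tuple x * y; y * z; z * z].
Proof.
move=> rp rq rr.
have rpr : represents (phi * r)%g
    [tuple (z + x) * (z + y); (z + y) * (z - x); (z - x) * (z - y)].
  apply: (same_represents (represents_mul rp rr)).
    apply: (@rational_map3 _ _ _ _ 2); [exact: (dhomogM (hD _ _) (hD _ _))|
      exact: (dhomogM (hD _ _) (hB _ _))|exact: (dhomogM (hB _ _) (hB _ _))|by nz3].
  rewrite /R_triple cayley_comp mpolyC1.
  by apply: (@same_map3 (z * (z * z + x * y) * (z - y))); ring.
apply: (same_represents (represents_mul rpr rq)).
  apply: (@rational_map3 _ _ _ _ 2); try exact: (dhomogM (hX _) (hX _)).
  by rewrite mulf_neq0 // mpolyXi_neq0.
apply: (@same_map_scale _ _ _ 1 (4%:R * (x + z) * (y + z))); first exact: oner_neq0.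
by apply: ord3P; rewrite /cayley_inv !compE; ring.
Qed.

Lemma ratX_neq0 : ratX C != 0.
Proof. by rewrite tofrac_eq0 -msupp_eq0 msuppX. Qed.
Lemma ratY_neq0 : ratY C != 0.
Proof. by rewrite tofrac_eq0 -msupp_eq0 msuppX. Qed.

Lemma monomialM (F : fieldType) (a b : F) (i j k l : int) : a != 0 -> b != 0 ->
  a ^ (i + j) * b ^ (k + l) = (a ^ i * b ^ k) * (a ^ j * b ^ l).
Proof. by move=> a0 b0; rewrite !expfzDr // mulrACA. Qed.

Lemma standard_affine (f : {multiplicative SL2Z -> Cremona C}) :
  represents (f SL2Z_S) [tuple x * y; z * z; x * z] ->
  represents (f SL2Z_R) [tuple x * y; y * z; z * z] -> is_standard f.
Proof.
move=> rS rR; rewrite /is_standard; elim/SL2Z_ind => [|M IH|M IH].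
- rewrite multiplicative1 (affine_mapE (represents1 C)) !tnth_mktuple !dehomogE !divr1.
  by rewrite SL2Z_1E !mx2_entries !expr0z !expr1z mulr1 mul1r.
- have [-> -> -> ->] : [/\ (SL2Z_S * M)%g 0 0 = M 1 0, (SL2Z_S * M)%g 0 1 = M 1 1,
      (SL2Z_S * M)%g 1 0 = - M 0 0 & (SL2Z_S * M)%g 1 1 = - M 0 1].
    by rewrite SL2Z_mulE [X in _ *m X]mx2E SL2Z_SE mx2_mul !mx2_entries; split; ring.
  rewrite gmulfM (affine_map_mul rS IH) !tnth3 !rmorphM /= !mmapXi /aff !tnth3.
  set X := _ ^ M 0 0 * _; set Y := _ ^ M 1 0 * _.
  have X0 : X != 0.
    by apply: mulf_neq0; apply: expfz_neq0; [exact: ratX_neq0|exact: ratY_neq0].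
  congr (_, _); first by rewrite mulr1 mulrAC divff // mul1r.
  by rewrite !mulr1 div1r /X invfM !invr_expz.
- have [-> -> -> ->] : [/\ (SL2Z_R * M)%g 0 0 = M 0 0 + M 1 0,
      (SL2Z_R * M)%g 0 1 = M 0 1 + M 1 1, (SL2Z_R * M)%g 1 0 = M 1 0 &
      (SL2Z_R * M)%g 1 1 = M 1 1].
    by rewrite SL2Z_mulE [X in _ *m X]mx2E SL2Z_RE mx2_mul !mx2_entries; split; ring.
  rewrite gmulfM (affine_map_mul rR IH) !tnth3 !rmorphM /= !mmapXi /aff !tnth3.
  rewrite (monomialM (M 0 0) (M 1 0) (M 0 1) (M 1 1) ratX_neq0 ratY_neq0).
  by congr (_, _); rewrite mulr1 ?mulr1 divr1.
Qed.

Lemma conj_mulg (G : groupType) (p a b : G) :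
  (p * (a * b) * p^-1 = (p * a * p^-1) * (p * b * p^-1))%g.
Proof. by rewrite !mulgA mulgVK. Qed.

(** The standard embedding is built as a conjugate of one theta_1; every other homomorphism
    satisfying [is_theta 1] agrees with it by [SL2Z_multiplicative_uniq]. *)
Lemma standard_conjugate : exists theta_s : {multiplicative SL2Z -> Cremona C},
  is_standard theta_s /\
  forall theta1 : {multiplicative SL2Z -> Cremona C}, is_theta 1 theta1 ->
    exists phi : Cremona C, forall M, theta_s M = (phi * theta1 M * phi^-1)%g.
Proof.
have [theta tP] := theta_exists (@ltr01 R).
have [rr rs] := theta_generators ltr01 tP.
have [phi [rp rq]] := represents_cayley.
pose f M := (phi * theta M * phi^-1)%g.
have fM : {morph f : M N / (M * N)%g}.
  by move=> M N; rewrite /f gmulfM; exact: conj_mulg.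
pose theta_s : {multiplicative SL2Z -> Cremona C} :=
  HB.pack f (isMultiplicative.Build _ _ f fM).
exists theta_s; split.
  exact: (@standard_affine theta_s (represents_standard_S rp rq rs)
    (represents_standard_R rp rq rr)).
move=> theta1 tP1; exists phi => M.
have [rr1 rs1] := theta_generators ltr01 tP1.
rewrite (@SL2Z_multiplicative_uniq _ theta1 theta) //.
- exact: represents_eq rr1 rr.
- exact: represents_eq rs1 rs.
Qed.

End Standard.

Theorem theorem1 (R : realType) :
  [/\ (* (1) *)
      forall e : R, 0 < e ->
        exists theta : {multiplicative SL2Z -> Cremona R[i]},
          [/\ is_theta e theta, injective theta & preserves_type theta],
      (* (2) *)
      forall (e e' : R) (theta theta' : {multiplicative SL2Z -> Cremona R[i]}),
        0 < e -> 0 < e' -> e <> e' -> e * e' <> 1 ->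
        is_theta e theta -> is_theta e' theta' ->
        ~ exists phi : Cremona R[i],
            [set (phi * f * phi^-1)%g | f in range theta] = range theta'
    & (* (3) *)
      exists theta_s : {multiplicative SL2Z -> Cremona R[i]},
        is_standard theta_s /\
        forall theta1 : {multiplicative SL2Z -> Cremona R[i]},
          is_theta 1 theta1 ->
          exists phi : Cremona R[i],
            forall M, theta_s M = (phi * theta1 M * phi^-1)%g].
Proof.
split.
- move=> e e0; have [theta tP] := theta_exists e0.
  by exists theta; split=> //; [exact: theta_injective tP|exact: theta_preserves_type tP].
- by move=> e e' theta theta'; exact: nonconjugate.
- exact: standard_conjugate.
Qed.
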